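(* Let $n\ge 3$ and let $f$ be an isoparametric function on the round sphere $(\mathbb{S}^n,g_0^n)$ whose level hypersurfaces have $\ell$ distinct principal curvatures with multiplicities $m_1,m_2$. Put $p_n=\frac{n+2}{n-2}$ and $h(r)=\frac{m_1+m_2}{2}\cos r-\frac{m_2-m_1}{2}$. If $m_1<n-1$ and $m_2<n-1$, then the equation $$w''(r)+\frac{h(r)}{\sin r}\,w'(r)+\frac{n(n-2)}{4\ell^2}\left[|w(r)|^{p_n-1}w(r)-w(r)\right]=0\quad\text{on }[0,\pi],$$ with boundary conditions $w'(0)=w'(\pi)=0$, admits a sequence of sign-changing solutions $(w_k)_{k\ge 1}$ such that, for every positive integer $k$, $w_k$ has exactly $k$ zeroes in $[0,\pi]$.
   Context: A smooth function $f$ on a Riemannian manifold $(M,g)$ is isoparametric if there are a continuous function $a$ and a smooth function $b$ with $|\nabla f|_g^2=b\circ f$ and $\Delta_g f=a\circ f$. Here $g_0^n$ is the round metric on $\mathbb{S}^n$. On $\mathbb{S}^n$, $f$ is taken to be (the restriction of) a Cartan–Münzner polynomial, with image $[-1,1]$: its regular level sets are connected hypersurfaces with the same number $\ell$ of distinct constant principal curvatures, $\ell\in\{1,2,3,4,6\}$; the principal curvatures have at most two different multiplicities $m_1,m_2$ (with $m_1=m_2$ if $\ell$ is odd), $\frac{m_1+m_2}{2}=\frac{n-1}{\ell}$, and $$|\nabla f|^2=\ell^2(1-f^2),\qquad \Delta_{g_0^n}f=-\ell(n+\ell-1)f+\frac{\ell^2(m_2-m_1)}{2}.$$ A solution of the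 boundary value problem is a $C^2$ function on $[0,\pi]$ satisfying the equation on $(0,\pi)$ and the stated boundary conditions at the two singular endpoints. *)

(* Defs.v *)
From HB Require Import structures.
From mathcomp Require Import all_boot all_order all_algebra.
From mathcomp Require mpoly.

Set Implicit Arguments.
Unset Strict Implicit.
Unset Printing Implicit Defensive.

Import Order.TTheory GRing.Theory Num.Theory.

Local Open Scope ring_scope.

Section Euclidean.
Context {R : rcfType} {d : nat}.
Implicit Types (x y : 'rV[R]_d).

(* Explicit Euclidean norm: the analysis library equips 'rV[R]_d with the sup
   norm. *)
Definition sqnorm x : R := \sum_(i < d) x ord0 i ^+ 2.

Definition enorm x : R := Num.sqrt (sqnorm x).

End Euclidean.

(* The notations of mpoly clash with those of the analysis library, hence its
   import is confined to this module. *)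
Module CartanMunzner.
Import mpoly.

Section CartanMunzner.
Context {R : rcfType} {d : nat}.

Definition eval (F : {mpoly R[d]}) (x : 'rV[R]_d) : R := F.@[x ord0].

(* |grad F|^2 = l^2 |x|^(2l-2) and Delta F = l^2 (m2 - m1) / 2 |x|^(l-2) for F
   homogeneous of degree l.  For l = 1 the truncated exponent l - 2 is
   harmless: m1 = m2 in isoparametric_data, so the right-hand side is 0. *)
Definition cartan_munzner (l m1 m2 : nat) (F : {mpoly R[d]}) : Prop :=
  [/\ F \is l.-homog,
      forall x, \sum_(i < d) eval F^`M(i) x ^+ 2
                = l%:R ^+ 2 * sqnorm x ^+ (l - 1) &
      forall x, \sum_(i < d) eval F^`M(i)^`M(i) x
                = l%:R ^+ 2 * (m2%:R - m1%:R) / 2 * enorm x ^+ (l - 2)].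

(* f coincides on the unit sphere with such an F. *)
Definition restricts_cartan_munzner (l m1 m2 : nat) (f : 'rV[R]_d -> R) : Prop :=
  exists2 F : {mpoly R[d]}, cartan_munzner l m1 m2 F &
    forall x, sqnorm x = 1 -> f x = eval F x.

End CartanMunzner.
End CartanMunzner.

From mathcomp Require Import all_classical all_reals all_analysis.
Import CartanMunzner.
Import numFieldNormedType.Exports.

Local Open Scope classical_set_scope.

Section Smooth.
Context {R : realType} {n : nat}.
Implicit Types (g : 'rV[R]_n.+1 -> R).

Definition pderiv (i : 'I_n.+1) g : 'rV[R]_n.+1 -> R :=
  fun x => 'D_(delta_mx ord0 i) g x.

Definition iter_pderiv (s : seq 'I_n.+1) g : 'rV[R]_n.+1 -> R :=
  foldr pderiv g s.

Definition smooth_on (U : set 'rV[R]_n.+1) g : Prop :=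
  forall (s : seq 'I_n.+1) (x : 'rV[R]_n.+1), U x ->
    {for x, continuous (iter_pderiv s g)} /\
    forall i, derivable (iter_pderiv s g) x (delta_mx ord0 i).

End Smooth.

Definition smooth_real {R : realType} (b : R -> R) : Prop :=
  forall (k : nat) (t : R), derivable (derive1n k b) t 1.

(* A function on the round sphere S^n is encoded by an f : 'rV[R]_n.+1 -> R of
   which only the values at unit vectors matter: every notion below depends on
   f only through its 0-homogeneous extension x |-> f (x / |x|).  At a unit
   vector, the Euclidean gradient, the Hessian on tangent vectors and the
   Laplacian of this extension are the Riemannian gradient, Hessian and
   Laplace-Beltrami operator of f for the round metric. *)
Section Sphere.
Context {R : realType} {n : nat}.
Implicit Types (f : 'rV[R]_n.+1 -> R) (x : 'rV[R]_n.+1) (c lam : R).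

Definition sphere : set 'rV[R]_n.+1 := [set x | sqnorm x = 1].

Definition radial_ext f : 'rV[R]_n.+1 -> R :=
  fun x => f ((enorm x)^-1 *: x).

Definition smooth_on_sphere f : Prop :=
  smooth_on [set x | x != 0] (radial_ext f).

Definition sgrad f x : 'rV[R]_n.+1 := \row_i pderiv i (radial_ext f) x.

Definition shess f x : 'M[R]_n.+1 :=
  \matrix_(i, j) iter_pderiv [:: i; j] (radial_ext f) x.

Definition slaplacian f x : R := \tr (shess f x).

Definition isoparametric f : Prop :=
  smooth_on_sphere f /\
  exists a b : R -> R,
    [/\ continuous a, smooth_real b,
        forall x, sphere x -> sqnorm (sgrad f x) = b (f x) &
        forall x, sphere x -> slaplacian f x = a (f x)].

Definition level f c : set 'rV[R]_n.+1 := [set x | sphere x /\ f x = c].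

Definition regular_level f c : Prop :=
  level f c !=set0 /\ forall x, level f c x -> sgrad f x != 0.

(* Orthogonal projection of R^(n+1) onto the tangent space at x of the level
   set of f through x, i.e. onto the orthogonal of the two orthogonal vectors
   x and sgrad f x. *)
Definition level_proj f x : 'M[R]_n.+1 :=
  1%:M - x^T *m x
       - (sqnorm (sgrad f x))^-1 *: ((sgrad f x)^T *m sgrad f x).

(* Shape operator of that level set for the unit normal sgrad f / |sgrad f|,
   extended by 0 to the normal directions and acting on row vectors. *)
Definition shape_operator f x : 'M[R]_n.+1 :=
  - (enorm (sgrad f x))^-1 *:
    (level_proj f x *m shess f x *m level_proj f x).

(* Dimension of the lam-eigenspace of the shape operator in the tangent space
   of the level set; it is 0 if lam is not a principal curvature at x. *)
Definition curvature_mult f x lam : nat :=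
  \rank (eigenspace (shape_operator f x) lam :&: level_proj f x)%MS.

Definition principal_curvature f x lam : Prop := (0 < curvature_mult f x lam)%N.

Definition constant_principal_curvatures f (l m1 m2 : nat) c : Prop :=
  exists (lam : 'I_l -> R) (mu : 'I_l -> nat),
    [/\ injective lam,
        forall x, level f c x -> principal_curvature f x = range lam,
        forall x i, level f c x -> curvature_mult f x (lam i) = mu i &
        range mu = [set m1; m2]].

Record isoparametric_data (l m1 m2 : nat) f : Prop := IsoparametricData {
  isop_isoparametric : isoparametric f;
  isop_polynomial : restricts_cartan_munzner l m1 m2 f;
  isop_image : f @` sphere = `[-1, 1];
  isop_number : l \in [:: 1; 2; 3; 4; 6]%N;
  isop_connected : forall c, regular_level f c -> connected (level f c);
  isop_curvatures : forall c, regular_level f c ->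
    constant_principal_curvatures f l m1 m2 c;
  isop_odd : odd l -> m1 = m2;
  isop_mult : (m1%:R + m2%:R) / 2 = (n%:R - 1) / l%:R :> R;
  isop_grad : forall x, sphere x ->
    sqnorm (sgrad f x) = l%:R ^+ 2 * (1 - f x ^+ 2);
  isop_laplacian : forall x, sphere x ->
    slaplacian f x = - (l%:R * (n%:R + l%:R - 1) * f x)
                     + l%:R ^+ 2 * (m2%:R - m1%:R) / 2
}.

End Sphere.

Section BoundaryValueProblem.
Context {R : realType}.
Implicit Types (A : set R) (w : R -> R).

(* Derivative relative to A, hence one-sided at the endpoints of an interval. *)
Definition derivative_on A (f f' : R -> R) : Prop :=
  forall x, A x ->
    (f y - f x) / (y - x) @[y --> within A (dnbhs x)] --> f' x.

Definition crit_exp (n : nat) : R := (n%:R + 2) / (n%:R - 2).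

Definition ode_h (m1 m2 : nat) (r : R) : R :=
  (m1%:R + m2%:R) / 2 * cos r - (m2%:R - m1%:R) / 2.

Definition bvp_solution (n l m1 m2 : nat) w : Prop :=
  exists w' w'' : R -> R,
    [/\ derivative_on `[0, pi] w w',
        derivative_on `[0, pi] w' w'',
        {within `[0, pi], continuous w''},
        forall r : R, 0 < r < pi ->
          w'' r + ode_h m1 m2 r / sin r * w' r
          + n%:R * (n%:R - 2) / (4 * l%:R ^+ 2)
            * (`|w r| `^ (crit_exp n - 1) * w r - w r) = 0 &
        w' 0 = 0 /\ w' pi = 0].

Definition sign_changing w : Prop :=
  exists r s : R,
    [/\ 0 <= r <= pi, 0 <= s <= pi, w r < 0 & 0 < w s].

Definition zeros w : set R := [set r | 0 <= r <= pi /\ w r = 0].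

End BoundaryValueProblem.

(* Main.v *)
Require Import Defs.
From mathcomp Require Import all_boot all_order all_algebra.
From mathcomp Require Import ring lra.
From mathcomp Require Import all_classical all_reals all_analysis.

Set Implicit Arguments.
Unset Strict Implicit.
Unset Printing Implicit Defensive.

Import Order.TTheory GRing.Theory Num.Theory.
Import numFieldNormedType.Exports.

Local Open Scope classical_set_scope.
Local Open Scope card_scope.
Local Open Scope ring_scope.

(** Let A r = sin (r/2) ^ m1 * cos (r/2) ^ m2. Its logarithmic derivative is h / sin, so
   the equation reads (A w')' + A g w = 0 with g x = lam (|x| ^ a x - x), a = 4 / (n - 2)
   and lam = n (n - 2) / (4 l ^ 2). The two singular endpoints look like centres of balls
   of dimension m1 + 1 and m2 + 1, and the hypothesis m_i < n - 1 means
   a (m_i - 1) < 4: the power is subcritical in both dimensions.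

   The solutions are found by shooting. On [eps, pi - eps] the system u' = v / A,
   v' = - A (g u) is regular; it is solved from u eps = d, v eps = 0, and th denotes the
   polar angle of (u, - v), with th eps = 0. The angle passes the odd multiples of pi / 2
   only upwards, and it meets them exactly at the zeros of u. If th (pi - eps) = k pi, then
   u has exactly k zeros and a horizontal tangent at pi - eps. For d = 1 the solution is
   constant and the angle stays 0; if the angle exceeds k pi for some large d = D, then
   continuity in d gives a solution with k zeros and 1 <= d <= D (shooting).

   Passing to the limit eps -> 0 needs a bound D that is independent of eps (many_zeros).
   A solution of height d keeps the height d / 2 on a length of order d ^ (- a / 2). On this
   plateau the Pohozaev function A (t E) + c u v, where E is the energy, gains a multiple
   of d to the power a + 2 - (m1 + 1) a / 2. This exponent is positive by
   subcriticality, and the Pohozaev function loses only a bounded amount afterwards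
   and is bounded by the energy. Hence E is large at a fixed distance from the endpoint
   (energy_blowup). Large energy forces a zero in every interval of a given length,
   because the logarithmic slope - u' / u satisfies a Riccati equation whose solutions
   blow up (zero_of_energy). Read from right to left, the same argument shows
   that u has too many zeros unless its height at pi - eps is at most D. The energy is largest at an end, so the solutions are bounded
   uniformly in eps (bounded_of_end_heights).

   Along an ultrafilter the solutions converge to a solution on the open interval, with
   end values (limit_solution). The value at 0 is at least 1. The value at pi
   is nonzero, since zero data at a singular endpoint force the zero solution
   (singular_unique). Thus neither the limit nor its approximations have zeros near the
   ends, and in between close solutions make the same number of half turns, so that the
   limit has exactly k zeros (nodal_limit). At 0 the
   quotient u' / t tends to - g (u 0) / (1 + m1), and similarly at pi, which makes the
   limit twice continuously differentiable up to the boundary (end_regularity). *)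

(** * Calculus of one variable *)

Section Calculus.
Context {R : realType}.
Implicit Types (f g : R -> R) (a b c s t x : R).

(** Pointwise forms of the derivative rules: a derivative is computed by
   assembling a proof term, whose value der_eq then adjusts. *)
Lemma der_add f g t a b : is_derive t 1 f a -> is_derive t 1 g b ->
  is_derive t 1 (fun x => f x + g x) (a + b).
Proof. by move=> hf hg; exact: is_deriveD. Qed.

Lemma der_opp f t a : is_derive t 1 f a -> is_derive t 1 (fun x => - f x) (- a).
Proof. by move=> hf; exact: is_deriveN. Qed.

Lemma der_sub f g t a b : is_derive t 1 f a -> is_derive t 1 g b ->
  is_derive t 1 (fun x => f x - g x) (a - b).
Proof. by move=> hf hg; exact: is_deriveB. Qed.

Lemma der_mul f g t a b : is_derive t 1 f a -> is_derive t 1 g b ->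
  is_derive t 1 (fun x => f x * g x) (a * g t + f t * b).
Proof.
move=> hf hg; have := is_deriveM hf hg; rewrite /GRing.scale /= => h.
by apply: is_derive_eq h _; ring.
Qed.

Lemma der_exp f t a n : is_derive t 1 f a ->
  is_derive t 1 (fun x => f x ^+ n) (n%:R * f t ^+ n.-1 * a).
Proof.
move=> hf; have -> : (fun x => f x ^+ n) = f ^+ n.
  by apply/funext => x /=; rewrite fctE.
by have := is_deriveX n hf.
Qed.

Lemma der_inv f t a : f t != 0 -> is_derive t 1 f a ->
  is_derive t 1 (fun x => (f x)^-1) (- a / f t ^+ 2).
Proof.
move=> ft0 hf; have h := is_deriveV ft0 hf; apply: is_derive_eq h _.
by rewrite /GRing.scale /= !mulNr mulrC.
Qed.

Lemma der_comp f g t a b : is_derive (f t) 1 g b -> is_derive t 1 f a ->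
  is_derive t 1 (fun x => g (f x)) (b * a).
Proof. by move=> hg hf; exact: is_derive1_comp. Qed.

Lemma der_cst c t : is_derive t 1 (fun _ : R => c) 0.
Proof. exact: is_derive_cst. Qed.

Lemma der_id t : is_derive t 1 (fun x : R => x) 1.
Proof. exact: is_derive_id. Qed.

Lemma der_eq f t a b : is_derive t 1 f a -> a = b -> is_derive t 1 f b.
Proof. by move=> h <-. Qed.

Lemma der_continuous f t a : is_derive t 1 f a -> {for t, continuous f}.
Proof. by move=> [+ _] => /derivable1_diffP/differentiable_continuous. Qed.

Lemma within_of_for f a b :
  (forall t, a <= t <= b -> {for t, continuous f}) ->
  {within `[a, b], continuous f}.
Proof.
move=> h; apply: continuous_in_subspaceT => x; rewrite inE /= in_itv /= => hx.
exact: h.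
Qed.

Lemma der_within f f' a b :
  (forall t, a <= t <= b -> is_derive t 1 f (f' t)) ->
  {within `[a, b], continuous f}.
Proof. move=> h; apply: within_of_for => t /h; exact: der_continuous. Qed.

Lemma mean_value f f' a b : a <= b ->
  (forall t, a <= t <= b -> is_derive t 1 f (f' t)) ->
  exists2 c, a <= c <= b & f b - f a = f' c * (b - a).
Proof.
move=> ab h; have := @MVT_segment R f f' a b ab.
case=> [x|//|c]; first by rewrite in_itv /= => /andP[? ?]; apply: h; rewrite !ltW.
  exact: (@der_within _ f').
by rewrite in_itv /= => hc e; exists c.
Qed.

Lemma ivt f a b v : a <= b ->
  (forall t, a <= t <= b -> {for t, continuous f}) ->
  Num.min (f a) (f b) <= v <= Num.max (f a) (f b) ->
  exists2 c, a <= c <= b & f c = v.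
Proof.
move=> ab hf hv; have [c] := IVT ab (within_of_for hf) hv.
by rewrite in_itv /=; exists c.
Qed.

Lemma der_le f g f' g' a b : a <= b ->
  (forall t, a <= t <= b -> is_derive t 1 f (f' t)) ->
  (forall t, a <= t <= b -> is_derive t 1 g (g' t)) ->
  (forall t, a <= t <= b -> f' t <= g' t) -> f b - f a <= g b - g a.
Proof.
move=> ab hf hg le.
have [c hc e] : exists2 c, a <= c <= b &
    (g b - f b) - (g a - f a) = (g' c - f' c) * (b - a).
  apply: (@mean_value (fun x => g x - f x) (fun x => g' x - f' x)) => // t ht.
  by apply: der_sub; [exact: hg|exact: hf].
have : 0 <= (g' c - f' c) * (b - a).
  by apply: mulr_ge0; rewrite subr_ge0 // le.
lra.
Qed.

Lemma der_nondecreasing f f' a b : a <= b ->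
  (forall t, a <= t <= b -> is_derive t 1 f (f' t)) ->
  (forall t, a <= t <= b -> 0 <= f' t) -> f a <= f b.
Proof.
move=> ab hf le.
have := @der_le (fun=> 0) f (fun=> 0) f' a b ab (fun t _ => der_cst 0 t) hf le.
lra.
Qed.

Lemma der_nonincreasing f f' a b : a <= b ->
  (forall t, a <= t <= b -> is_derive t 1 f (f' t)) ->
  (forall t, a <= t <= b -> f' t <= 0) -> f b <= f a.
Proof.
move=> ab hf le.
have := @der_le f (fun=> 0) f' (fun=> 0) a b ab hf (fun t _ => der_cst 0 t) le.
lra.
Qed.

Lemma der_norm_le f g f' g' a b : a <= b ->
  (forall t, a <= t <= b -> is_derive t 1 f (f' t)) ->
  (forall t, a <= t <= b -> is_derive t 1 g (g' t)) ->
  (forall t, a <= t <= b -> `|f' t| <= g' t) -> `|f b - f a| <= g b - g a.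
Proof.
move=> ab hf hg le; rewrite ler_norml; apply/andP; split; last first.
  apply: (der_le ab hf hg) => t ht; exact: le_trans (ler_norm _) (le t ht).
have := @der_le (fun x => - f x) g (fun t => - f' t) g' a b ab.
have -> : - f b - - f a = - (f b - f a) by ring.
rewrite lerNl; apply=> // t ht; first by apply: der_opp; exact: hf.
by rewrite (le_trans (ler_norm _)) // normrN le.
Qed.

Lemma der_lin c t : is_derive t 1 (fun x : R => c * x) c.
Proof. by apply: der_eq (der_mul (der_cst c t) (der_id t)) _; ring. Qed.

Lemma der_expR_lin c s t :
  is_derive t 1 (fun x : R => expR (c * (x - s))) (c * expR (c * (t - s))).
Proof.
have h := der_mul (der_cst c t) (der_sub (der_id t) (der_cst s t)).
by apply: der_eq (@der_comp (fun x => c * (x - s)) expR _ _ _ (is_derive_expR _) h) _; ring.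
Qed.

(** The product of f with expR (- c t) is nonincreasing. *)
Lemma gronwall_le f f' c a b : a <= b ->
  (forall t, a <= t <= b -> is_derive t 1 f (f' t)) ->
  (forall t, a <= t <= b -> f' t <= c * f t) ->
  f b <= f a * expR (c * (b - a)).
Proof.
move=> ab hf le.
have : f b * expR ((- c) * (b - a)) <= f a * expR (- c * (a - a)).
  apply: (@der_nonincreasing (fun x => f x * expR (- c * (x - a)))
           (fun t => f' t * expR (- c * (t - a)) +
                     f t * (- c * expR (- c * (t - a)))) a b ab) => t ht.
    by apply: der_mul; [exact: hf|exact: der_expR_lin].
  have -> : f' t * expR (- c * (t - a)) + f t * (- c * expR (- c * (t - a)))
     = - ((c * f t - f' t) * expR (- c * (t - a))) by ring.
  by rewrite oppr_le0 mulr_ge0 ?expR_ge0 // subr_ge0 le.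
rewrite subrr mulr0 expR0 mulr1 mulNr expRN.
by rewrite ler_pdivrMr ?expR_gt0.
Qed.

Lemma gronwall_ge f f' c a b : a <= b ->
  (forall t, a <= t <= b -> is_derive t 1 f (f' t)) ->
  (forall t, a <= t <= b -> - (c * f t) <= f' t) ->
  f a <= f b * expR (c * (b - a)).
Proof.
move=> ab hf le.
have : f a * expR (c * (a - a)) <= f b * expR (c * (b - a)).
  apply: (@der_nondecreasing (fun x => f x * expR (c * (x - a)))
           (fun t => f' t * expR (c * (t - a)) +
                     f t * (c * expR (c * (t - a)))) a b ab) => t ht.
    by apply: der_mul; [exact: hf|exact: der_expR_lin].
  have -> : f' t * expR (c * (t - a)) + f t * (c * expR (c * (t - a)))
     = (f' t + c * f t) * expR (c * (t - a)) by ring.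
  rewrite mulr_ge0 ?expR_ge0 //; have := le t ht; lra.
by rewrite subrr mulr0 expR0 mulr1.
Qed.

Lemma difference_quotient f x (d e : R) : is_derive x 1 f d -> 0 < e ->
  exists2 r, 0 < r & forall y, 0 < `|y - x| < r -> `|(f y - f x) / (y - x) - d| < e.
Proof.
move=> [df <-] e0.
have : h^-1 *: (f (h *: 1 + x) - f x) @[h --> 0^'] --> 'D_1 f x by exact: df.
move=> /cvgr_dist_lt /(_ _ e0) /nbhs_ballP[r /= r0 hr].
exists r => // y /andP[y0 yr].
have := hr (y - x); rewrite /ball /= sub0r normrN => /(_ yr).
rewrite -normr_gt0 => /(_ y0).
by rewrite /GRing.scale /= mulr1 subrK mulrC distrC.
Qed.

(** If f reached M, the step would fail at the first time where f equals M. *)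
Lemma continuous_induction f M a b :
  (forall t, a <= t <= b -> {for t, continuous f}) -> f a < M ->
  (forall t, a <= t <= b -> (forall s, a <= s <= t -> f s <= M) -> f t < M) ->
  forall t, a <= t <= b -> f t < M.
Proof.
move=> cf fa step t /andP[at_ tb]; rewrite ltNge; apply/negP => Mt.
have hit s : a <= s <= b -> M <= f s -> exists2 x, a <= x <= s & f x = M.
  move=> /andP[as_ sb] Ms; apply: ivt as_ _ _; last by rewrite ge_min le_max (ltW fa) Ms orbT.
  by move=> x /andP[ax xs]; apply: cf; rewrite ax (le_trans xs).
pose S := [set x | a <= x <= b /\ f x = M].
have infS : has_inf S.
  have [|x /andP[ax xt] fx] := hit t _ Mt; first by rewrite at_.
  split; first by exists x; split; rewrite // ax (le_trans xt).
  by exists a => y [/andP[]].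
pose T := inf S.
have below x : S x -> T <= x by apply: (ge_inf infS.2).
have hT : a <= T <= b.
  have [x Sx] := infS.1; rewrite (le_trans (below x Sx)); last by have [/andP[]] := Sx.
  by rewrite andbT; apply: lb_le_inf infS.1 _ => y [/andP[]].
have fT : f T = M.
  apply/eqP; rewrite -subr_eq0 -normr_le0 leNgt; apply/negP => e0.
  have := cf T hT => /cvgr_dist_lt /(_ _ e0) /nbhs_ballP[d /= d0 hd].
  have [x Sx xT] := inf_adherent d0 infS.
  have : `|f T - f x| < `|f T - M|; last by rewrite Sx.2 ltxx.
  by apply: hd; rewrite /ball /= distrC ger0_norm ?subr_ge0 ?below // ltrBlDl.
have : f T < M; last by rewrite fT ltxx.
apply: step => // s /andP[as_ sT]; rewrite leNgt; apply/negP => Ms.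
have sb : s <= b by have /andP[_] := hT; exact: le_trans.
have [|x /andP[ax xs] fx] := hit s _ (ltW Ms); first by rewrite as_.
have xS : S x by split; rewrite // ax (le_trans xs).
have xs' : x = s by apply: le_anti; rewrite xs (le_trans sT (below x xS)).
by move: Ms; rewrite -xs' fx ltxx.
Qed.

End Calculus.

(** * Primitives and global solutions of Lipschitz systems *)

Section Primitive.
Context {R : realType}.
Implicit Types (f g : R -> R) (a b c s t x y e B K L u v : R).

(** Integrals start at - N rather than at 0, so that a single formula covers
   both sides of 0. *)
Let Q f N t := (\int[lebesgue_measure]_(x in `[- N, t]) f x)%R.

Let derQ f N t : continuous f -> - N < t -> is_derive t 1 (Q f N) (f t).
Proof.
move=> cf Nt.
have tu : t < t + 1 by rewrite ltrDl.
have fi : lebesgue_measure.-integrable `[- N, t + 1] (EFin \o f).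
  apply: continuous_compact_integrable; first exact: segment_compact.
  exact: continuous_subspaceT.
have [d e] := continuous_FTC1_closed tu fi Nt (cf t).
by split; [exact: d|rewrite -derive1E; exact: e].
Qed.

Lemma der_near f g t d e : 0 < e ->
  (forall x, `|t - x| < e -> f x = g x) -> is_derive t 1 f d -> is_derive t 1 g d.
Proof.
move=> e0 h; apply: near_eq_is_derive.
by apply/nbhs_ballP; exists e => // x /h ->.
Qed.

(** Where both are defined, the integrals from - M and from - N differ by a
   constant; subtracting the value at 0 therefore glues them, with a lower limit
   that follows t. *)
Lemma primitive f : continuous f ->
  exists P, P 0 = 0 /\ forall t, is_derive t 1 P (f t).
Proof.
move=> cf.
have indep N M t : 0 < N -> N <= M -> - N < t ->
    Q f M t - Q f M 0 = Q f N t - Q f N 0.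
  move=> N0 NM Nt.
  have h x : - N < x -> is_derive x 1 (fun y => Q f M y - Q f N y) 0.
    move=> Nx; have MX : - M < x by apply: le_lt_trans Nx; rewrite lerN2.
    by apply: der_eq (der_sub (derQ cf MX) (derQ cf Nx)) _; rewrite subrr.
  suff : Q f M t - Q f N t = Q f M 0 - Q f N 0 by move: (Q f M t) (Q f N t) => x y; clear; lra.
  case: (leP 0 t) => t0.
  - have [] := @mean_value _ (fun y => Q f M y - Q f N y) (fun=> 0) 0 t t0.
      by move=> x /andP[x0 _]; apply: h; lra.
    by move=> c _; rewrite mul0r => /subr0_eq.
  - have [] := @mean_value _ (fun y => Q f M y - Q f N y) (fun=> 0) t 0 (ltW t0).
      by move=> x /andP[x0 _]; apply: h; lra.
    by move=> c _; rewrite mul0r => /subr0_eq.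
exists (fun t => Q f (`|t| + 1) t - Q f (`|t| + 1) 0); split.
  by rewrite subrr.
move=> t; pose N := `|t| + 2.
have tN : - N < t by have := ler_norm (- t); rewrite normrN /N; lra.
apply: (@der_near (fun x => Q f N x - Q f N 0) _ t (f t) 1); first exact: ltr01.
  move=> x hx; apply: indep.
  - by have := normr_ge0 x; lra.
  - by have := lerB_dist x t; rewrite distrC /N; lra.
  - by have := ler_norm (- x); rewrite normrN; lra.
by apply: der_eq (der_sub (derQ cf tN) (der_cst _ t)) _; rewrite subr0.
Qed.

End Primitive.

Section Picard.
Context {R : realType}.
Implicit Types (f g : R -> R) (a b c s t x y e B K L u v : R).

Lemma continuous_maxl f c : (forall t, c <= t -> {for t, continuous f}) ->
  continuous (fun s => f (Num.max s c)).
Proof.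
move=> cf t; apply: (@continuous_comp _ _ _ (fun s => Num.max s c) f).
  by apply: continuous_max => //; exact: cst_continuous.
by apply: cf; rewrite le_max lexx orbT.
Qed.

Lemma half_expr_small B e : 0 < e -> exists n : nat, B * 2^-1 ^+ n < e.
Proof.
move=> e0; pose C := `|B| + 1; have C0 : 0 < C by have := normr_ge0 B; rewrite /C; lra.
have : (fun n : nat => (2^-1 : R) ^+ n) @ \oo --> (0 : R).
  by apply: cvg_expr; rewrite ger0_norm; lra.
move=> /cvgr_dist_lt /(_ (e / C) (divr_gt0 e0 C0)) [n _ /(_ n)].
rewrite /= leqnn => /(_ isT); rewrite sub0r normrN => hn.
exists n; apply: le_lt_trans (_ : C * 2^-1 ^+ n < e).
  by apply: ler_wpM2r; [apply: exprn_ge0; lra|have := ler_norm B; rewrite /C; lra].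
rewrite mulrC -ltr_pdivlMr //; exact: le_lt_trans (ler_norm _) hn.
Qed.

Lemma eq_of_half_expr_le x y B :
  (forall n : nat, `|x - y| <= B * 2^-1 ^+ n) -> x = y.
Proof.
move=> h; apply/eqP; rewrite -subr_eq0 -normr_le0 leNgt; apply/negP => p.
have [n hn] := half_expr_small B p; have := h n; lra.
Qed.

(** The intervals [x n - r n, x n + r n], with r n = 2 B / 2 ^ n the sum of all
   remaining increments, are nested; the limit is the supremum of their left ends. *)
Lemma geometric_limit (x : nat -> R) B :
  (forall n, `|x n.+1 - x n| <= B * 2^-1 ^+ n) ->
  exists l, forall n, `|x n - l| <= 2 * B * 2^-1 ^+ n.
Proof.
move=> h; pose r n := 2 * B * 2^-1 ^+ n : R.
have rS n : r n = 2 * r n.+1 by rewrite /r exprS; field.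
have hr n : - r n.+1 <= x n.+1 - x n <= r n.+1.
  have := h n; rewrite ler_norml => /andP[h1 h2].
  by have : B * 2^-1 ^+ n = r n.+1; [rewrite /r exprS; field|lra].
have dec n m : x (n + m)%N + r (n + m)%N <= x n + r n.
  elim: m => [|m ih]; first by rewrite addn0.
  by rewrite addnS; have := hr (n + m)%N; have := rS (n + m)%N; lra.
have inc n m : x n - r n <= x (n + m)%N - r (n + m)%N.
  elim: m => [|m ih]; first by rewrite addn0.
  by rewrite addnS; have := hr (n + m)%N; have := rS (n + m)%N; lra.
have B0 : 0 <= B by have := h 0; rewrite expr0 mulr1; apply: le_trans.
have r0 n : 0 <= r n by rewrite !mulr_ge0 // exprn_ge0 //; lra.
have zy n m : x n - r n <= x m + r m.
  by have := inc n m; have := dec m n; rewrite [(m + n)%N]addnC; have := r0 (n + m)%N; lra.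
pose S := [set x n - r n | n in [set: nat]].
have supS : has_sup S.
  split; first by exists (x 0 - r 0), 0.
  by exists (x 0 + r 0) => _ [n _ <-].
exists (sup S) => n; rewrite -/(r n) ler_norml; apply/andP; split; last first.
  rewrite lerBlDr addrC -lerBlDr; apply: (ub_le_sup supS.2); by exists n.
have : sup S <= x n + r n; last by lra.
by apply: ge_sup => [|_ [m _ <-]]; [exact: supS.1|exact: zy].
Qed.

(** Integrating against an exponential of rate c gains a factor 1 / c: this makes
   the integral operator below contracting in a weighted norm. *)
Lemma exp_integral_le f f' b c s t : 0 <= b -> 0 < c -> s <= t ->
  (forall r, s <= r <= t -> is_derive r 1 f (f' r)) ->
  (forall r, s <= r <= t -> `|f' r| <= b * expR (c * (r - s))) ->
  `|f t - f s| <= b / c * expR (c * (t - s)).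
Proof.
move=> b0 c0 st hf le.
have := @der_norm_le _ f (fun r => b / c * expR (c * (r - s))) f'
  (fun r => b * expR (c * (r - s))) s t st hf.
have e0 : 0 <= b / c by rewrite divr_ge0 // ltW.
rewrite subrr mulr0 expR0 mulr1 => h.
suff : `|f t - f s| <= b / c * expR (c * (t - s)) - b / c by lra.
apply: h => // r hr.
apply: der_eq (der_mul (der_cst (b / c) r) (der_expR_lin c s r)) _.
by field; rewrite gt_eqF.
Qed.

(** Picard iteration in the norm given by the supremum of |f t| expR (- c (t - t0)).
   For c large the integral operator halves distances on the whole half-line at
   once, so that short-time solutions need not be continued. *)
Lemma global_solution (al be g : R -> R) K L t0 u0 v0 : 0 < K -> 0 <= L ->
  continuous al -> continuous be ->
  (forall t, `|al t| <= K) -> (forall t, `|be t| <= K) ->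
  (forall x y, `|g x - g y| <= L * `|x - y|) ->
  exists u v : R -> R, [/\ u t0 = u0, v t0 = v0 &
    forall t, t0 <= t -> is_derive t 1 u (al t * v t) /\ is_derive t 1 v (be t * g (u t))].
Proof.
move=> K0 L0 cal cbe hal hbe hg.
have cg : continuous g.
  move=> x; apply/cvgrPdist_lt => e e0; apply/nbhs_ballP.
  have L1 : 0 < L + 1 by lra.
  exists (e / (L + 1)); rewrite /=; first exact: divr_gt0.
  move=> y /= hy; apply: le_lt_trans (hg x y) _.
  have : (L + 1) * `|x - y| < e by rewrite mulrC -ltr_pdivlMr.
  by have := normr_ge0 (x - y); lra.
have /choice[I hI] : forall f, exists P : R -> R, continuous f ->
    P t0 = 0 /\ forall t, is_derive t 1 P (f t).
  move=> f.
  have [cf|ncf] := pselect (continuous f); last by exists (fun=> 0).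
  have [P [_ hP]] := primitive cf; exists (fun t => P t - P t0) => _.
  by rewrite subrr; split => // t; apply: der_eq (der_sub (hP t) (der_cst _ t)) _; rewrite subr0.
pose pl t := Num.max t t0.
have plE t : t0 <= t -> pl t = t by move=> h; apply/max_idPl.
pose Vop U := fun t => v0 + I (fun s => be s * g (U (pl s))) t.
pose Uop V := fun t => u0 + I (fun s => al s * V (pl s)) t.
have cpl f : continuous f -> continuous (fun s => f (pl s)).
  by move=> cf; apply: continuous_maxl => t _; exact: cf.
have VopD (U : R -> R) : continuous U -> Vop U t0 = v0 /\ forall t, is_derive t 1 (Vop U) (be t * g (U (pl t))).
  move=> cU; have cc : continuous (fun s => be s * g (U (pl s))).
    move=> s; apply: continuousM; first exact: cbe.
    apply: (@continuous_comp _ _ _ (fun s => U (pl s)) g); last exact: cg.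
    exact: cpl.
  have [h1 h2] := hI _ cc; rewrite /Vop h1 addr0; split => // t.
  by apply: der_eq (der_add (der_cst v0 t) (h2 t)) _; rewrite add0r.
have UopD (V : R -> R) : continuous V -> Uop V t0 = u0 /\ forall t, is_derive t 1 (Uop V) (al t * V (pl t)).
  move=> cV; have cc : continuous (fun s => al s * V (pl s)).
    by move=> s; apply: continuousM; [exact: cal|exact: cpl].
  have [h1 h2] := hI _ cc; rewrite /Uop h1 addr0; split => // t.
  by apply: der_eq (der_add (der_cst u0 t) (h2 t)) _; rewrite add0r.
have Vc (U : R -> R) : continuous U -> continuous (Vop U).
  by move=> /VopD[_ h] t; exact: der_continuous (h t).
have Uc (V : R -> R) : continuous V -> continuous (Uop V).
  by move=> /UopD[_ h] t; exact: der_continuous (h t).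
pose c := 2 * K * (1 + L); have c0 : 0 < c by rewrite !mulr_gt0 //; lra.
have KLc : K * (K * L / c) / c <= 2^-1.
  have -> : K * (K * L / c) / c = (K ^+ 2 * L) / c ^+ 2 by field; rewrite gt_eqF.
  rewrite ler_pdivrMr ?exprn_gt0 //.
  have : 0 <= K ^+ 2 * (2 + 3 * L + 2 * L ^+ 2).
    by rewrite mulr_ge0 ?sqr_ge0 //; have := sqr_ge0 L; lra.
  by rewrite /c; lra.
(* one application of the integral operator halves the weighted distance *)
have contr (U1 U2 : R -> R) b : 0 <= b -> continuous U1 -> continuous U2 ->
  (forall t, t0 <= t -> `|U1 t - U2 t| <= b * expR (c * (t - t0))) ->
  forall t, t0 <= t -> `|Uop (Vop U1) t - Uop (Vop U2) t| <=
                       b * 2^-1 * expR (c * (t - t0)).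
  move=> b0 c1 c2 h.
  have hV t : t0 <= t -> `|Vop U1 t - Vop U2 t| <= K * (L * b) / c * expR (c * (t - t0)).
    move=> tt0; have [e1 d1] := VopD _ c1; have [e2 d2] := VopD _ c2.
    have := @exp_integral_le (fun t => Vop U1 t - Vop U2 t)
      (fun r => be r * g (U1 (pl r)) - be r * g (U2 (pl r))) (K * (L * b)) c t0 t.
    rewrite /= e1 e2 subrr subr0; apply=> //.
    + by rewrite !mulr_ge0 // ltW.
    move=> r /andP[hr _]; rewrite -mulrBr normrM plE // -[K * _ * _]mulrA -[L * b * _]mulrA.
    apply: ler_pM => //; apply: le_trans (hg _ _) _.
    by apply: ler_wpM2l => //; exact: h.
  move=> t tt0; have [e1 d1] := UopD _ (Vc _ c1); have [e2 d2] := UopD _ (Vc _ c2).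
  have bc : 0 <= K * (K * (L * b) / c).
    by rewrite mulr_ge0 ?(ltW K0) // divr_ge0 ?(ltW c0) // !mulr_ge0 // ltW.
  have := @exp_integral_le (fun t => Uop (Vop U1) t - Uop (Vop U2) t)
    (fun r => al r * Vop U1 (pl r) - al r * Vop U2 (pl r)) (K * (K * (L * b) / c)) c t0 t bc c0 tt0.
  rewrite /= e1 e2 subrr subr0 => H.
  apply: le_trans (H _ _) _.
  - move=> r /andP[hr _]; rewrite -mulrBr normrM plE // -[K * _ * _]mulrA.
    by apply: ler_pM => //; exact: hV.
  - apply: ler_wpM2r; first exact: expR_ge0.
    have -> : K * (K * (L * b) / c) / c = b * (K * (K * L / c) / c).
      by field; rewrite gt_eqF.
    exact: ler_wpM2l.
pose U n := iter n (fun U => Uop (Vop U)) (fun=> u0).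
have cU n : continuous (U n).
  elim: n => [|n ih]; first by move=> t; exact: cst_continuous.
  by apply: Uc; apply: Vc.
pose B := K * (`|v0| + K * `|g u0| / c) / c.
have B0 : 0 <= B.
  by rewrite divr_ge0 ?(ltW c0) // mulr_ge0 ?(ltW K0) // addr_ge0 // divr_ge0 ?(ltW c0) // mulr_ge0 // ltW.
have base t : t0 <= t -> `|U 1 t - U 0 t| <= B * expR (c * (t - t0)).
  move=> tt0; have [e1 d1] := VopD _ (cU 0); have [e2 d2] := UopD _ (Vc _ (cU 0)).
  have hV r : t0 <= r -> `|Vop (U 0) r| <= (`|v0| + K * `|g u0| / c) * expR (c * (r - t0)).
    move=> tr; have := @exp_integral_le (Vop (U 0)) _ (K * `|g u0|) c t0 r _ c0 tr (fun r _ => d1 r).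
    rewrite e1 => H; rewrite mulrDl -[Vop _ _](subrK v0) addrC.
    apply: le_trans (ler_normD _ _) _; apply: lerD; last apply: H.
    + rewrite -[X in X <= _]mulr1; apply: ler_wpM2l => //.
      by rewrite -expR0 ler_expR mulr_ge0 ?(ltW c0) // subr_ge0.
    + by rewrite mulr_ge0 // ltW.
    + move=> x /andP[hx _]; rewrite normrM /= -[X in X <= _]mulr1; apply: ler_pM => //.
      * by apply: ler_wpM2r.
      * by rewrite -expR0 ler_expR mulr_ge0 ?(ltW c0) // subr_ge0.
  have := @exp_integral_le (Uop (Vop (U 0))) _ (K * (`|v0| + K * `|g u0| / c)) c t0 t _ c0 tt0 (fun r _ => d2 r).
  rewrite e2; apply.
  - by rewrite mulr_ge0 ?(ltW K0) // addr_ge0 // divr_ge0 ?(ltW c0) // mulr_ge0 // ltW.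
  - move=> r /andP[hr _]; rewrite normrM plE // -[K * _ * _]mulrA.
    by apply: ler_pM => //; exact: hV.
have step n t : t0 <= t -> `|U n.+1 t - U n t| <= B * 2^-1 ^+ n * expR (c * (t - t0)).
  elim: n t => [|n ih] t tt0; first by rewrite expr0 mulr1; exact: base.
  rewrite exprSr mulrA; apply: (contr (U n.+1) (U n)) => //.
  by rewrite mulr_ge0 // exprn_ge0 //; lra.
have /choice[W hW] : forall t, exists w, t0 <= t -> forall n,
    `|U n t - w| <= 2 * (B * expR (c * (t - t0))) * 2^-1 ^+ n.
  move=> t.
  have [tt0|ntt0] := pselect (t0 <= t); last by exists 0.
  have [l hl] := @geometric_limit (fun n => U n t) (B * expR (c * (t - t0)))
     (fun n => le_trans (step n t tt0) ltac:(by rewrite mulrAC)).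
  by exists l.
have cW : continuous (fun t => W (pl t)).
  move=> s; apply/cvgrPdist_lt => e e0.
  pose M := 2 * (B * expR (c * (pl s + 1 - t0))).
  have [n hn] := half_expr_small (2 * M) e0.
  have near t : `|s - t| < 1 -> `|U n (pl t) - W (pl t)| <= M * 2^-1 ^+ n.
    move=> hst; have plt0 : t0 <= pl t by rewrite /pl le_max lexx orbT.
    apply: le_trans (hW (pl t) plt0 n) _.
    apply: ler_wpM2r; first by apply: exprn_ge0; lra.
    apply: ler_wpM2l => //; apply: ler_wpM2l => //.
    rewrite ler_expR; apply: ler_wpM2l; first exact: ltW.
    apply: lerB => //; rewrite /pl ge_max.
    have hs : s <= Num.max s t0 by rewrite le_max lexx.
    have ht : t0 <= Num.max s t0 by rewrite le_max lexx orbT.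
    by have := ler_norm (t - s); rewrite distrC => ?; apply/andP; split; lra.
  have e2 : 0 < e - 2 * M * 2^-1 ^+ n by lra.
  have := cpl _ (cU n) s => /cvgr_dist_lt /(_ _ e2) /nbhs_ballP[d /= d0 hd].
  apply/nbhs_ballP; exists (Num.min 1 d) => /=; first by rewrite lt_min ltr01.
  move=> t /=; rewrite lt_min => /andP[t1 /hd /= td].
  have ns := near s ltac:(by rewrite subrr normr0 ltr01); have nt := near t t1.
  have -> : W (pl s) - W (pl t) = (U n (pl s) - U n (pl t)) -
     (U n (pl s) - W (pl s)) + (U n (pl t) - W (pl t)) by ring.
  apply: le_lt_trans (ler_normD _ _) _.
  apply: le_lt_trans (lerD (ler_normB _ _) (lexx _)) _; lra.
(* the limit, extended by a constant before t0, is a fixed point on [t0, +oo[ *)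
pose v := Vop (fun t => W (pl t)); pose u := Uop v.
have plK t : pl (pl t) = pl t by rewrite plE // /pl le_max lexx orbT.
have uW t : t0 <= t -> u t = W t.
  move=> tt0; apply: (@eq_of_half_expr_le _ _ (4 * (B * expR (c * (t - t0))))) => n.
  have h : `|U n.+1 t - u t| <= (2 * B * 2^-1 ^+ n) * 2^-1 * expR (c * (t - t0)).
    apply: (contr (U n) (fun t => W (pl t))) => //.
      by apply: mulr_ge0; [rewrite mulr_ge0|apply: exprn_ge0; lra].
    by move=> r hr; rewrite plE //; apply: le_trans (hW r hr n) _; rewrite !mulrA mulrAC.
  have h2 := hW t tt0 n.+1; rewrite exprS in h2.
  have -> : u t - W t = (U n.+1 t - W t) - (U n.+1 t - u t) by ring.
  apply: le_trans (ler_normB _ _) _.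
  have p0 : 0 <= B * expR (c * (t - t0)) * 2^-1 ^+ n.
    by apply: mulr_ge0; [rewrite mulr_ge0 ?expR_ge0|apply: exprn_ge0; lra].
  lra.
have [vt0 vD] := VopD _ cW; have [ut0 uD] := UopD _ (Vc _ cW).
exists u, v; split => // t tt0; split.
  by have := uD t; rewrite plE.
by have := vD t; rewrite plK plE // -uW.
Qed.

End Picard.

(** * The angle in the phase plane *)

Section Angle.
Context {R : realType}.
Implicit Types (A f g u v th : R -> R) (a b c d e s t x y z phi : R) (k n : nat).

Lemma der_pos_local f t d : is_derive t 1 f d -> 0 < d ->
  exists2 e, 0 < e & forall x, 0 < `|x - t| < e -> 0 < (f x - f t) / (x - t).
Proof.
move=> df d0; have [e e0 he] := difference_quotient df d0; exists e => // x /he.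
by rewrite ltr_norml => /andP[]; clear; lra.
Qed.

(** The equation u'' + (A' / A) u' + g u = 0 as a first order system for u and
   v = A u'. *)
Definition ode_sol A g a b u v := forall t, a <= t <= b ->
  is_derive t 1 u (v t / A t) /\ is_derive t 1 v (- (A t * g (u t))).

Lemma ode_sol_sub A g a b a' b' u v : a <= a' -> b' <= b ->
  ode_sol A g a b u v -> ode_sol A g a' b' u v.
Proof. by move=> h1 h2 h t /andP[? ?]; apply: h; apply/andP; split; lra. Qed.

Lemma ode_sol0 A g a b : g 0 = 0 -> ode_sol A g a b (fun=> 0) (fun=> 0).
Proof.
move=> g0 t _; rewrite g0 mul0r mulr0 oppr0.
by split; exact: der_cst.
Qed.

(** The squared distance N of two phase points satisfies |N'| <= K (1 + L) N, so
   Gronwall's inequality applies in both directions of time. *)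
Lemma ode_sol_dist A g a b u1 v1 u2 v2 K L : a <= b -> 0 <= K -> 0 <= L ->
  ode_sol A g a b u1 v1 -> ode_sol A g a b u2 v2 ->
  (forall t, a <= t <= b -> `|(A t)^-1| <= K /\ `|A t| <= K) ->
  (forall t, a <= t <= b -> `|g (u1 t) - g (u2 t)| <= L * `|u1 t - u2 t|) ->
  let N t := (u1 t - u2 t) ^+ 2 + (v1 t - v2 t) ^+ 2 in
  N b <= N a * expR (K * (1 + L) * (b - a)) /\
  N a <= N b * expR (K * (1 + L) * (b - a)).
Proof.
move=> ab K0 L0 h1 h2 hA hg N.
pose N' t := 2 * ((u1 t - u2 t) * ((v1 t - v2 t) * (A t)^-1))
           - 2 * ((v1 t - v2 t) * (A t * (g (u1 t) - g (u2 t)))).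
have dN t : a <= t <= b -> is_derive t 1 N (N' t).
  move=> ht; have [d1 d1'] := h1 t ht; have [d2 d2'] := h2 t ht.
  apply: der_eq (der_add (der_exp 2 (der_sub d1 d2)) (der_exp 2 (der_sub d1' d2'))) _.
  by rewrite /N' /= !expr1; ring.
have bN t : a <= t <= b -> `|N' t| <= K * (1 + L) * N t.
  move=> ht; have [A1 A2] := hA t ht; have gg := hg t ht.
  apply: le_trans (ler_normB _ _) _.
  rewrite !normrM (ger0_norm (ler0n _ 2)) /N.
  rewrite -(real_normK (num_real (u1 t - u2 t))) -(real_normK (num_real (v1 t - v2 t))).
  have p0 := normr_ge0 (u1 t - u2 t); have q0 := normr_ge0 (v1 t - v2 t).
  move: p0 q0 gg (normr_ge0 (g (u1 t) - g (u2 t))) A1 A2 (normr_ge0 (A t)^-1) (normr_ge0 (A t)).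
  move: `|u1 t - u2 t| `|v1 t - v2 t| `|g (u1 t) - g (u2 t)| `|(A t)^-1| `|A t|.
  move=> p q r i j p0 q0 rp r0 iK jK i0 j0.
  have e1 : p * (q * i) <= p * (q * K) by rewrite !ler_wpM2l.
  have e2 : q * (j * r) <= q * (K * (L * p)) by rewrite ler_wpM2l // ler_pM.
  have e3 : 0 <= K * (1 + L) * (p - q) ^+ 2.
    by rewrite mulr_ge0 ?sqr_ge0 // mulr_ge0 // addr_ge0.
  nra.
split.
  apply: (gronwall_le ab dN) => t ht.
  exact: le_trans (ler_norm _) (bN t ht).
apply: (gronwall_ge ab dN) => t ht.
by have := bN t ht; rewrite ler_norml => /andP[].
Qed.

Definition amp u v t := Num.sqrt (u t ^+ 2 + v t ^+ 2).

(** Polar coordinates in the phase plane. The angle need not be monotone, but at the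
   zeros of u it turns with the positive speed 1 / A, whatever g is, and counting
   only uses its monotonicity there. *)
Record prufer a b u v th : Prop := Prufer {
  prufer_der : forall t, a <= t <= b ->
    exists2 d, is_derive t 1 th d & (u t = 0 -> 0 < d);
  prufer_pos : forall t, a <= t <= b -> 0 < u t ^+ 2 + v t ^+ 2;
  prufer_cos : forall t, a <= t <= b -> u t = amp u v t * cos (th t);
  prufer_sin : forall t, a <= t <= b -> v t = - (amp u v t * sin (th t)) }.

Lemma continuous_clamp f a b : a <= b ->
  (forall t, a <= t <= b -> {for t, continuous f}) ->
  continuous (fun s => f (Num.min (Num.max s a) b)).
Proof.
move=> ab cf t; apply: (@continuous_comp _ _ _ (fun s => Num.min (Num.max s a) b) f).
  apply: continuous_min; last exact: cst_continuous.
  by apply: continuous_max => //; exact: cst_continuous.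
by apply: cf; rewrite le_min ge_min lexx orbT le_max lexx orbT ab.
Qed.

Lemma clampE a b t : a <= t <= b -> Num.min (Num.max t a) b = t.
Proof. by move=> /andP[h1 h2]; rewrite (max_idPl h1) (min_idPl h2). Qed.

(** The angle is defined by integrating its own differential equation. Then
   X = u sin th + v cos th satisfies (X ^ 2 / N)' = 0, hence vanishes, and
   Y = u cos th - v sin th keeps its sign because X and Y have no common zero. *)
Lemma prufer_exists A g a b u v phi : a <= b -> ode_sol A g a b u v ->
  (forall t, a <= t <= b -> 0 < A t) ->
  (forall t, a <= t <= b -> {for t, continuous A}) -> continuous g ->
  (forall t, a <= t <= b -> 0 < u t ^+ 2 + v t ^+ 2) ->
  u a = amp u v a * cos phi -> v a = - (amp u v a * sin phi) ->
  exists th, th a = phi /\ prufer a b u v th.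
Proof.
move=> ab sol A0 cA cg N0 ua va.
pose N t := u t ^+ 2 + v t ^+ 2.
pose H t := (v t ^+ 2 * (A t)^-1 + A t * (g (u t) * u t)) * (N t)^-1.
have cu t : a <= t <= b -> {for t, continuous u}.
  by move=> /sol[h _]; exact: der_continuous h.
have cv t : a <= t <= b -> {for t, continuous v}.
  by move=> /sol[_ h]; exact: der_continuous h.
have cN t : a <= t <= b -> {for t, continuous N}.
  by move=> ht; apply: continuousD; apply: continuousM;
    do ?[exact: cu|exact: cv].
have cH t : a <= t <= b -> {for t, continuous H}.
  move=> ht; apply: continuousM; last first.
    by apply: continuousV; [rewrite gt_eqF // N0|exact: cN].
  apply: continuousD.
    apply: continuousM; last by apply: continuousV; [rewrite gt_eqF // A0|exact: cA].
    by apply: continuousM; exact: cv.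
  apply: continuousM; first exact: cA.
  apply: continuousM; last exact: cu.
  by apply: continuous_comp; [exact: cu|exact: cg].
have [P [P0 dP]] := primitive (continuous_clamp ab cH).
pose th t := P t - P a + phi.
have dth t : a <= t <= b -> is_derive t 1 th (H t).
  move=> ht; have := dP t; rewrite clampE // => h.
  by apply: der_eq (der_add (der_sub h (der_cst _ t)) (der_cst _ t)) _; ring.
have tha : th a = phi by rewrite /th subrr add0r.
exists th; split => //.
have dsin t : a <= t <= b -> is_derive t 1 (fun t => sin (th t)) (cos (th t) * H t).
  by move=> ht; exact: der_comp (is_derive_sin _) (dth t ht).
have dcos t : a <= t <= b -> is_derive t 1 (fun t => cos (th t)) (- sin (th t) * H t).
  by move=> ht; exact: der_comp (is_derive_cos _) (dth t ht).
pose X t := u t * sin (th t) + v t * cos (th t).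
pose Y t := u t * cos (th t) - v t * sin (th t).
have NX t : N t = X t ^+ 2 + Y t ^+ 2.
  rewrite /N /X /Y -[u t ^+ 2]mulr1 -[v t ^+ 2]mulr1 -(cos2Dsin2 (th t)); ring.
have dX t : a <= t <= b -> is_derive t 1 (fun t => X t ^+ 2 * (N t)^-1) 0.
  move=> ht; have [du dv] := sol t ht; have n0 : N t != 0 by rewrite gt_eqF // N0.
  have a0 : A t != 0 by rewrite gt_eqF // A0.
  have d1 := der_exp 2 (der_add (der_mul du (dsin t ht)) (der_mul dv (dcos t ht))).
  have d2 := der_inv n0 (der_add (der_exp 2 du) (der_exp 2 dv)).
  apply: der_eq (der_mul d1 d2) _.
  rewrite /H /X /= !expr1; move: n0; rewrite /N => n0.
  by field; rewrite n0 a0.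
have aab : a <= a <= b by rewrite lexx.
have Na0 : amp u v a ^+ 2 = N a by rewrite sqr_sqrtr // ltW // N0.
have amp0 t : a <= t <= b -> 0 < amp u v t by move=> ht; rewrite sqrtr_gt0 N0.
have X0 t : a <= t <= b -> X t = 0.
  move=> /andP[at_ tb].
  have Xa : X a = 0 by rewrite /X tha {1}ua {1}va; ring.
  have [c hc] : exists2 c, a <= c <= t &
     X t ^+ 2 * (N t)^-1 - X a ^+ 2 * (N a)^-1 = 0 * (t - a).
    apply: (@mean_value _ (fun t => X t ^+ 2 * (N t)^-1) (fun=> 0)) => // s /andP[h1 h2].
    by apply: dX; rewrite h1 (le_trans h2).
  rewrite mul0r Xa expr0n mul0r subr0 => /eqP.
  by rewrite mulf_eq0 invr_eq0 expf_eq0 /= (gt_eqF (N0 t _)) ?orbF ?at_ // => /eqP.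
have cY t : a <= t <= b -> {for t, continuous Y}.
  move=> ht; apply: continuousB; apply: continuousM; do ?[exact: cu|exact: cv].
    exact: der_continuous (dcos t ht).
  exact: der_continuous (dsin t ht).
have Ya : Y a = amp u v a.
  rewrite /Y tha {1}ua {1}va -[RHS]mulr1 -(cos2Dsin2 phi); ring.
have Y0 t : a <= t <= b -> 0 < Y t.
  move=> ht; have /andP[at_ tb] := ht; rewrite ltNge; apply/negP => Yt.
  have [s /andP[as_ st] Ys] : exists2 s, a <= s <= t & Y s = 0.
    apply: ivt => //.
      by move=> s /andP[h1 h2]; apply: cY; rewrite h1 (le_trans h2).
    by rewrite ge_min le_max Yt orbT Ya (ltW (amp0 a _)).
  have hs : a <= s <= b by rewrite as_ (le_trans st).
  by have := N0 s hs; rewrite -/(N s) NX X0 // Ys expr0n addr0 ltxx.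
have YE t : a <= t <= b -> Y t = amp u v t.
  move=> ht; rewrite /amp -/(N t) NX X0 // expr0n add0r sqrtr_sqr.
  by rewrite ger0_norm // ltW // Y0.
split=> //.
- move=> t ht; exists (H t); first exact: dth.
  move=> ut; rewrite /H /N ut mulr0 mulr0 addr0 expr0n add0r.
  have := N0 t ht; rewrite ut expr0n add0r => v0.
  by rewrite divr_gt0 // divr_gt0 // A0.
- move=> t ht; rewrite -YE //; apply/eqP; rewrite -subr_eq0 -[u t]mulr1 -(cos2Dsin2 (th t)).
  have -> : u t * (cos (th t) ^+ 2 + sin (th t) ^+ 2) - Y t * cos (th t) = X t * sin (th t).
    by rewrite /Y /X; ring.
  by rewrite X0 // mul0r.
- move=> t ht; rewrite -YE //; apply/eqP; rewrite -subr_eq0 -[v t]mulr1 -(cos2Dsin2 (th t)).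
  have -> : v t * (cos (th t) ^+ 2 + sin (th t) ^+ 2) - - (Y t * sin (th t)) = X t * cos (th t).
    by rewrite /Y /X; ring.
  by rewrite X0 // mul0r.
Qed.

End Angle.

(** * Counting zeros with the angle *)

Section Counting.
Context {R : realType}.
Implicit Types (A f g u v th : R -> R) (a b c d e s t x y z : R) (k n i : nat).

Lemma cosDnatpi x n : cos (x + n%:R * pi) = (-1) ^+ n * cos x.
Proof.
elim: n => [|n ih]; first by rewrite mul0r addr0 expr0 mul1r.
by rewrite -natr1 mulrDl mul1r addrA cosDpi ih exprS mulN1r mulNr.
Qed.

Lemma cos_half_pi_nat n : cos (pi / 2 + n%:R * pi) = 0 :> R.
Proof. by rewrite cosDnatpi cos_pihalf mulr0. Qed.

Lemma cos_eq0_bounded x n : - (pi / 2) < x < n%:R * pi + pi / 2 -> cos x = 0 ->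
  exists2 i, (i < n)%N & x = pi / 2 + i%:R * pi.
Proof.
elim: n => [|n ih] /andP[x1 x2] cx.
  have : 0 < cos x by apply: cos_gt0_pihalf; rewrite x1; move: x2; rewrite mul0r add0r.
  by rewrite cx ltxx.
have [xn|xn|xn] := ltgtP x (n%:R * pi + pi / 2).
- by have [|i hi ->] := ih _ cx; [rewrite x1 xn|exists i => //; exact: ltnW].
- have : 0 < cos (x - n.+1%:R * pi).
    apply: cos_gt0_pihalf; move: x2 xn; rewrite -natr1; have := @pi_gt0 R; lra.
  have : cos x = (-1) ^+ n.+1 * cos (x - n.+1%:R * pi).
    by rewrite -cosDnatpi subrK.
  rewrite cx => /esym/eqP; rewrite mulf_eq0 expf_eq0 oppr_eq0 oner_eq0 andbF /=.
  by move/eqP => ->; rewrite ltxx.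
- by exists n => //; rewrite xn addrC.
Qed.

Section Barrier.
Variables (a b : R) (u v th : R -> R).
Hypothesis P : prufer a b u v th.

Lemma prufer_continuous t : a <= t <= b -> {for t, continuous th}.
Proof. by move=> /(prufer_der P)[d h _]; exact: der_continuous h. Qed.

Lemma prufer_amp_gt0 t : a <= t <= b -> 0 < amp u v t.
Proof. by move=> ht; rewrite sqrtr_gt0 (prufer_pos P). Qed.

Lemma prufer_zero t : a <= t <= b -> u t = 0 <-> cos (th t) = 0.
Proof.
move=> ht; rewrite (prufer_cos P ht); split=> [/eqP|->]; last by rewrite mulr0.
by rewrite mulf_eq0 gt_eqF ?prufer_amp_gt0 // => /eqP.
Qed.

(** The angle increases strictly at every zero of cos th, so it cannot come back
   to such a value c from above. *)
Lemma angle_barrier_lt s t c : a <= s -> s < t -> t <= b -> cos c = 0 ->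
  c <= th s -> c < th t.
Proof.
move=> as_ st tb cc cs.
have inab x : s <= x <= t -> a <= x <= b by move=> /andP[/(le_trans as_) -> /le_trans ->].
have rise x : s <= x <= t -> th x = c ->
    exists2 r, 0 < r & forall y, 0 < `|y - x| < r -> 0 < (th y - c) / (y - x).
  move=> hx ex; have [d dx d0] := prufer_der P (inab x hx); rewrite -ex.
  by apply: (der_pos_local dx); apply: d0; apply/(prufer_zero (inab x hx)); rewrite ex.
have [s1 /andP[ss st1] cs1] : exists2 s1, s <= s1 < t & c < th s1.
  move: cs; rewrite le_eqVlt => /orP[/eqP e|cs]; last by exists s; rewrite // lexx.
  have [|r r0 hr] := rise s _ (esym e); first by rewrite lexx ltW.
  pose y := Num.min ((s + t) / 2) (s + r / 2).
  have y1 : y <= (s + t) / 2 by rewrite ge_min lexx.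
  have y2 : y <= s + r / 2 by rewrite ge_min lexx orbT.
  have sy : s < y by rewrite lt_min; apply/andP; split; lra.
  exists y; first by apply/andP; split; lra.
  have ys : 0 < y - s by rewrite subr_gt0.
  have := hr y; rewrite gtr0_norm // ys /= pmulr_lgt0 ?invr_gt0 // subr_gt0; apply; lra.
suff : forall x, s1 <= x <= t -> - th x < - c.
  by move=> /(_ t); rewrite ltrN2; apply; rewrite ltW // lexx.
have cth x : s1 <= x <= t -> {for x, continuous (fun x => - th x)}.
  move=> /andP[h1 h2]; apply: continuousN; apply: prufer_continuous; apply: inab.
  by rewrite (le_trans ss h1).
apply: (continuous_induction cth); first by rewrite ltrN2.
move=> x /andP[h1 h2] above; have {}above y : s1 <= y <= x -> c <= th y.
  by move=> /above; rewrite lerN2.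
rewrite ltrN2 lt_neqAle above ?h1 ?lexx // andbT; apply/eqP => e.
have [|r r0 hr] := rise x _ (esym e); first by rewrite (le_trans ss h1).
have s1x : s1 < x by rewrite lt_neqAle h1 andbT; apply/eqP => es; move: cs1; rewrite es e ltxx.
pose y := Num.max s1 (x - r / 2).
have yx : y < x by rewrite gt_max s1x; lra.
have sy : s1 <= y by rewrite le_max lexx.
have yr : x - r / 2 <= y by rewrite le_max lexx orbT.
have yx0 : y - x < 0 by rewrite subr_lt0.
have : th y < c; last by rewrite ltNge above // sy ltW.
rewrite -subr_lt0 -(nmulr_lgt0 _ (_ : (y - x)^-1 < 0)) ?invr_lt0 //.
by apply: hr; rewrite ltr0_norm //; apply/andP; split; lra.
Qed.

Lemma angle_barrier s t c : a <= s -> s <= t -> t <= b -> cos c = 0 ->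
  c <= th s -> c <= th t.
Proof.
move=> as_; rewrite le_eqVlt => /orP[/eqP <- //|st] tb cc cs.
exact/ltW/(angle_barrier_lt as_ st tb cc cs).
Qed.

(** The values pi / 2 + i pi between the two end values of the angle are attained
   by continuity, and only once each because of the barrier. *)
Lemma prufer_exact_zeros k : a <= b ->
  - (pi / 2) < th a < pi / 2 ->
  k%:R * pi - pi / 2 < th b < k%:R * pi + pi / 2 ->
  exists z : nat -> R,
    (forall i, (i < k)%N -> a <= z i <= b /\ th (z i) = pi / 2 + i%:R * pi) /\
    (forall t, a <= t <= b -> u t = 0 -> exists2 i, (i < k)%N & t = z i).
Proof.
move=> ab /andP[a1 a2] /andP[b1 b2].
have pi0 := @pi_gt0 R.
have /choice[z hz] : forall i, exists z, (i < k)%N -> a <= z <= b /\ th z = pi / 2 + i%:R * pi.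
  move=> i; have [ik|_] := ltnP i k; last by exists 0.
  have ik' : (i.+1%:R : R) <= k%:R by rewrite ler_nat.
  have i0 : (0 : R) <= i%:R by [].
  have := ler_wpM2r (ltW pi0) ik'; rewrite -natr1 mulrDl mul1r => ik2.
  have i02 : 0 <= i%:R * pi :> R by rewrite mulr_ge0 // ltW.
  have [y hy ey] : exists2 y, a <= y <= b & th y = pi / 2 + i%:R * pi.
    apply: ivt => //; first exact: prufer_continuous.
    by rewrite ge_min le_max; apply/andP; split; apply/orP; [left|right]; lra.
  by exists y.
exists z; split => // t ht ut.
have /andP[at_ tb] := ht.
have ct : cos (th t) = 0 by apply/prufer_zero.
have lo : - (pi / 2) < th t.
  have := @angle_barrier_lt a t (- (pi / 2)) (lexx a).
  have := at_; rewrite le_eqVlt => /orP[/eqP <- //|lt] /(_ lt tb).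
  by rewrite cosN cos_pihalf => /(_ erefl (ltW a1)).
have hi : th t < k%:R * pi + pi / 2.
  rewrite ltNge; apply/negP => h.
  have := @angle_barrier t b (k%:R * pi + pi / 2) at_ tb (lexx b).
  by rewrite addrC cos_half_pi_nat => /(_ erefl); rewrite addrC => /(_ h); lra.
have [|i ik e] := @cos_eq0_bounded (th t) k _ ct; first by rewrite lo.
exists i => //; have [/andP[z1 z2] ez] := hz i ik.
have ci := cos_half_pi_nat i.
have [lt|lt|//] := ltgtP t (z i).
  by have := angle_barrier_lt at_ lt z2 ci; rewrite e ez lexx ltxx => /(_ isT).
by have := angle_barrier_lt z1 lt tb ci; rewrite e ez lexx ltxx => /(_ isT).
Qed.

(** After a zero of u the angle lies above the corresponding odd multiple of
   pi / 2, and the next zero can only be the next one of these multiples or a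
   later one. *)
Lemma angle_ge_of_zeros n (z : nat -> R) : - (pi / 2) < th a ->
  (forall i, (i <= n)%N -> a <= z i <= b /\ u (z i) = 0) ->
  (forall i, (i < n)%N -> z i < z i.+1) ->
  pi / 2 + n%:R * pi <= th (z n).
Proof.
move=> a1 hz mz; have pi0 := @pi_gt0 R.
elim: n hz mz => [|n ih] hz mz.
  have [ht ut] := hz 0 (leqnn _); have /andP[at_ tb] := ht.
  have ct : cos (th (z 0)) = 0 by apply/prufer_zero.
  have lo : - (pi / 2) < th (z 0).
    have := @angle_barrier_lt a (z 0) (- (pi / 2)) (lexx a).
    have := at_; rewrite le_eqVlt => /orP[/eqP <- //|lt] /(_ lt tb).
    by rewrite cosN cos_pihalf => /(_ erefl (ltW a1)).
  rewrite mul0r addr0 leNgt; apply/negP => h.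
  have := @cos_gt0_pihalf R (th (z 0)); rewrite lo h ct ltxx.
  by move=> /(_ isT).
have {}ih : pi / 2 + n%:R * pi <= th (z n).
  by apply: ih => i hi; [apply: hz; exact: leqW|apply: mz; exact: leqW].
have [/andP[h1 h2] _] := hz n (leqnSn _); have [ht ut] := hz n.+1 (leqnn _).
have /andP[_ tb] := ht.
have lt := angle_barrier_lt h1 (mz n (leqnn _)) tb (cos_half_pi_nat n) ih.
have ct : cos (th (z n.+1)) = 0 by apply/prufer_zero.
rewrite leNgt; apply/negP => h.
have : 0 < cos (th (z n.+1) - n.+1%:R * pi).
  by apply: cos_gt0_pihalf; move: h lt; rewrite -(@natr1 R n); lra.
have : cos (th (z n.+1)) = (-1) ^+ n.+1 * cos (th (z n.+1) - n.+1%:R * pi).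
  by rewrite -cosDnatpi subrK.
rewrite ct => /esym/eqP; rewrite mulf_eq0 expf_eq0 oppr_eq0 oner_eq0 andbF /=.
by move/eqP => ->; rewrite ltxx.
Qed.

End Barrier.

Lemma cos_angle_diff a b u1 v1 th1 u2 v2 th2 t : a <= t <= b ->
  prufer a b u1 v1 th1 -> prufer a b u2 v2 th2 ->
  u1 t * u2 t + v1 t * v2 t =
  amp u1 v1 t * amp u2 v2 t * cos (th1 t - th2 t).
Proof.
move=> ht P1 P2; rewrite cosB (prufer_cos P1 ht) (prufer_sin P1 ht).
by rewrite (prufer_cos P2 ht) (prufer_sin P2 ht) /amp; ring.
Qed.

(** An angle difference pi / 2 would make the two phase points orthogonal. *)
Lemma angle_stay_close a b u1 v1 th1 u2 v2 th2 t : a <= t <= b ->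
  prufer a b u1 v1 th1 -> prufer a b u2 v2 th2 ->
  (forall s, a <= s <= t -> 0 < u1 s * u2 s + v1 s * v2 s) ->
  `|th1 a - th2 a| < pi / 2 -> `|th1 t - th2 t| < pi / 2.
Proof.
move=> /andP[at_ tb] P1 P2 pos ha; rewrite ltNge; apply/negP => ht.
have [s /andP[s1 s2] es] : exists2 s, a <= s <= t & `|th1 s - th2 s| = pi / 2.
  apply: (@ivt _ (fun s => `|th1 s - th2 s|)) => //.
    move=> s /andP[s1 s2]; have hs : a <= s <= b by rewrite s1 (le_trans s2).
    apply: (@continuous_comp _ _ _ (fun s => th1 s - th2 s)); last exact: norm_continuous.
    by apply: continuousB; [exact: prufer_continuous P1 _ hs|exact: prufer_continuous P2 _ hs].
  by rewrite ge_min le_max (ltW ha) ht orbT.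
have hs : a <= s <= b by rewrite s1 (le_trans s2).
have := pos s; rewrite s1 s2 (cos_angle_diff hs P1 P2) => /(_ isT).
by rewrite -cos_norm es cos_pihalf mulr0 ltxx.
Qed.

Lemma dot_pos_of_close x1 y1 x2 y2 :
  (x1 - x2) ^+ 2 + (y1 - y2) ^+ 2 < x1 ^+ 2 + y1 ^+ 2 ->
  0 < x1 * x2 + y1 * y2.
Proof. by have := sqr_ge0 x2; have := sqr_ge0 y2; nra. Qed.

End Counting.

(** * The nonlinearity and its primitive *)

Section Nonlinearity.
Context {R : realType}.
Variables (a lam : R).
Hypotheses (a_gt0 : 0 < a) (lam_gt0 : 0 < lam).
Implicit Types (x y B C M d e : R).

Definition pw x := `|x| `^ a.
Definition gnl x := lam * (pw x * x - x).
Definition Fnl x := lam * (pw x * x ^+ 2 / (a + 2) - x ^+ 2 / 2).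

Let a2_neq0 : a + 2 != 0.
Proof.
have a0 := a_gt0; have h : 0 < a + 2 by lra.
by rewrite gt_eqF.
Qed.

Lemma pw_ge0 x : 0 <= pw x. Proof. exact: powR_ge0. Qed.

Lemma pwN x : pw (- x) = pw x. Proof. by rewrite /pw normrN. Qed.

Lemma pw_le x y : `|x| <= `|y| -> pw x <= pw y.
Proof. by apply: ge0_ler_powR; rewrite ?nnegrE ?normr_ge0 // ltW. Qed.

Lemma pw_lt x y : `|x| < `|y| -> pw x < pw y.
Proof. by apply: gt0_ltr_powR; rewrite ?nnegrE ?normr_ge0. Qed.

Lemma pw1 : pw 1 = 1. Proof. by rewrite /pw normr1 powR1. Qed.

Lemma pw_ge1 x : 1 <= `|x| -> 1 <= pw x.
Proof. by move=> h; rewrite -[X in X <= _]pw1; apply: pw_le; rewrite normr1. Qed.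

Lemma pw_small e : 0 < e -> exists2 d, 0 < d & forall x, `|x| < d -> pw x < e.
Proof.
move=> e0; exists (e `^ a^-1); first exact: powR_gt0.
move=> x hx; have <- : (e `^ a^-1) `^ a = e.
  by rewrite -powRrM mulVf ?gt_eqF // powRr1 // ltW.
by apply: gt0_ltr_powR; rewrite ?nnegrE ?normr_ge0 ?powR_ge0.
Qed.

Lemma pw_large e : exists2 d, 1 <= d & forall x, d <= `|x| -> e <= pw x.
Proof.
pose e' := Num.max 1 e; have e'0 : 0 < e' by rewrite lt_max ltr01.
have d0 := powR_gt0 a^-1 e'0.
exists (Num.max 1 (e' `^ a^-1)); first by rewrite le_max lexx.
move=> x; rewrite ge_max => /andP[_ hx].
have : e' <= pw x; last by apply: le_trans; rewrite le_max lexx orbT.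
have {1}<- : (e' `^ a^-1) `^ a = e'.
  by rewrite -powRrM mulVf ?gt_eqF // powRr1 // ltW.
by apply: ge0_ler_powR; rewrite ?nnegrE ?normr_ge0 ?powR_ge0 // ltW.
Qed.

(** At 0 the difference quotient of pw x * x at h is pw h, which tends to 0. *)
Lemma der_pwM x : is_derive x 1 (fun x => pw x * x) ((a + 1) * pw x).
Proof.
have pos y : 0 < y -> is_derive y 1 (fun x => pw x * x) ((a + 1) * pw y).
  move=> y0; apply: (@der_near _ (fun x => x `^ a * x) _ y _ y y0).
    move=> z hz; rewrite /pw ger0_norm //; have := ler_norm (y - z); lra.
  apply: der_eq (der_mul (is_derive1_powR a y0) (der_id y)) _.
  by rewrite /pw ger0_norm ?(ltW y0) // -mulrA [y `^ _ * _]mulrC mulr_powRB1 ?(ltW y0) //; ring.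
have [x0|x0|x0] := ltgtP x 0; last 1 first.
- have p0 : pw 0 = 0 by rewrite /pw normr0 powR0 // gt_eqF.
  have h : h^-1 *: (pw (h *: 1 + x) * (h *: 1 + x) - pw x * x) @[h --> 0^'] --> (a + 1) * pw x.
    rewrite x0 p0 mulr0; apply/cvgrPdist_lt => e e0.
    have [d d0 hd] := pw_small e0.
    apply/nbhs_ballP; exists d => // h /=; rewrite /ball /= sub0r normrN => hh h0.
    rewrite /GRing.scale /= mulr1 addr0 !mulr0 subr0 sub0r normrN [pw h * h]mulrC mulrA mulVf // mul1r.
    by rewrite ger0_norm ?pw_ge0 // hd.
  split; first by apply/cvg_ex; exists ((a + 1) * pw x).
  exact: cvg_lim h.
- have nx : 0 < - x by lra.
  have := der_mul (der_cst (-1) x) (der_comp (pos _ nx) (der_opp (der_id x))).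
  have -> : (fun y => -1 * (pw (- y) * - y)) = (fun y => pw y * y).
    by apply/funext => y; rewrite pwN; ring.
  by move=> h; apply: der_eq h _; rewrite pwN; ring.
- exact: pos.
Qed.

Lemma der_gnl x : is_derive x 1 gnl (lam * ((a + 1) * pw x - 1)).
Proof.
apply: der_eq (der_mul (der_cst lam x) (der_sub (der_pwM x) (der_id x))) _.
by ring.
Qed.

Lemma der_Fnl x : is_derive x 1 Fnl (gnl x).
Proof.
have e : Fnl = fun x => lam * (pw x * x * x * (a + 2)^-1 - x ^+ 2 * 2^-1).
  by apply/funext => y; rewrite /Fnl expr2 mulrA.
rewrite e; have h1 := der_mul (der_mul (der_pwM x) (der_id x)) (der_cst (a + 2)^-1 x).
have h2 := der_mul (der_exp 2 (der_id x)) (der_cst 2^-1 x).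
apply: der_eq (der_mul (der_cst lam x) (der_sub h1 h2)) _.
by rewrite /gnl /= expr1; field; exact: a2_neq0.
Qed.

Lemma gnl_continuous : continuous gnl.
Proof. move=> x; exact: der_continuous (der_gnl x). Qed.

Lemma gnl0 : gnl 0 = 0. Proof. by rewrite /gnl mulr0 subrr mulr0. Qed.

Lemma gnlN x : gnl (- x) = - gnl x.
Proof. by rewrite /gnl pwN; ring. Qed.

Lemma FnlN x : Fnl (- x) = Fnl x.
Proof. by rewrite /Fnl pwN sqrrN. Qed.

Lemma gnl_lip M : 0 <= M -> exists2 L, 0 <= L & forall x y,
  `|x| <= M -> `|y| <= M -> `|gnl x - gnl y| <= L * `|x - y|.
Proof.
have a0 := a_gt0; have l0 := lam_gt0.
move=> M0; have p0 := pw_ge0 M; pose L := lam * ((a + 1) * pw M + 1).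
have L0 : 0 <= L.
  by rewrite mulr_ge0 ?(ltW lam_gt0) // addr_ge0 // mulr_ge0 // addr_ge0 // ltW.
exists L => // x y; wlog xy : x y / x <= y.
  by move=> H hx hy; have [/H|/ltW/H] := leP x y; [|rewrite distrC [`|x - y|]distrC]; apply.
move=> hx hy; rewrite distrC [`|x - y|]distrC.
have [c /andP[c1 c2] ->] := mean_value xy (fun t _ => der_gnl t).
rewrite normrM; apply: ler_wpM2r => //.
have cM : `|c| <= `|M|.
  rewrite (ger0_norm M0) ler_norml; move: hx hy; rewrite !ler_norml => /andP[? ?] /andP[? ?].
  by apply/andP; split; lra.
have := pw_le cM; have := pw_ge0 c; rewrite normrM (gtr0_norm lam_gt0) => h1 h2.
rewrite ler_pM2l // ler_norml; apply/andP; split.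
  by have : 0 <= (a + 1) * (pw M + pw c); [rewrite mulr_ge0 //; lra|lra].
by have : 0 <= (a + 1) * (pw M - pw c); [rewrite mulr_ge0 //; lra|lra].
Qed.

Lemma sqr_le_pw eta : 0 < eta -> exists2 C, 0 <= C & forall x,
  x ^+ 2 <= eta * (pw x * x ^+ 2) + C.
Proof.
move=> eta0; have [d d1 hd] := pw_large eta^-1.
exists (d ^+ 2) => [|x]; first exact: sqr_ge0.
have x2 := sqr_ge0 x; have [dx|xd] := leP d `|x|.
  have h := hd x dx.
  have : 1 <= eta * pw x by rewrite mulrC -ler_pdivrMr // div1r.
  by have := sqr_ge0 d; nra.
have : x ^+ 2 <= d ^+ 2.
  by rewrite -(real_normK (num_real x)) ler_sqr ?nnegrE ?normr_ge0 ?ltW //; lra.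
have : 0 <= eta * (pw x * x ^+ 2).
  by apply: mulr_ge0; [lra|apply: mulr_ge0 => //; exact: pw_ge0].
lra.
Qed.

Lemma Fnl_coercive B : exists2 M, 1 <= M & forall x, M <= `|x| -> B < Fnl x.
Proof.
have a0 := a_gt0; have l0 := lam_gt0.
have [d d1 hd] := pw_large (a + 2).
pose M := Num.max d (2 * (`|B| + 1) / lam).
exists M; first by rewrite le_max d1.
move=> x; rewrite ge_max => /andP[h1 h2].
have xx : 1 <= `|x| by lra.
have e : x ^+ 2 = `|x| * `|x| by rewrite -(real_normK (num_real x)) expr2.
have : 2 * (`|B| + 1) <= lam * x ^+ 2.
  move: h2; rewrite ler_pdivrMr // => h2; rewrite e.
  by have := normr_ge0 B; nra.
have -> : Fnl x = lam * x ^+ 2 * (pw x / (a + 2) - 2^-1) by rewrite /Fnl; field; exact: a2_neq0.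
have : 1 <= pw x / (a + 2) by rewrite ler_pdivlMr ?mul1r ?hd //; lra.
have := ler_norm B; have := normr_ge0 B; nra.
Qed.

Lemma Fnl_bounded_below : exists2 C, 0 <= C & forall x, - C <= Fnl x.
Proof.
have a0 := a_gt0; have l0 := lam_gt0.
have ea : 0 < 2 / (a + 2) by rewrite divr_gt0 //; lra.
have [C C0 hC] := sqr_le_pw ea.
exists (lam * C / 2) => [|x]; first by rewrite divr_ge0 // mulr_ge0 // ltW.
have := hC x => h; rewrite /Fnl -subr_ge0.
have -> : lam * (pw x * x ^+ 2 / (a + 2) - x ^+ 2 / 2) - - (lam * C / 2) =
   lam / 2 * (2 / (a + 2) * (pw x * x ^+ 2) + C - x ^+ 2) by field; exact: a2_neq0.
by rewrite mulr_ge0 ?subr_ge0 // divr_ge0 // ltW.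
Qed.

Lemma gnl_le d x : 1 <= d -> `|x| <= d -> `|gnl x| <= lam * (pw d * d).
Proof.
have a0 := a_gt0; have l0 := lam_gt0.
move=> d1 xd; have d0 : 0 <= d by lra.
have -> : gnl x = lam * ((pw x - 1) * x) by rewrite /gnl; ring.
rewrite !normrM (gtr0_norm lam_gt0) ler_pM2l // ler_pM //.
have p0 := pw_ge0 x; have : 1 <= pw d by apply: pw_ge1; rewrite ger0_norm.
have : pw x <= pw d by apply: pw_le; rewrite (ger0_norm d0).
by rewrite ler_norml => ? ?; apply/andP; split; lra.
Qed.

Lemma Fnl_le d x : `|x| <= d -> Fnl x <= lam * (pw d * d ^+ 2).
Proof.
move=> xd; have d0 : 0 <= d := le_trans (normr_ge0 x) xd.
have x2 : x ^+ 2 <= d ^+ 2 by rewrite -(real_normK (num_real x)) ler_sqr ?nnegrE.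
have a1 : 1 <= a + 2 by move: a_gt0; clear -a_gt0 lam_gt0; lra.
rewrite /Fnl ler_pM2l // lerBlDr; apply: le_trans (_ : pw x * x ^+ 2 <= _).
  rewrite ler_pdivrMr ?(lt_le_trans ltr01 a1) //.
  by rewrite ler_peMr // mulr_ge0 ?pw_ge0 ?sqr_ge0.
apply: le_trans (_ : pw d * d ^+ 2 <= _); last by rewrite lerDl divr_ge0 ?sqr_ge0.
by apply: ler_pM; rewrite ?pw_ge0 ?sqr_ge0 // pw_le // (ger0_norm d0).
Qed.

Lemma Fnl_le_norm d x : 1 <= d -> a + 2 <= 2 * pw d -> Fnl x <= Fnl d -> `|x| <= d.
Proof.
have a0 := a_gt0; have l0 := lam_gt0.
move=> d1 hd; rewrite leNgt => h; rewrite leNgt; apply: contraNN h => xd.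
have d0 : `|d| = d by rewrite ger0_norm //; lra.
have hp : pw d < pw x by apply: pw_lt; rewrite d0.
have FE y : Fnl y = lam / (2 * (a + 2)) * (y ^+ 2 * (2 * pw y - (a + 2))).
  by rewrite /Fnl; field; exact: a2_neq0.
rewrite !FE ltr_pM2l; last by rewrite divr_gt0 //; lra.
have : d ^+ 2 < x ^+ 2.
  by rewrite -(real_normK (num_real x)) ltr_sqr ?nnegrE ?normr_ge0 //; lra.
have := sqr_ge0 d; nra.
Qed.

End Nonlinearity.

(** * The weight and the friction *)

Section Weight.
Context {R : realType}.
Implicit Types (r s t x y : R) (m n : nat).

Lemma sin_le_id x : 0 <= x -> sin x <= x.
Proof.
move=> x0; have := @der_nondecreasing R (fun y => y - sin y) (fun y => 1 - cos y) 0 x x0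
  (fun t _ => der_sub (der_id t) (is_derive_sin t)).
rewrite sin0 subrr => h; rewrite -subr_ge0; apply: h => t _.
by rewrite subr_ge0 cos_le1.
Qed.

Lemma cos_ge_quadratic x : 0 <= x -> 1 - x ^+ 2 / 2 <= cos x.
Proof.
move=> x0.
have d (t : R) (_ : 0 <= t <= x) : is_derive t 1 (fun y => cos y + y ^+ 2 * 2^-1) (t - sin t).
  apply: der_eq (der_add (is_derive_cos t) (der_mul (der_exp 2 (der_id t)) (der_cst 2^-1 t))) _.
  by rewrite /= expr1; field.
have := der_nondecreasing x0 d.
rewrite cos0 expr0n mul0r addr0 => h.
have {h} : 1 <= cos x + x ^+ 2 * 2^-1; last lra.
by apply: h => t /andP[t0 _]; rewrite subr_ge0 sin_le_id.
Qed.

Lemma id_cos_le_sin x : 0 <= x <= pi -> x * cos x <= sin x.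
Proof.
move=> /andP[x0 xpi].
have d (t : R) (_ : 0 <= t <= x) : is_derive t 1 (fun y => sin y - y * cos y) (t * sin t).
  apply: der_eq (der_sub (is_derive_sin t) (der_mul (der_id t) (is_derive_cos t))) _.
  by rewrite /=; ring.
have := der_nondecreasing x0 d.
rewrite sin0 mul0r subrr => h; rewrite -subr_ge0; apply: h => t /andP[t0 tx].
by rewrite mulr_ge0 // sin_ge0_pi // t0 (le_trans tx).
Qed.

(** The density of the equation in divergence form and its logarithmic derivative,
   the coefficient of friction. Half angles show the behaviour at both ends: the
   endpoints 0 and pi look like centres of balls of dimension m1 + 1 and m2 + 1. *)
Definition wt m1 m2 r : R := sin (r / 2) ^+ m1 * cos (r / 2) ^+ m2.
Definition frc m1 m2 r : R :=
  m1%:R / 2 * (cos (r / 2) / sin (r / 2)) - m2%:R / 2 * (sin (r / 2) / cos (r / 2)).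

Lemma half_trig_gt0 r : 0 < r < pi -> 0 < sin (r / 2) /\ 0 < cos (r / 2).
Proof.
move=> /andP[r0 rpi]; split.
  by apply: sin_gt0_pihalf; apply/andP; split; lra.
by apply: cos_gt0_pihalf; apply/andP; split; have := @pi_gt0 R; lra.
Qed.

Lemma wt_gt0 m1 m2 r : 0 < r < pi -> 0 < wt m1 m2 r.
Proof. by move=> /half_trig_gt0[? ?]; rewrite mulr_gt0 // exprn_gt0. Qed.

Lemma wt_le1 m1 m2 r : 0 < r < pi -> wt m1 m2 r <= 1.
Proof.
move=> /half_trig_gt0[? ?]; rewrite /wt -[leRHS]mulr1.
apply: ler_pM; do ?[by rewrite exprn_ge0 ?ltW]; apply: exprn_ile1; do ?[exact: ltW];
  [exact: sin_le1|exact: cos_le1].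
Qed.

Lemma frcE m1 m2 r : 0 < r < pi -> ode_h m1 m2 r / sin r = frc m1 m2 r.
Proof.
move=> /half_trig_gt0[s0 c0].
have e : r = r / 2 + r / 2 by lra.
have [n1 n2] : sin (r / 2) != 0 /\ cos (r / 2) != 0 by rewrite !gt_eqF.
have es : sin r = 2 * (sin (r / 2) * cos (r / 2)) by rewrite {1}e sinD; ring.
have ec : cos r = cos (r / 2) ^+ 2 - sin (r / 2) ^+ 2 by rewrite {1}e cosD; ring.
rewrite /ode_h /frc es ec.
have e1 := cos2Dsin2 (r / 2).
have -> : (m2%:R - m1%:R) / 2 = (m2%:R - m1%:R) / 2 * (cos (r / 2) ^+ 2 + sin (r / 2) ^+ 2) :> R.
  by rewrite e1 mulr1.
by field; rewrite n1 n2.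
Qed.

Lemma natr_exp_pred x n : x != 0 -> n%:R * x ^+ n.-1 = n%:R * x ^+ n / x.
Proof. by case: n => [|n] x0; rewrite ?mul0r // exprSr mulrA mulfK. Qed.

Lemma der_half t : is_derive t 1 (fun x : R => x / 2) 2^-1.
Proof. by apply: der_eq (der_mul (der_id t) (der_cst 2^-1 t)) _; ring. Qed.

Lemma der_wt m1 m2 r : 0 < r < pi ->
  is_derive r 1 (wt m1 m2) (wt m1 m2 r * frc m1 m2 r).
Proof.
move=> /half_trig_gt0[s0 c0].
have n : sin (r / 2) != 0 /\ cos (r / 2) != 0 by rewrite !gt_eqF.
have ds := @der_comp R (fun x => x / 2) sin _ _ _ (is_derive_sin _) (der_half r).
have dc := @der_comp R (fun x => x / 2) cos _ _ _ (is_derive_cos _) (der_half r).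
apply: der_eq (der_mul (der_exp m1 ds) (der_exp m2 dc)) _.
rewrite !natr_exp_pred ?n.1 ?n.2 // /wt /frc.
by field; rewrite n.1 n.2.
Qed.

Lemma half_refl r : (pi - r) / 2 = pi / 2 - r / 2 :> R. Proof. by rewrite mulrBl. Qed.

Lemma sin_refl r : sin ((pi - r) / 2) = cos (r / 2).
Proof. by rewrite half_refl sinB sin_pihalf cos_pihalf mul1r mul0r subr0. Qed.

Lemma cos_refl r : cos ((pi - r) / 2) = sin (r / 2).
Proof. by rewrite half_refl cosB sin_pihalf cos_pihalf mul1r mul0r add0r. Qed.

Lemma wt_refl m1 m2 r : wt m1 m2 (pi - r) = wt m2 m1 r.
Proof. by rewrite /wt sin_refl cos_refl mulrC. Qed.

Lemma frc_refl m1 m2 r : frc m1 m2 (pi - r) = - frc m2 m1 r.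
Proof. by rewrite /frc sin_refl cos_refl opprB. Qed.

Lemma frc_nonincreasing m1 m2 s t : 0 < s -> s <= t -> t < pi ->
  frc m1 m2 t <= frc m1 m2 s.
Proof.
move=> s0 st tpi.
have [ss sc] : 0 < sin (s / 2) /\ 0 < cos (s / 2).
  by apply: half_trig_gt0; apply/andP; split; lra.
have [ts tc] : 0 < sin (t / 2) /\ 0 < cos (t / 2).
  by apply: half_trig_gt0; apply/andP; split; lra.
have : 0 <= sin (t / 2 - s / 2) by apply: sin_ge0_pi; apply/andP; split; lra.
rewrite sinB subr_ge0 => h.
have m1p : 0 <= m1%:R / 2 :> R by rewrite divr_ge0.
have m2p : 0 <= m2%:R / 2 :> R by rewrite divr_ge0.
apply: lerB; apply: ler_wpM2l => //.
  by rewrite ler_pdivrMr // mulrAC ler_pdivlMr //; lra.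
by rewrite ler_pdivrMr // mulrAC ler_pdivlMr //; lra.
Qed.

Lemma half_trig_bounds r : 0 < r <= 1 ->
  [/\ r / 4 <= sin (r / 2), 2^-1 <= cos (r / 2) &
      1 - r ^+ 2 / 8 <= r / 2 * (cos (r / 2) / sin (r / 2)) <= 1].
Proof.
move=> /andP[r0 r1].
have x0 : 0 <= r / 2 by lra.
have pi2 := @pi_ge2 R.
have hp : 0 < r < pi by apply/andP; split; lra.
have [s0 c0] := half_trig_gt0 hp.
have h1 := cos_ge_quadratic x0; have h2 := sin_le_id x0.
have h3 : r / 2 * cos (r / 2) <= sin (r / 2).
  by apply: id_cos_le_sin; apply/andP; split; lra.
have hc : 2^-1 <= cos (r / 2) by nra.
split => //; first by nra.
rewrite mulrA; apply/andP; split; last by rewrite ler_pdivrMr // mul1r.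
rewrite ler_pdivlMr //.
have e : (1 - r ^+ 2 / 8) = 1 - (r / 2) ^+ 2 / 2 by field.
rewrite e; apply: le_trans (_ : cos (r / 2) * sin (r / 2) <= _).
  by apply: ler_wpM2r => //; exact: ltW.
by rewrite mulrC; apply: ler_wpM2r => //; exact: ltW.
Qed.

Lemma frc_near0 m1 m2 r : 0 < r <= 1 ->
  `|r * frc m1 m2 r - m1%:R| <= (m1%:R + m2%:R) * r ^+ 2.
Proof.
move=> hr; have [h1 h2 /andP[h3 h4]] := half_trig_bounds hr.
have /andP[r0 r1] := hr.
have s0 : 0 < sin (r / 2) by lra.
have c0 : 0 < cos (r / 2) by lra.
have hs : sin (r / 2) <= r / 2 by apply: sin_le_id; lra.
have h5 : sin (r / 2) / cos (r / 2) <= r.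
  by rewrite ler_pdivrMr //; nra.
have h6 : 0 <= sin (r / 2) / cos (r / 2) by rewrite divr_ge0 // ltW.
rewrite /frc; move: h3 h4 h5 h6.
move: (cos (r / 2) / sin (r / 2)) (sin (r / 2) / cos (r / 2)) => p q h3 h4 h5 h6.
have m1p : 0 <= m1%:R :> R by [].
have m2p : 0 <= m2%:R :> R by [].
move: (m1%:R : R) (m2%:R : R) m1p m2p => M1 M2 m1p m2p.
have -> : r * (M1 / 2 * p - M2 / 2 * q) - M1 = - (M1 * (1 - r / 2 * p) + M2 * (r / 2 * q)) by field.
rewrite normrN; apply: le_trans (ler_normD _ _) _.
have e1 : 0 <= M1 * (1 - r / 2 * p) by apply: mulr_ge0 => //; lra.
have e2 : 0 <= M2 * (r / 2 * q) by apply: mulr_ge0 => //; apply: mulr_ge0 => //; lra.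
rewrite !ger0_norm // mulrDl; apply: lerD; apply: ler_wpM2l => //; first by have := sqr_ge0 r; lra.
nra.
Qed.

Lemma frc_ge0_near m1 m2 t : (0 < m1)%N -> 0 < t <= 1 ->
  t <= 1 / (m1%:R + m2%:R) -> 0 <= frc m1 m2 t.
Proof.
move=> mm /andP[t0 t1] ht; have m1p : 1 <= m1%:R :> R by rewrite ler1n.
have m12 : 0 < m1%:R + m2%:R :> R by rewrite ltr_pwDl // (lt_le_trans ltr01).
have ht1 : 0 < t <= 1 by rewrite t0.
have := frc_near0 m1 m2 ht1.
rewrite ler_norml => /andP[h _]; rewrite ler_pdivlMr // in ht.
have h3 : (m1%:R + m2%:R) * t ^+ 2 <= 1.
  by rewrite mulrC expr2 -mulrA mulr_ile1 ?mulr_ge0 // ltW.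
by rewrite -(pmulr_rge0 _ t0); move: h h3 m1p; clear; lra.
Qed.

Lemma wt_lower m1 m2 : exists2 c : R, 0 < c &
  forall r, 0 < r <= 1 -> c * r ^+ m1 <= wt m1 m2 r.
Proof.
exists (4^-1 ^+ m1 * 2^-1 ^+ m2); first by rewrite mulr_gt0 // exprn_gt0.
move=> r hr; have [h1 h2 _] := half_trig_bounds hr; have /andP[r0 _] := hr.
rewrite mulrAC -exprMn mulrC [4^-1 * r]mulrC mulrC.
apply: ler_pM; rewrite ?exprn_ge0 ?invr_ge0 //; first by apply: divr_ge0; lra.
  by rewrite lerXn2r // nnegrE; lra.
by rewrite lerXn2r // nnegrE; lra.
Qed.

Lemma frc_bounded m1 m2 c b t : 0 < c -> b < pi -> c <= t <= b ->
  `|frc m1 m2 t| <= `|frc m1 m2 c| + `|frc m1 m2 b|.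
Proof.
move=> c0 bpi /andP[ct tb].
have h1 : frc m1 m2 t <= frc m1 m2 c.
  by apply: frc_nonincreasing; rewrite // (le_lt_trans tb).
have h2 : frc m1 m2 b <= frc m1 m2 t.
  by apply: frc_nonincreasing; rewrite // (lt_le_trans c0).
have h3 := ler_norm (frc m1 m2 c); have h4 := ler_norm (- frc m1 m2 b).
rewrite normrN in h4; have h5 := normr_ge0 (frc m1 m2 c); have h6 := normr_ge0 (frc m1 m2 b).
by rewrite ler_norml; apply/andP; split; lra.
Qed.

Lemma frc_bound m1 m2 s : 0 < s < pi -> exists2 K, 0 <= K &
  forall t, s <= t <= pi - s -> `|frc m1 m2 t| <= K.
Proof.
move=> /andP[s0 _]; exists (`|frc m1 m2 s| + `|frc m1 m2 (pi - s)|).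
  by rewrite addr_ge0.
by move=> t; apply: frc_bounded; rewrite // gtrBl.
Qed.

Lemma wt_bound m1 m2 s b : 0 < s -> s <= b -> b < pi -> exists2 K, 0 <= K &
  forall t, s <= t <= b -> `|(wt m1 m2 t)^-1| <= K /\ `|wt m1 m2 t| <= K.
Proof.
move=> s0 sb bpi.
have inpi t : s <= t <= b -> 0 < t < pi.
  by move=> /andP[/(lt_le_trans s0) -> /le_lt_trans ->].
have [|c] := @EVT_min R (wt m1 m2) s b sb.
  by apply: within_of_for => t ht; exact: der_continuous (der_wt m1 m2 (inpi t ht)).
rewrite in_itv /= => hc hmin; have c0 := wt_gt0 m1 m2 (inpi c hc).
exists (1 + (wt m1 m2 c)^-1); first by rewrite addr_ge0 // invr_ge0 ltW.
move=> t ht; have w0 := wt_gt0 m1 m2 (inpi t ht); have w1 := wt_le1 m1 m2 (inpi t ht).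
rewrite !gtr0_norm ?invr_gt0 //; split; last by rewrite (le_trans w1) // lerDl invr_ge0 ltW.
by rewrite (le_trans (_ : _ <= (wt m1 m2 c)^-1)) ?lerDr // lef_pV2 ?posrE // hmin // in_itv.
Qed.

End Weight.

(** * The energy *)

Section Energy.
Context {R : realType}.
Variables (a lam : R) (m1 m2 : nat).
Hypotheses (a_gt0 : 0 < a) (lam_gt0 : 0 < lam).
Implicit Types (u v : R -> R) (r s t b d e x y : R).

Local Notation A := (wt m1 m2).
Local Notation q := (frc m1 m2).
Local Notation g := (gnl a lam).
Local Notation F := (Fnl a lam).

Definition energy u v t := (v t / A t) ^+ 2 / 2 + F (u t).

Lemma ode_sol_opp e b u v : ode_sol A g e b u v ->
  ode_sol A g e b (fun t => - u t) (fun t => - v t).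
Proof.
move=> sol t ht; have [du dv] := sol t ht; split.
  by apply: der_eq (der_opp du) _; rewrite mulNr.
by apply: der_eq (der_opp dv) _; rewrite gnlN mulrN.
Qed.

Lemma energy_opp u v t : energy (fun t => - u t) (fun t => - v t) t = energy u v t.
Proof. by rewrite /energy FnlN mulNr sqrrN. Qed.

Section Solution.
Variables (e b : R) (u v : R -> R).
Hypotheses (e_gt0 : 0 < e) (b_ltpi : b < pi) (sol : ode_sol A g e b u v).

Let inpi t : e <= t <= b -> 0 < t < pi.
Proof. have := e_gt0; have := b_ltpi => ? ? /andP[? ?]; apply/andP; split; lra. Qed.

Lemma der_slope t : e <= t <= b ->
  is_derive t 1 (fun t => v t / A t) (- g (u t) - q t * (v t / A t)).
Proof.
move=> ht; have [_ dv] := sol ht; have w0 := wt_gt0 m1 m2 (inpi ht).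
have n0 : A t != 0 by rewrite gt_eqF.
apply: der_eq (der_mul dv (der_inv n0 (der_wt m1 m2 (inpi ht)))) _.
by field.
Qed.

Lemma der_energy t : e <= t <= b ->
  is_derive t 1 (energy u v) (- (q t * (v t / A t) ^+ 2)).
Proof.
move=> ht; have [du _] := sol ht.
have d1 := der_mul (der_exp 2 (der_slope ht)) (der_cst 2^-1 t).
have d2 := @der_comp R u F _ _ _ (der_Fnl lam a_gt0 (u t)) du.
by apply: der_eq (der_add d1 d2) _; rewrite /= expr1; field; rewrite gt_eqF // wt_gt0 // inpi.
Qed.

Lemma energy_nonincreasing s t : e <= s -> s <= t -> t <= b -> 0 <= q t ->
  energy u v t <= energy u v s.
Proof.
move=> es st tb qt; have e0 := e_gt0; have bpi := b_ltpi.
have d x (hx : s <= x <= t) : is_derive x 1 (energy u v) (- (q x * (v x / A x) ^+ 2)).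
  by case/andP: hx => ? ?; apply: der_energy; apply/andP; split; lra.
apply: (der_nonincreasing st d) => x /andP[x1 x2].
rewrite oppr_le0 mulr_ge0 ?sqr_ge0 // (le_trans qt) // frc_nonincreasing //; lra.
Qed.

Lemma energy_nondecreasing s t : e <= s -> s <= t -> t <= b -> q s <= 0 ->
  energy u v s <= energy u v t.
Proof.
move=> es st tb qt; have e0 := e_gt0; have bpi := b_ltpi.
have d x (hx : s <= x <= t) : is_derive x 1 (energy u v) (- (q x * (v x / A x) ^+ 2)).
  by case/andP: hx => ? ?; apply: der_energy; apply/andP; split; lra.
apply: (der_nondecreasing st d) => x /andP[x1 x2].
rewrite oppr_ge0 mulr_le0_ge0 ?sqr_ge0 // (le_trans _ qt) // frc_nonincreasing //; lra.
Qed.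

(** The friction is nonincreasing, so it changes sign at most once, from plus to
   minus: the energy first decreases and then increases. *)
Lemma energy_le_max t : e <= t <= b ->
  energy u v t <= Num.max (energy u v e) (energy u v b).
Proof.
move=> /andP[et tb]; rewrite le_max; have [qt|/ltW qt] := leP 0 (q t).
  by apply/orP; left; exact: energy_nonincreasing.
by apply/orP; right; exact: energy_nondecreasing.
Qed.

(** Compare v with G t A, whose derivative is at least G A where the friction is
   nonnegative. *)
Lemma slope_le t G : e <= t <= b -> v e = 0 -> 0 <= q t ->
  (forall s, e <= s <= t -> `|g (u s)| <= G) -> `|v t / A t| <= G * t.
Proof.
move=> /andP[et tb] ve qt hG; have e0 := e_gt0; have bpi := b_ltpi.
have ht : 0 < t < pi by apply: inpi; rewrite et.
have w0 := wt_gt0 m1 m2 ht.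
have he : 0 < e < pi by apply: inpi; rewrite lexx (le_trans et).
have we := wt_gt0 m1 m2 he.
have G0 : 0 <= G by apply: le_trans (hG e _) => //; rewrite lexx.
have d1 s (hs : e <= s <= t) : is_derive s 1 v (- (A s * g (u s))).
  by case/andP: hs => ? ?; have [] := sol (t := s) (ltac:(apply/andP; split; lra)).
have d2 s (hs : e <= s <= t) : is_derive s 1 (fun s => G * (s * A s)) (G * (A s + s * (A s * q s))).
  have hs' : 0 < s < pi by case/andP: hs => ? ?; apply: inpi; apply/andP; split; lra.
  apply: der_eq (der_mul (der_cst G s) (der_mul (der_id s) (der_wt m1 m2 hs'))) _.
  by rewrite mul0r add0r mul1r.
have := der_norm_le et d1 d2; rewrite ve subr0 => h.
have {h} h : `|v t| <= G * (t * A t).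
  apply: le_trans (h _) _.
    move=> s /andP[s1 s2]; have hs : 0 < s < pi by apply: inpi; apply/andP; split; lra.
    have ws := wt_gt0 m1 m2 hs.
    rewrite normrN normrM (gtr0_norm ws) mulrC.
    apply: ler_pM; rewrite ?(ltW ws) //; first by apply: hG; rewrite s1.
    have qs : 0 <= q s by apply: le_trans qt _; apply: frc_nonincreasing => //; lra.
    by rewrite lerDl; apply: mulr_ge0; [lra|apply: mulr_ge0; [exact: ltW|]].
  by rewrite lerBlDr lerDl; apply: mulr_ge0 => //; apply: mulr_ge0; exact: ltW.
by rewrite normrM normfV (gtr0_norm w0) ler_pdivrMr // -mulrA.
Qed.

End Solution.

(** The energy may be negative because of the quadratic part of Fnl, but the
   superlinear part dominates it up to constants. *)
Lemma sqr_le_energy : exists C0 C1 : R, [/\ 0 <= C0, 0 <= C1,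
  forall x, - C0 <= F x & forall u v t,
  [/\ 0 <= energy u v t + C0,
      (v t / A t) ^+ 2 <= 2 * (energy u v t + C0) &
      u t ^+ 2 <= 2 / lam * (energy u v t + C0) + C1]].
Proof.
have a0 := a_gt0; have l0 := lam_gt0.
have [C0 C00 hC0] := Fnl_bounded_below a_gt0 lam_gt0.
have ea : 0 < (a + 2)^-1 by rewrite invr_gt0; lra.
have [C C_0 hC] := sqr_le_pw a_gt0 ea.
exists C0, (2 * C); split => //; first by rewrite mulr_ge0.
move=> u v t; have h := hC0 (u t); have h2 := sqr_ge0 (v t / A t).
rewrite /energy; move: (v t / A t) h2 => w h2; split; [lra|lra|].
have hu := hC (u t).
have -> : u t ^+ 2 = 2 * (u t ^+ 2 - u t ^+ 2 / 2) by field.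
have -> : 2 / lam * (w ^+ 2 / 2 + F (u t) + C0) + 2 * C =
  2 * (((w ^+ 2 / 2 + C0) / lam) + F (u t) / lam + C).
  by field; rewrite gt_eqF.
rewrite ler_pM2l //.
have -> : F (u t) / lam = (a + 2)^-1 * (pw a (u t) * u t ^+ 2) - u t ^+ 2 / 2.
  have a2 : 0 < a + 2 by lra.
  by rewrite /Fnl; field; rewrite !gt_eqF.
have : 0 <= (w ^+ 2 / 2 + C0) / lam by apply: divr_ge0; [lra|exact: ltW].
lra.
Qed.

End Energy.

(** * The Pohozaev function *)

Section Pohozaev.
Context {R : realType}.
Variables (a lam : R) (m1 m2 : nat).
Hypotheses (a_gt0 : 0 < a) (lam_gt0 : 0 < lam) (m1_gt0 : (0 < m1)%N)
  (subcritical : a * (m1%:R - 1) < 4).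
Implicit Types (u v : R -> R) (r s t b d e x y : R).

Local Notation A := (wt m1 m2).
Local Notation q := (frc m1 m2).
Local Notation g := (gnl a lam).
Local Notation F := (Fnl a lam).
Local Notation E := (energy a lam m1 m2).
Local Notation p := (pw a).

(** Subcriticality says that (m1 - 1) / 2 < (m1 + 1) / (a + 2). The multiplier pcoef
   is the midpoint of this gap and pkap a quarter of its length. *)
Definition pkap : R := ((m1%:R + 1) / (a + 2) - (m1%:R - 1) / 2) / 4.
Definition pcoef : R := (m1%:R - 1) / 2 + 2 * pkap.

Lemma pkap_gt0 : 0 < pkap.
Proof.
have a0 := a_gt0; have h := subcritical; have a2 : 0 < a + 2 by lra.
have -> : pkap = (4 - a * (m1%:R - 1)) / (8 * (a + 2)).
  by rewrite /pkap; field; rewrite gt_eqF.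
by apply: divr_gt0; lra.
Qed.

Lemma m1_ge1 : 1 <= m1%:R :> R. Proof. by rewrite ler1n. Qed.

Lemma pcoef_ge0 : 0 <= pcoef.
Proof. by have := m1_ge1; have := pkap_gt0; rewrite /pcoef; lra. Qed.

(** The function whose derivative is obtained by testing the equation with t u'
   and with pcoef u. *)
Definition pohozaev u v t := A t * (t * E u v t) + pcoef * (u t * v t).

Lemma der_pohozaev e b u v t : 0 < e -> b < pi -> ode_sol A g e b u v ->
  e <= t <= b ->
  is_derive t 1 (pohozaev u v)
    (A t * ((1 + t * q t) * E u v t - t * q t * (v t / A t) ^+ 2
       + pcoef * (v t / A t) ^+ 2 - pcoef * (u t * g (u t)))).
Proof.
move=> e0 bpi sol ht; have [du dv] := sol t ht.
have hp : 0 < t < pi by case/andP: ht => ? ?; apply/andP; split; lra.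
have w0 := wt_gt0 m1 m2 hp.
have dE := der_energy a_gt0 e0 bpi sol ht.
apply: der_eq (der_add (der_mul (der_wt m1 m2 hp) (der_mul (der_id t) dE))
  (der_mul (der_cst pcoef t) (der_mul du dv))) _.
by field; rewrite gt_eqF.
Qed.

(** When t q t is within pkap of m1, the position of pcoef inside the gap makes the
   coefficient of the squared slope nonnegative and leaves at least pkap in front
   of the superlinear term. *)
Lemma pohozaev_der_ge u v t : `|t * q t - m1%:R| <= pkap ->
  pkap * (p (u t) * u t ^+ 2) * lam - lam * u t ^+ 2 <=
  (1 + t * q t) * E u v t - t * q t * (v t / A t) ^+ 2
       + pcoef * (v t / A t) ^+ 2 - pcoef * (u t * g (u t)).
Proof.
move=> h; have a0 := a_gt0; have l0 := lam_gt0; have k0 := pkap_gt0.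
have w2 := sqr_ge0 (v t / A t); have u2 := sqr_ge0 (u t).
have pu2 : 0 <= p (u t) * u t ^+ 2 by rewrite mulr_ge0 ?pw_ge0.
rewrite /energy; move: (v t / A t) w2 => w w2.
have a2 : 0 < a + 2 by lra.
have -> : (1 + t * q t) * (w ^+ 2 / 2 + F (u t)) - t * q t * w ^+ 2
       + pcoef * w ^+ 2 - pcoef * (u t * g (u t)) =
  w ^+ 2 * ((1 - t * q t) / 2 + pcoef)
  + lam * (p (u t) * u t ^+ 2) * ((1 + t * q t) / (a + 2) - pcoef)
  + lam * u t ^+ 2 * (pcoef - (1 + t * q t) / 2).
  by rewrite /Fnl /gnl; field; rewrite gt_eqF.
move: h; rewrite ler_norml => /andP[h1 h2].
have e1 : 0 <= (1 - t * q t) / 2 + pcoef by rewrite /pcoef; lra.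
have e2 : pkap <= (1 + t * q t) / (a + 2) - pcoef.
  have k4 : (m1%:R + 1) / (a + 2) = 4 * pkap + (m1%:R - 1) / 2 by rewrite /pkap; field; rewrite gt_eqF.
  have : (m1%:R + 1) / (a + 2) - (1 + t * q t) / (a + 2) <= pkap.
    rewrite -mulrBl ler_pdivrMr //; nra.
  by rewrite /pcoef k4; lra.
have e3 : - 1 <= pcoef - (1 + t * q t) / 2 by rewrite /pcoef; lra.
have f1 := mulr_ge0 w2 e1.
have f2 := ler_wpM2l (mulr_ge0 (ltW l0) pu2) e2.
have f3 := ler_wpM2l (mulr_ge0 (ltW l0) u2) e3.
lra.
Qed.

(** Up to this distance from the endpoint the friction is close to m1 / r. *)
Definition rad : R := Num.min 1 (Num.min pkap 2^-1 / (m1%:R + m2%:R)).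

Lemma rad_gt0 : 0 < rad.
Proof.
have := m1_ge1; have : 0 <= m2%:R :> R by []; have := pkap_gt0 => h1 h2 h3.
rewrite lt_min ltr01 divr_gt0 //; last lra.
by rewrite lt_min h1; lra.
Qed.

Lemma rad_le1 : rad <= 1. Proof. by rewrite ge_min lexx. Qed.

Lemma rad_ltpi : rad < pi.
Proof. by have := rad_le1; have := @pi_ge2 R; lra. Qed.

Lemma frc_rad t : 0 < t <= rad -> `|t * q t - m1%:R| <= Num.min pkap 2^-1.
Proof.
move=> /andP[t0 tr]; have r1 := rad_le1; have h1 := m1_ge1.
have h2 : 0 <= m2%:R :> R by []; have h3 : 0 < m1%:R + m2%:R :> R by lra.
have ht1 : 0 < t <= 1 by apply/andP; split; lra.
apply: le_trans (frc_near0 m1 m2 ht1) _.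
have : t <= Num.min pkap 2^-1 / (m1%:R + m2%:R) by apply: le_trans tr _; rewrite ge_min lexx orbT.
rewrite ler_pdivlMr // => h; apply: le_trans h.
rewrite mulrC; apply: ler_wpM2r; [exact: ltW|nra].
Qed.

Lemma frc_rad_ge0 t : 0 < t <= rad -> 0 <= q t.
Proof.
move=> ht; have := frc_rad ht; rewrite le_min => /andP[_].
rewrite ler_norml => /andP[h _]; have := m1_ge1 => h1.
have /andP[t0 _] := ht.
by rewrite -(pmulr_rge0 _ t0); lra.
Qed.

End Pohozaev.

(** * Large heights produce large energy *)

Section Blowup.
Context {R : realType}.
Variables (a lam : R) (m1 m2 : nat).
Hypotheses (a_gt0 : 0 < a) (lam_gt0 : 0 < lam) (m1_gt0 : (0 < m1)%N)
  (subcritical : a * (m1%:R - 1) < 4).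
Implicit Types (u v : R -> R) (r s t b d e x y B : R).

Local Notation A := (wt m1 m2).
Local Notation q := (frc m1 m2).
Local Notation g := (gnl a lam).
Local Notation F := (Fnl a lam).
Local Notation E := (energy a lam m1 m2).
Local Notation p := (pw a).
Local Notation P := (pohozaev a lam m1 m2).
Local Notation rad := (rad a m1 m2).
Local Notation pkap := (pkap a m1).
Local Notation pcoef := (pcoef a m1).

Let kap0 : 0 < pkap. Proof. exact: pkap_gt0. Qed.
Let rad0 : 0 < rad. Proof. exact: rad_gt0. Qed.
Let rad1 : rad <= 1. Proof. exact: rad_le1. Qed.
Let radpi : rad < pi. Proof. exact: rad_ltpi. Qed.

(* Linear arithmetic below only sees the hypotheses that are passed to it. *)
Ltac forget := clear -a_gt0 lam_gt0 m1_gt0 m2 subcritical kap0 rad0 rad1 radpi.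

(** The length on which a solution of height d keeps at least half of its height. *)
Definition scale d := Num.sqrt lam^-1 * d `^ (- (a / 2)).

Lemma scale_gt0 d : 0 < d -> 0 < scale d.
Proof. by move=> d0; rewrite mulr_gt0 ?powR_gt0 // sqrtr_gt0 invr_gt0. Qed.

Lemma scale_sqr d : 0 < d -> lam * p d * scale d ^+ 2 = 1.
Proof.
move=> d0; rewrite /scale exprMn sqr_sqrtr ?invr_ge0 ?(ltW lam_gt0) //.
rewrite -powR_mulrn ?powR_ge0 // -powRrM /pw gtr0_norm //.
have -> : - (a / 2) * 2%:R = - a by field.
rewrite powRN; have : d `^ a != 0 by rewrite gt_eqF // powR_gt0.
by move=> h; field; rewrite h gt_eqF.
Qed.

Lemma scale_small r : 0 < r -> exists2 D, 1 <= D & forall d, D <= d -> scale d <= r.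
Proof.
move=> r0; have [D D1 hD] := pw_large a_gt0 ((lam * r ^+ 2)^-1).
exists D => // d Dd; have d0 : 0 < d by lra.
have hd : (lam * r ^+ 2)^-1 <= p d by apply: hD; rewrite gtr0_norm.
have lr : 0 < lam * r ^+ 2 by rewrite mulr_gt0 // exprn_gt0.
have h1 : 1 <= lam * r ^+ 2 * p d by rewrite mulrC -ler_pdivrMr // div1r.
have h2 := scale_sqr d0; have s0 := scale_gt0 d0.
suff : scale d ^+ 2 <= r ^+ 2 by rewrite ler_sqr // nnegrE ltW.
have pd : 0 < lam * p d by rewrite mulr_gt0 // powR_gt0 // normr_gt0 gt_eqF.
rewrite -(ler_pM2l pd) h2; lra.
Qed.

(** The quantity grows like d to the power a + 2 - (m1 + 1) a / 2, which is
   positive exactly in the subcritical case. *)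
Lemma scale_growth B : exists2 D, 1 <= D & forall d, D <= d ->
  B <= p d * d ^+ 2 * scale d ^+ m1.+1.
Proof.
have a0 := a_gt0; have sc := subcritical.
pose del : R := (a + 4 - a * m1%:R) / 2.
have del0 : 0 < del by rewrite /del; lra.
pose c := Num.sqrt lam^-1 ^+ m1.+1.
have c0 : 0 < c by rewrite exprn_gt0 // sqrtr_gt0 invr_gt0.
have [D D1 hD] := pw_large del0 (B / c).
exists D => // d Dd; have d0 : 0 < d by lra.
have -> : p d * d ^+ 2 * scale d ^+ m1.+1 = c * pw del d.
  rewrite /scale exprMn /pw (gtr0_norm d0) -/c -(powR_mulrn 2 (ltW d0)).
  rewrite -(powR_mulrn m1.+1 (powR_ge0 _ _)) -powRrM.
  rewrite mulrCA; congr (_ * _); rewrite -!powRD ?(gt_eqF d0) ?implybT //.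
  by congr (_ `^ _); rewrite /del -natr1; field.
have := hD d; rewrite gtr0_norm // => /(_ Dd).
by rewrite ler_pdivrMr // mulrC.
Qed.

Section Initial.
Variables (e d : R) (u v : R -> R).
Hypotheses (e_gt0 : 0 < e) (e_rad : e <= rad / 2) (sol : ode_sol A g e rad u v)
  (v_e : v e = 0) (u_e : u e = d) (d_ge1 : 1 <= d) (d_large : a + 2 <= p d).

Let in_rad t : e <= t <= rad -> 0 < t <= rad.
Proof. by have := e_gt0 => ? /andP[? ?]; apply/andP; split; lra. Qed.

Lemma energy_initial : E u v e = F d.
Proof. by rewrite /energy v_e u_e mul0r expr0n /= mul0r add0r. Qed.

(** The energy has not increased, and Fnl is monotone beyond d. *)
Lemma initial_bound t : e <= t <= rad -> `|u t| <= d.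
Proof.
move=> ht; have a0 := a_gt0; have /andP[et tr] := ht; have hd := d_large.
apply: (Fnl_le_norm a_gt0 lam_gt0 d_ge1); first by have := a_gt0; lra.
rewrite -energy_initial.
apply: le_trans (_ : E u v t <= _); first by rewrite /energy lerDr divr_ge0 ?sqr_ge0.
apply: (energy_nonincreasing a_gt0 e_gt0 radpi sol) => //.
exact: (frc_rad_ge0 m1_gt0 (in_rad ht)).
Qed.

Lemma initial_slope t : e <= t <= rad -> `|v t / A t| <= lam * (p d * d) * t.
Proof.
move=> ht; have /andP[et tr] := ht.
apply: (slope_le e_gt0 radpi sol ht v_e).
  exact: (frc_rad_ge0 m1_gt0 (in_rad ht)).
move=> s /andP[s1 s2]; apply: (gnl_le a_gt0 lam_gt0 d_ge1); apply: initial_bound.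
by rewrite s1 (le_trans s2).
Qed.

Lemma initial_plateau t : e <= t <= rad -> t <= scale d -> d / 2 <= u t.
Proof.
move=> ht ts; have /andP[et tr] := ht; have d1 := d_ge1; have d0 : 0 < d by lra.
have e0 := e_gt0.
pose G := lam * (p d * d).
have G0 : 0 <= G by rewrite mulr_ge0 ?(ltW lam_gt0) // mulr_ge0 ?pw_ge0 // ltW.
have du s (hs : e <= s <= t) : is_derive s 1 u (v s / A s).
  by case/andP: hs => s1 s2; have [] := sol (t := s) (ltac:(rewrite s1 (le_trans s2))).
have dG s (hs : e <= s <= t) : is_derive s 1 (fun s => s ^+ 2 * (G / 2)) (G * s).
  apply: der_eq (der_mul (der_exp 2 (der_id s)) (der_cst (G / 2) s)) _.
  by rewrite /= expr1; field.
have := der_norm_le et du dG; rewrite u_e => h.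
have {h} : `|u t - d| <= t ^+ 2 * (G / 2) - e ^+ 2 * (G / 2).
  by apply: h => s /andP[s1 s2]; apply: initial_slope; rewrite s1 (le_trans s2).
have e2 : 0 <= e ^+ 2 * (G / 2) by rewrite mulr_ge0 ?sqr_ge0 // divr_ge0.
have t2 : t ^+ 2 * G <= scale d ^+ 2 * G.
  by apply: ler_wpM2r => //; rewrite ler_sqr ?nnegrE // ?(ltW (scale_gt0 d0)) //; lra.
have : scale d ^+ 2 * G = d.
  by rewrite -[RHS]mul1r -(scale_sqr d0) /G; ring.
rewrite ler_norml => ? /andP[? _]; lra.
Qed.

End Initial.

Local Notation rate x := (pkap * (p x * x ^+ 2) * lam - lam * x ^+ 2).

(** Half of the maximal height still carries a fixed share of the top order
   term, and the negative quadratic term is of lower order. *)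
Lemma plateau_rate : exists k D : R, [/\ 0 < k, 1 <= D &
  forall d x, D <= d -> d / 2 <= x -> k * (p d * d ^+ 2) <= rate x].
Proof.
have k20 : 0 < pkap / 2 by rewrite divr_gt0.
have [C C0 hC] := sqr_le_pw a_gt0 k20.
have p12 : 0 < p 2^-1 by rewrite powR_gt0 // normr_gt0 invr_eq0.
pose k := lam * (pkap * p 2^-1 / 16).
have k0 : 0 < k by rewrite mulr_gt0 // divr_gt0 // mulr_gt0.
have [D D1 hD] := pw_large a_gt0 (lam * C / k).
exists k, D; split => // d x Dd dx.
have d1 : 1 <= d := le_trans D1 Dd; have d0 : 0 < d := lt_le_trans ltr01 d1.
have d2 : 0 < d / 2 by rewrite divr_gt0.
have x0 : 0 < x := lt_le_trans d2 dx.
have h1 : p 2^-1 * p d * (d ^+ 2 / 4) <= p x * x ^+ 2.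
  have -> : p 2^-1 * p d = p (d / 2) by rewrite mulrC /pw normrM powRM.
  have -> : d ^+ 2 / 4 = (d / 2) ^+ 2 by field.
  apply: ler_pM; [exact: pw_ge0|exact: sqr_ge0| |].
    by apply: pw_le => //; rewrite !gtr0_norm.
  by rewrite ler_sqr // nnegrE ltW.
have h2 : lam * x ^+ 2 <= lam * (pkap / 2 * (p x * x ^+ 2)) + lam * C.
  by rewrite -mulrDr ler_pM2l //; exact: hC.
have h3 : lam * C <= k * (p d * d ^+ 2).
  have hd : lam * C / k <= p d by apply: hD; rewrite gtr0_norm.
  rewrite ler_pdivrMr // in hd; apply: le_trans hd _.
  by rewrite mulrC ler_pM2l // ler_peMr ?pw_ge0 // exprn_ege1.
have h4 : 2 * (k * (p d * d ^+ 2)) <= lam * (pkap / 2 * (p x * x ^+ 2)).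
  have -> : 2 * (k * (p d * d ^+ 2)) = lam * (pkap / 2 * (p 2^-1 * p d * (d ^+ 2 / 4))).
    by rewrite /k; field.
  by rewrite ler_pM2l // ler_pM2l.
by move: h2 h3 h4; forget; lra.
Qed.

Lemma pohozaev_start : exists k D : R, [/\ 0 < k, 1 <= D &
  forall e d u v, 0 < e <= 1 -> v e = 0 -> u e = d -> D <= d ->
  k * (p d * d ^+ 2) * e ^+ m1.+1 <= P u v e].
Proof.
have [c c0 hc] := @wt_lower R m1 m2.
have [D D1 hD] := pw_large a_gt0 (a + 2).
have a2 : 0 < a + 2 := addr_gt0 a_gt0 (ltr0Sn _ _).
pose k := lam / (2 * (a + 2)).
have k0 : 0 < k by rewrite divr_gt0 // mulr_gt0.
exists (c * k), D; split => //; first exact: mulr_gt0.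
move=> e d u v he ve ue Dd; have /andP[e0 _] := he.
have d1 : 1 <= d := le_trans D1 Dd; have d0 : 0 < d := lt_le_trans ltr01 d1.
have dl : a + 2 <= p d by apply: hD; rewrite gtr0_norm.
have -> : P u v e = A e * (e * F d).
  by rewrite /pohozaev /energy ve ue mulr0 mul0r expr0n /= mul0r add0r mulr0 addr0.
have -> : c * k * (p d * d ^+ 2) * e ^+ m1.+1 = c * e ^+ m1 * (e * (k * (p d * d ^+ 2))).
  by rewrite [e ^+ m1.+1]exprS; ring.
have F1 : k * (p d * d ^+ 2) <= F d.
  have -> : F d = k * (p d * d ^+ 2) + k * (d ^+ 2 * (p d - (a + 2))).
    by rewrite /Fnl /k; field; rewrite gt_eqF.
  rewrite lerDl; apply: mulr_ge0; first exact: ltW.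
  by apply: mulr_ge0; [exact: sqr_ge0|rewrite subr_ge0].
have q0 : 0 <= k * (p d * d ^+ 2).
  by apply: mulr_ge0; [exact: ltW|apply: mulr_ge0; [exact: pw_ge0|exact: sqr_ge0]].
apply: ler_pM; last by rewrite ler_pM2l.
- by rewrite mulr_ge0 ?exprn_ge0 // ltW.
- by rewrite mulr_ge0 // ltW.
- exact: hc.
Qed.

(** The weight is at least c s ^ m1, which is integrated against the rate k. *)
Lemma pohozaev_gain c k e T u v :
  (forall t, 0 < t <= 1 -> c * t ^+ m1 <= A t) -> 0 < c -> 0 <= k ->
  0 < e -> e <= T -> T <= rad -> ode_sol A g e rad u v ->
  (forall s, e <= s <= T -> k <= rate (u s)) ->
  c * k / m1.+1%:R * (T ^+ m1.+1 - e ^+ m1.+1) <= P u v T - P u v e.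
Proof.
move=> hc c0 k0 e0 eT Tr sol hk; have mp : 0 < m1.+1%:R :> R by rewrite ltr0Sn.
have hr s : e <= s <= T -> e <= s <= rad by move=> /andP[-> /le_trans ->].
have dP s (hs : e <= s <= T) := der_pohozaev a_gt0 e0 radpi sol (hr s hs).
have dk s (hs : e <= s <= T) :
    is_derive s 1 (fun s => c * k / m1.+1%:R * s ^+ m1.+1) (c * s ^+ m1 * k).
  apply: der_eq (der_mul (der_cst (c * k / m1.+1%:R) s) (der_exp m1.+1 (der_id s))) _.
  by rewrite /=; field; rewrite gt_eqF.
rewrite mulrBr; apply: (der_le eT dk dP) => s hs; have /andP[es sT] := hs.
have s0 : 0 < s := lt_le_trans e0 es.
have sr : 0 < s <= rad by rewrite s0 (le_trans sT).
have fr : `|s * q s - m1%:R| <= pkap.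
  by apply: le_trans (frc_rad m1_gt0 sr) _; rewrite ge_min lexx.
apply: ler_pM => //; first by rewrite mulr_ge0 ?exprn_ge0 // ltW.
  by apply: hc; rewrite s0 (le_trans sT) // (le_trans Tr).
exact: le_trans (hk s hs) (pohozaev_der_ge a_gt0 lam_gt0 subcritical u v fr).
Qed.

(** The superlinear term compensates the negative quadratic term up to a constant,
   whatever the solution. *)
Lemma pohozaev_loss : exists2 C, 0 <= C & forall e s t u v,
  0 < e -> e <= s -> s <= t -> t <= rad -> ode_sol A g e rad u v ->
  P u v s - C <= P u v t.
Proof.
have [C C0 hC] := sqr_le_pw a_gt0 kap0.
have lC : 0 <= lam * C by rewrite mulr_ge0 // ltW.
exists (lam * C) => // e s t u v e0 es st tr sol.
have hr x : s <= x <= t -> e <= x <= rad.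
  by move=> /andP[sx xt]; rewrite (le_trans es sx) (le_trans xt tr).
have dP x (hx : s <= x <= t) := der_pohozaev a_gt0 e0 radpi sol (hr x hx).
have dk x (_ : s <= x <= t) := der_lin (- (lam * C)) x.
have := der_le st dk dP.
have ts : lam * C * (t - s) <= lam * C.
  rewrite ler_piMr // lerBlDr (le_trans tr) // (le_trans rad1) // lerDl.
  exact: le_trans (ltW e0) es.
suff h x : s <= x <= t -> - (lam * C) <= A x * ((1 + x * q x) * E u v x
    - x * q x * (v x / A x) ^+ 2 + pcoef * (v x / A x) ^+ 2 - pcoef * (u x * g (u x))).
  by move=> /(_ h); move: ts; rewrite mulrBr; forget; lra.
move=> hx; have /andP[ex xr] := hr x hx; have x0 : 0 < x := lt_le_trans e0 ex.
have xr0 : 0 < x <= rad by rewrite x0.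
have hp : 0 < x < pi by rewrite x0 (le_lt_trans xr radpi).
have fr : `|x * q x - m1%:R| <= pkap.
  by apply: le_trans (frc_rad m1_gt0 xr0) _; rewrite ge_min lexx.
have w0 := wt_gt0 m1 m2 hp; have w1 := wt_le1 m1 m2 hp.
apply: le_trans (_ : A x * - (lam * C) <= _).
  by rewrite mulrN lerN2 ler_piMl.
rewrite ler_pM2l //; apply: le_trans (pohozaev_der_ge a_gt0 lam_gt0 subcritical u v fr).
have : lam * u x ^+ 2 <= lam * (pkap * (p (u x) * u x ^+ 2) + C).
  by rewrite ler_pM2l //; exact: hC.
by forget; lra.
Qed.

Lemma pohozaev_le_energy : exists K L : R, 0 < K /\ forall u v t,
  0 < t <= rad -> P u v t <= K * E u v t + L.
Proof.
have [C0 [C1 [C00 C10 _ hE]]] := sqr_le_energy m1 m2 a_gt0 lam_gt0.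
have pc := pcoef_ge0 a_gt0 m1_gt0 subcritical.
have li : 0 < lam^-1 by rewrite invr_gt0.
pose K := 1 + pcoef * (1 + lam^-1); pose L := pcoef * (C1 / 2).
have pli : 0 <= pcoef * (1 + lam^-1) by rewrite mulr_ge0 // addr_ge0 // ltW.
have K0 : 0 < K by rewrite ltr_pwDl.
have L0 : 0 <= L by rewrite mulr_ge0 // divr_ge0.
exists K, (K * C0 + L); split => // u v t /andP[t0 tr].
have hp : 0 < t < pi by rewrite t0 (le_lt_trans tr radpi).
have w0 := wt_gt0 m1 m2 hp; have w1 := wt_le1 m1 m2 hp.
have [e1 e2 e3] := hE u v t; move: e1 e2 e3.
have -> : P u v t = A t * (t * E u v t + pcoef * (u t * (v t / A t))).
  by rewrite /pohozaev; field; rewrite gt_eqF.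
move: (E u v t) (v t / A t) (u t) => x w y e1 e2 e3.
have x2 : y * w <= (1 + lam^-1) * (x + C0) + C1 / 2.
  by have := sqr_ge0 (y - w); move: e2 e3; forget; lra.
have x3 := ler_wpM2l pc x2.
have x4 : t * x <= x + C0.
  apply: le_trans (_ : t * (x + C0) <= _); first by rewrite ler_pM2l // lerDl.
  by rewrite ler_piMl // (le_trans tr).
have x5 : 0 <= K * (x + C0) + L by rewrite addr_ge0 // mulr_ge0 // ltW.
rewrite addrA -mulrDr; apply: le_trans (_ : A t * (K * (x + C0) + L) <= _).
  by rewrite ler_pM2l // /K /L; move: x3 x4; forget; lra.
by rewrite ler_piMl.
Qed.

(** On the plateau the Pohozaev function gains a multiple of the scale invariant
   quantity that subcriticality makes large. *)
Lemma pohozaev_initial : exists k D : R, [/\ 0 < k, 1 <= D &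
  forall e d u v, 0 < e -> e <= rad / 2 -> ode_sol A g e rad u v ->
  v e = 0 -> u e = d -> D <= d -> scale d <= rad / 2 ->
  k * (p d * d ^+ 2 * scale d ^+ m1.+1) <= P u v (Num.max e (scale d))].
Proof.
have [c c0 hc] := @wt_lower R m1 m2.
have mp : 0 < m1.+1%:R :> R by rewrite ltr0Sn.
have [k1 [D1 [k10 D11 h1]]] := plateau_rate.
have [k2 [D2 [k20 D21 h2]]] := pohozaev_start.
have [D3 D31 h3] := pw_large a_gt0 (a + 2).
pose k := Num.min (c * k1 / m1.+1%:R) k2.
have k_gt0 : 0 < k by rewrite lt_min k20 andbT divr_gt0 // mulr_gt0.
exists k, (Num.max D1 (Num.max D2 D3)); split => //; first by rewrite le_max D11.
move=> e d u v e0 er sol ve ue; rewrite !ge_max => /and3P[dD1 dD2 dD3] sr.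
have d1 : 1 <= d := le_trans D11 dD1; have d0 : 0 < d := lt_le_trans ltr01 d1.
have s0 := scale_gt0 d0.
pose Q := p d * d ^+ 2.
have Q0 : 0 <= Q by rewrite mulr_ge0 ?pw_ge0 ?sqr_ge0.
set T := Num.max e (scale d).
have eT : e <= T by rewrite le_max lexx.
have r2 : rad / 2 <= rad by rewrite ler_pdivrMr // ler_peMr // ?ler1n // ltW.
have Tr : T <= rad by rewrite ge_max (le_trans er) // (le_trans sr).
have hrate s : e <= s <= T -> k1 * Q <= rate (u s).
  move=> /andP[es sT]; apply: h1 => //.
  have [sc|sc] := leP (scale d) e.
    have -> : s = e by apply/le_anti; rewrite es (le_trans sT) // ge_max lexx.
    by rewrite ue ler_pdivrMr // ler_peMr // ?ler1n // ltW.
  apply: (initial_plateau e0 sol ve ue) => //.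
  - by apply: h3; rewrite gtr0_norm.
  - by rewrite es (le_trans sT).
  - by rewrite (le_trans sT) // ge_max lexx (ltW sc).
have e1 : 0 < e <= 1 by rewrite e0 (le_trans er) // (le_trans r2).
have hs := h2 e d u v e1 ve ue dD2.
have hg := pohozaev_gain hc c0 (mulr_ge0 (ltW k10) Q0) e0 eT Tr sol hrate.
have eTm : e ^+ m1.+1 <= T ^+ m1.+1 by rewrite lerXn2r // nnegrE ltW // (lt_le_trans e0).
have {}hs : k * Q * e ^+ m1.+1 <= P u v e.
  apply: le_trans hs; apply: ler_wpM2r; first by rewrite exprn_ge0 // ltW.
  by apply: ler_wpM2r => //; rewrite ge_min lexx orbT.
have {}hg : k * Q * (T ^+ m1.+1 - e ^+ m1.+1) <= P u v T - P u v e.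
  apply: le_trans hg; apply: ler_wpM2r; first by rewrite subr_ge0.
  have -> : c * (k1 * Q) / m1.+1%:R = c * k1 / m1.+1%:R * Q by ring.
  by apply: ler_wpM2r => //; rewrite ge_min lexx.
apply: le_trans (_ : k * Q * T ^+ m1.+1 <= _).
  rewrite mulrA; apply: ler_wpM2l; first by rewrite mulr_ge0 // ltW.
  rewrite lerXn2r //; first by rewrite nnegrE ltW.
    by rewrite nnegrE ltW // (lt_le_trans e0).
  by rewrite le_max lexx orbT.
by move: hs hg; rewrite mulrBr; forget; lra.
Qed.

(** The energy cannot be dissipated before the distance rad / 2: the Pohozaev
   function stays large, and it is controlled by the energy. *)
Lemma energy_blowup B : exists2 D, 1 <= D &
  forall e u v, 0 < e -> e <= rad / 2 -> ode_sol A g e rad u v ->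
  v e = 0 -> D <= `|u e| -> forall t, rad / 2 <= t <= rad -> B <= E u v t.
Proof.
have [k [D0 [kp D01 hk]]] := pohozaev_initial.
have [C C_0 hC] := pohozaev_loss.
have [K [L [K0 hKL]]] := pohozaev_le_energy.
have [D1 D11 hD1] := scale_growth ((K * `|B| + L + C) / k).
have r2 : 0 < rad / 2 by rewrite divr_gt0.
have [D2 D21 hD2] := scale_small r2.
exists (Num.max D0 (Num.max D1 D2)); first by rewrite le_max D01.
have core e u v t : 0 < e -> e <= rad / 2 -> ode_sol A g e rad u v ->
    v e = 0 -> Num.max D0 (Num.max D1 D2) <= u e -> rad / 2 <= t <= rad -> B <= E u v t.
  move=> e0 er sol ve; rewrite !ge_max => /and3P[d0 d1 d2] /andP[t1 t2].
  have hs := hD2 _ d2; have hP := hk e (u e) u v e0 er sol ve erefl d0 hs.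
  have hg := hD1 _ d1; rewrite ler_pdivrMr // [_ * k]mulrC in hg.
  set T := Num.max e _ in hP.
  have eT : e <= T by rewrite le_max lexx.
  have Tt : T <= t by rewrite ge_max !(le_trans _ t1).
  have hl := hC e T t u v e0 eT Tt t2 sol.
  have t0 : 0 < t <= rad by rewrite (lt_le_trans r2 t1).
  have hKE := hKL u v t t0.
  rewrite (le_trans (ler_norm B)) // -(ler_pM2l K0).
  by move: hg hP hl hKE; forget; lra.
move=> e u v e0 er sol ve hu t ht.
have [u0|u0] := lerP 0 (u e); first by apply: (core e u v) => //; rewrite -(ger0_norm u0).
rewrite -energy_opp; apply: (core e) => //.
- exact: ode_sol_opp.
- by rewrite ve oppr0.
- by rewrite -(ltr0_norm u0).
Qed.

End Blowup.

(** * Large energy produces many zeros *)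

Section Oscillation.
Context {R : realType}.
Variables (a lam : R) (m1 m2 : nat).
Hypotheses (a_gt0 : 0 < a) (lam_gt0 : 0 < lam) (m1_gt0 : (0 < m1)%N)
  (subcritical : a * (m1%:R - 1) < 4).
Implicit Types (u v : R -> R) (r s t b d e x y B l : R).

Local Notation A := (wt m1 m2).
Local Notation q := (frc m1 m2).
Local Notation g := (gnl a lam).
Local Notation F := (Fnl a lam).
Local Notation E := (energy a lam m1 m2).
Local Notation p := (pw a).
Local Notation rad := (rad a m1 m2).

Ltac forget := clear -a_gt0 lam_gt0 m1_gt0 m2 subcritical.

(** For u > 0 the logarithmic slope y = - u' / u satisfies a Riccati equation. *)
Lemma der_riccati e b u v t : 0 < e -> b < pi -> ode_sol A g e b u v ->
  e <= t <= b -> 0 < u t ->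
  is_derive t 1 (fun t => - (v t / A t) / u t)
    ((- (v t / A t) / u t) ^+ 2 - q t * (- (v t / A t) / u t) + lam * (p (u t) - 1)).
Proof.
move=> e0 bpi sol ht ut; have [du _] := sol t ht; have dw := der_slope e0 bpi sol ht.
have un : u t != 0 by rewrite gt_eqF.
have An : A t != 0.
  rewrite gt_eqF // wt_gt0 //; have /andP[t1 t2] := ht.
  by rewrite (lt_le_trans e0 t1) (le_lt_trans t2 bpi).
apply: der_eq (der_mul (der_opp dw) (der_inv un du)) _.
by rewrite /gnl; field; rewrite un An.
Qed.

(** High energy makes the Riccati right-hand side coercive: either u is large
   and lam * p u dominates, or u is bounded and then y ^ 2 is large. *)
Lemma riccati_rate (Q w : R) : 0 <= Q -> 0 < w -> exists B, forall x y (r : R),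
  `|r| <= Q -> 0 < x -> B <= (y * x) ^+ 2 / 2 + F x ->
  (y ^+ 2 + w ^+ 2) / 4 <= y ^+ 2 - r * y + lam * (p x - 1).
Proof.
move=> Q0 w0.
have [d d1 hd] := pw_large a_gt0 ((w ^+ 2 + Q ^+ 2) / (2 * lam) + 1).
have d0 : 0 < d := lt_le_trans ltr01 d1.
pose Y := w ^+ 2 + 2 * Q ^+ 2 + 4 * lam.
exists (lam * (p d * d ^+ 2) + d ^+ 2 * Y / 2) => x y r rQ x0 hE.
have r2 : r ^+ 2 <= Q ^+ 2 by rewrite -(real_normK (num_real r)) ler_sqr ?nnegrE.
have ry : r * y <= y ^+ 2 / 2 + Q ^+ 2 / 2.
  by have := sqr_ge0 (y - r); move: r2; forget; lra.
have w2 := sqr_ge0 w; have y2 := sqr_ge0 y; have q2 := sqr_ge0 Q.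
have [h|h] := lerP d x.
  have hp : (w ^+ 2 + Q ^+ 2) / (2 * lam) <= p x - 1.
    by rewrite lerBrDr; apply: hd; rewrite gtr0_norm.
  have : (w ^+ 2 + Q ^+ 2) / 2 <= lam * (p x - 1).
    apply: le_trans (_ : lam * ((w ^+ 2 + Q ^+ 2) / (2 * lam)) <= _); last by rewrite ler_pM2l.
    by rewrite le_eqVlt; apply/orP; left; apply/eqP; field; rewrite gt_eqF.
  by move: ry w2 y2 q2; forget; lra.
have xd : x ^+ 2 <= d ^+ 2 by rewrite ler_sqr ?nnegrE ltW.
have Fx : F x <= lam * (p d * d ^+ 2).
  by apply: Fnl_le => //; rewrite gtr0_norm // ltW.
have yY : Y <= y ^+ 2.
  have e1 : d ^+ 2 * Y <= d ^+ 2 * y ^+ 2.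
    have := ler_wpM2l y2 xd; move: hE Fx; rewrite exprMn; forget; lra.
  by rewrite ler_pM2l // exprn_gt0 in e1.
have lp : 0 <= lam * p x by rewrite mulr_ge0 ?pw_ge0 // ltW.
by move: ry yY lp; rewrite /Y; forget; lra.
Qed.

(** A solution of y' >= (y ^ 2 + w ^ 2) / 4 blows up within the length 16 / w:
   the angle atan (y / w) would increase by 4 > pi. *)
Lemma riccati_blowup (y y' : R -> R) s w : 0 < w ->
  (forall t, s <= t <= s + 16 / w -> is_derive t 1 y (y' t)) ->
  ~ (forall t, s <= t <= s + 16 / w -> (y t ^+ 2 + w ^+ 2) / 4 <= y' t).
Proof.
move=> w0 dy hy; have wn : w != 0 by rewrite gt_eqF.
have sl : s <= s + 16 / w by rewrite lerDl divr_ge0 // ltW.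
have dat t (ht : s <= t <= s + 16 / w) : is_derive t 1 (fun t => atan (y t * w^-1))
    ((1 + (y t * w^-1) ^+ 2)^-1 * (y' t * w^-1 + y t * 0)).
  have h := der_mul (dy t ht) (der_cst w^-1 t).
  exact: (@der_comp R (fun t => y t * w^-1) atan _ _ _ (is_derive1_atan _) h).
have dl t (_ : s <= t <= s + 16 / w) := der_lin (w / 4) t.
have := der_le sl dl dat => h.
have {}h : w / 4 * (s + 16 / w) - w / 4 * s <=
    atan (y (s + 16 / w) * w^-1) - atan (y s * w^-1).
  apply: h => t ht; rewrite mulr0 addr0.
  have dpos : 0 < y t ^+ 2 + w ^+ 2 by rewrite ltr_wpDl ?sqr_ge0 // exprn_gt0.
  have -> : (1 + (y t * w^-1) ^+ 2)^-1 = w ^+ 2 / (y t ^+ 2 + w ^+ 2).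
    by field; rewrite wn !gt_eqF.
  have -> : w / 4 = w ^+ 2 / (y t ^+ 2 + w ^+ 2) * ((y t ^+ 2 + w ^+ 2) / 4 / w).
    by field; rewrite wn gt_eqF.
  apply: ler_wpM2l; first by rewrite divr_ge0 ?sqr_ge0 // ltW.
  by apply: ler_wpM2r; [rewrite invr_ge0 ltW|exact: hy].
have e4 : w / 4 * (s + 16 / w) - w / 4 * s = 4 by field.
rewrite e4 in h; have := atan_ltpi2 (y (s + 16 / w) * w^-1).
by have := atan_gtNpi2 (y s * w^-1); have := @pihalf_lt2 R; move: h; forget; lra.
Qed.

Lemma pos_of_nonzero (w : R -> R) b s : (forall t, s <= t <= b -> {for t, continuous w}) ->
  (forall t, s <= t <= b -> w t <> 0) -> 0 < w s -> forall t, s <= t <= b -> 0 < w t.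
Proof.
move=> cw wn ws t ht; have /andP[t1 t2] := ht; rewrite ltNge; apply/negP => wt0.
have [x /andP[x1 x2] wx] : exists2 x, s <= x <= t & w x = 0.
  apply: ivt => //; first by move=> x /andP[x1 x2]; apply: cw; rewrite x1 (le_trans x2).
  by rewrite ge_min le_max wt0 orbT (ltW ws).
by apply: (wn x) => //; rewrite x1 (le_trans x2).
Qed.

(** On an interval without zeros one may assume u > 0, and the logarithmic slope
   would blow up. *)
Lemma zero_of_energy c b l : 0 < c -> b < pi -> 0 < l -> exists B,
  forall s u v, c <= s -> s + l <= b -> ode_sol A g s (s + l) u v ->
  (forall t, s <= t <= s + l -> B <= E u v t) ->
  exists2 t, s <= t <= s + l & u t = 0.
Proof.
move=> c0 bpi l0.
have Q0 : 0 <= `|q c| + `|q b| by rewrite addr_ge0.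
have w0 : 0 < 16 / l by rewrite divr_gt0.
have [B hB] := riccati_rate Q0 w0; exists B.
have core s u v : c <= s -> s + l <= b -> ode_sol A g s (s + l) u v ->
    (forall t, s <= t <= s + l -> B <= E u v t) ->
    ~ (forall t, s <= t <= s + l -> 0 < u t).
  move=> cs slb sol hE upos.
  have s0 : 0 < s := lt_le_trans c0 cs; have slpi : s + l < pi := le_lt_trans slb bpi.
  have ll : 16 / (16 / l) = l by field; rewrite gt_eqF.
  apply: (riccati_blowup (y := fun t => - (v t / A t) / u t) (s := s) w0); rewrite ll.
    by move=> t ht; exact: (der_riccati s0 slpi sol ht (upos t ht)).
  move=> t ht; have /andP[t1 t2] := ht; apply: hB; last 2 first.
  - exact: upos.
  - by rewrite divfK ?gt_eqF ?upos // sqrrN; exact: hE.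
  - by apply: frc_bounded; rewrite // (le_trans cs) // (le_trans t2).
move=> s u v cs slb sol hE.
have cu t : s <= t <= s + l -> {for t, continuous u}.
  by move=> /sol[h _]; exact: der_continuous h.
apply: contrapT => nz.
have un t : s <= t <= s + l -> u t <> 0 by move=> ht ut; apply: nz; exists t.
have hs : s <= s <= s + l by rewrite lexx lerDl ltW.
have [us|us|us] := ltgtP (u s) 0; last by case: (un s hs).
  apply: (core s (fun t => - u t) (fun t => - v t)) => //.
  - exact: ode_sol_opp.
  - by move=> t ht; rewrite energy_opp; exact: hE.
  apply: pos_of_nonzero; last by rewrite oppr_gt0.
  - by move=> t ht; apply: continuousN; exact: cu.
  - by move=> t ht /eqP; rewrite oppr_eq0 => /eqP; exact: un.
by apply: (core s u v) => //; exact: pos_of_nonzero.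
Qed.

(** The height D does not depend on the starting point e: this makes the shooting
   below uniform as e tends to 0. *)
Lemma many_zeros l : 0 < l -> exists2 D, 1 <= D &
  forall e u v, 0 < e -> e <= rad / 2 -> ode_sol A g e rad u v -> v e = 0 ->
  D <= `|u e| -> forall s, rad / 2 <= s -> s + l <= rad ->
  exists2 t, s <= t <= s + l & u t = 0.
Proof.
move=> l0; have r0 := rad_gt0 m2 a_gt0 m1_gt0 subcritical.
have r2 : 0 < rad / 2 by rewrite divr_gt0.
have [B hB] := zero_of_energy r2 (@rad_ltpi R a m1 m2) l0.
have [D D1 hD] := energy_blowup m2 a_gt0 lam_gt0 m1_gt0 subcritical B.
exists D => // e u v e0 er sol ve De s rs sl; apply: (hB s u v) => //.
  by apply: ode_sol_sub sol => //; exact: le_trans rs.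
by move=> t /andP[t1 t2]; apply: (hD e) => //; rewrite (le_trans rs t1) (le_trans t2).
Qed.

End Oscillation.

(** * Comparison of angles and reflection *)

Section AngleTools.
Context {R : realType}.
Implicit Types (u v th : R -> R) (a b c l t eta kap nu : R).

Lemma angle_ge_of_zero_intervals a b u v th c l (k : nat) : prufer a b u v th ->
  - (pi / 2) < th a -> a <= c -> 0 < l -> c + (2 * k%:R + 1) * l <= b ->
  (forall i : nat, (i <= k)%N ->
     exists2 t, c + 2 * i%:R * l <= t <= c + 2 * i%:R * l + l & u t = 0) ->
  pi / 2 + k%:R * pi <= th b.
Proof.
move=> P tha ac l0 cb hz.
have /choice[z hz'] : forall i : nat, exists t, (i <= k)%N ->
    c + 2 * i%:R * l <= t <= c + 2 * i%:R * l + l /\ u t = 0.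
  move=> i; have [ik|_] := leqP i k; last by exists 0.
  by have [t h1 h2] := hz i ik; exists t.
have zin i : (i <= k)%N -> a <= z i <= b.
  move=> ik; have [/andP[h1 h2] _] := hz' i ik.
  have ik' : (i%:R : R) <= k%:R by rewrite ler_nat.
  have i0 : (0 : R) <= i%:R by [].
  have e1 : 0 <= i%:R * l by rewrite mulr_ge0 // ltW.
  have e2 : i%:R * l <= k%:R * l by rewrite ler_pM2r.
  by apply/andP; split; lra.
have zk : pi / 2 + k%:R * pi <= th (z k).
  apply: (angle_ge_of_zeros P) => //.
    by move=> i ik; split; [exact: zin|exact: (hz' i ik).2].
  move=> i ik; have [/andP[_ h2] _] := hz' i (ltnW ik).
  have [/andP[h1 _] _] := hz' i.+1 ik.
  apply: le_lt_trans h2 _; apply: lt_le_trans h1; rewrite -natr1; lra.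
have /andP[z1 z2] := zin k (leqnn k).
by have := angle_barrier P z1 z2 (lexx b) (cos_half_pi_nat k) zk.
Qed.

(** By the law of cosines, a point at squared distance less than nu (1 - cos eta) from
   a point of squared norm at least nu lies in a direction that differs by less
   than eta; continuity excludes angles beyond pi / 2. *)
Lemma angle_close a b u1 v1 th1 u2 v2 th2 kap nu eta : a <= b ->
  prufer a b u1 v1 th1 -> prufer a b u2 v2 th2 -> th1 a = th2 a ->
  0 < eta < pi / 2 ->
  (forall t, a <= t <= b -> (u1 t - u2 t) ^+ 2 + (v1 t - v2 t) ^+ 2 <= kap) ->
  (forall t, a <= t <= b -> nu <= u1 t ^+ 2 + v1 t ^+ 2) ->
  kap < nu * (1 - cos eta) -> `|th1 b - th2 b| < eta.
Proof.
move=> ab P1 P2 e12 /andP[eta0 etapi] hk hn kn.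
have ce : 0 < cos eta by apply: cos_gt0_pihalf; apply/andP; split; lra.
have aab : a <= a <= b by rewrite lexx.
have bab : a <= b <= b by rewrite lexx ab.
have kap0 : 0 <= kap by apply: le_trans (hk a aab); rewrite addr_ge0 ?sqr_ge0.
have c1 : cos eta <= 1 by exact: cos_le1.
have nu0 : 0 < nu.
  rewrite ltNge; apply/negP => nu0; have : nu * (1 - cos eta) <= 0.
    by rewrite mulr_le0_ge0 // subr_ge0.
  by move=> /(lt_le_trans kn) /(le_lt_trans kap0); rewrite ltxx.
have knu : kap < nu by apply: lt_le_trans kn _; rewrite ler_piMr ?gerBl // ltW.
have half : `|th1 b - th2 b| < pi / 2.
  apply: (angle_stay_close bab P1 P2); last first.
    by rewrite e12 subrr normr0; have := @pi_gt0 R; lra.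
  move=> s /andP[s1 s2]; have hs : a <= s <= b by rewrite s1.
  by apply: dot_pos_of_close; have := hk s hs; have := hn s hs; lra.
rewrite ltNge; apply/negP => he.
have cosd : cos (th1 b - th2 b) <= cos eta.
  rewrite -cos_norm leNgt; apply/negP.
  have pi0 := @pi_gt0 R.
  have pi2 : pi / 2 <= pi :> R by rewrite ler_pdivrMr // ler_peMr ?ler1n // ltW.
  rewrite ltr_cos ?in_itv /=; first by rewrite ltNge he.
    by rewrite normr_ge0 (le_trans (ltW half)).
  by rewrite (ltW eta0) (le_trans (ltW etapi)).
have d := cos_angle_diff bab P1 P2.
have sq1 : amp u1 v1 b ^+ 2 = u1 b ^+ 2 + v1 b ^+ 2.
  by rewrite sqr_sqrtr // ltW // (prufer_pos P1).
have sq2 : amp u2 v2 b ^+ 2 = u2 b ^+ 2 + v2 b ^+ 2.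
  by rewrite sqr_sqrtr // ltW // (prufer_pos P2).
have a1 := prufer_amp_gt0 P1 bab; have a2 := prufer_amp_gt0 P2 bab.
have := hk b bab; have := hn b bab.
move: d sq1 sq2 a1 a2; move: (amp u1 v1 b) (amp u2 v2 b) => x y d sq1 sq2 x0 y0 h1 h2.
have xy0 : 0 < x * y by rewrite mulr_gt0.
have e1 : x * y * cos (th1 b - th2 b) <= x * y * cos eta by rewrite ler_pM2l.
have e2 : x * y * cos eta <= (x ^+ 2 + y ^+ 2) / 2 * cos eta.
  by rewrite ler_pM2r //; move: (sqr_ge0 (x - y)); clear; lra.
have e3 : nu * (1 - cos eta) <= x ^+ 2 * (1 - cos eta).
  by apply: ler_wpM2r; [rewrite subr_ge0|rewrite sq1].
have e4 : 0 <= y ^+ 2 * (1 - cos eta) by rewrite mulr_ge0 ?sqr_ge0 // subr_ge0.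
(* if the angle were eta, the law of cosines would make the distance too large *)
have e5 : (u1 b - u2 b) ^+ 2 + (v1 b - v2 b) ^+ 2 =
   x ^+ 2 + y ^+ 2 - 2 * (x * y * cos (th1 b - th2 b)).
  by rewrite sq1 sq2 -d; ring.
by move: kn h2 e1 e2 e3 e4; rewrite e5; clear; lra.
Qed.

End AngleTools.

Section Reflection.
Context {R : realType}.
Variables (m1 m2 : nat).
Implicit Types (g u v : R -> R) (a b t : R).

(** Reflection exchanges the endpoints, hence the multiplicities. *)
Lemma ode_sol_refl g a b u v : ode_sol (wt m1 m2) g a b u v ->
  ode_sol (wt m2 m1) g (pi - b) (pi - a) (fun t => u (pi - t)) (fun t => - v (pi - t)).
Proof.
move=> sol t /andP[t1 t2].
have [du dv] := sol (pi - t) ltac:(apply/andP; split; lra).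
have dr : is_derive t 1 (fun t : R => pi - t) (- 1).
  by apply: der_eq (der_sub (der_cst pi t) (der_id t)) _; rewrite sub0r.
split.
  by apply: der_eq (@der_comp R (fun t => pi - t) u _ _ _ du dr) _; rewrite -(wt_refl m1 m2 t); ring.
by apply: der_eq (der_opp (@der_comp R (fun t => pi - t) v _ _ _ dv dr)) _; rewrite -(wt_refl m1 m2 t); ring.
Qed.

End Reflection.

(** * Solutions on the regularised interval *)

Section Cauchy.
Context {R : realType}.
Variables (a lam : R) (m1 m2 : nat).
Hypotheses (a_gt0 : 0 < a) (lam_gt0 : 0 < lam).
Implicit Types (u v : R -> R) (r s t b d e x y B l M D eps : R).

Local Notation A := (wt m1 m2).
Local Notation q := (frc m1 m2).
Local Notation g := (gnl a lam).
Local Notation F := (Fnl a lam).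
Local Notation E := (energy a lam m1 m2).
Local Notation p := (pw a).

Ltac forget := clear -a_gt0 lam_gt0 m1 m2.

Lemma clamp_bounds M x : 0 <= M -> `|Num.min (Num.max x (- M)) M| <= M.
Proof.
move=> M0; rewrite ler_norml le_min ge_min lexx orbT andbT le_max lexx orbT /=.
lra.
Qed.

Lemma clamp_lip c b x y : c <= b ->
  `|Num.min (Num.max x c) b - Num.min (Num.max y c) b| <= `|x - y|.
Proof.
move=> cb; rewrite ler_norml; have h1 := ler_norm (x - y).
have h2 := ler_norm (- (x - y)); rewrite normrN in h2.
have h0 := normr_ge0 (x - y).
apply/andP; move: (`|x - y|) h0 h1 h2 cb => z; rewrite /Num.min /Num.max; forget.
by case: (ltP x c) => ?; case: (ltP y c) => ?; do 2 case: ltP => ?; split; lra.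
Qed.

Lemma energy_growth e b u v C0 Q : 0 < e -> b < pi -> e <= b -> 0 <= Q ->
  ode_sol A g e b u v ->
  (forall t, e <= t <= b -> `|q t| <= Q) ->
  (forall t, (v t / A t) ^+ 2 <= 2 * (E u v t + C0)) ->
  E u v b + C0 <= (E u v e + C0) * expR (2 * Q * (b - e)).
Proof.
move=> e0 bpi eb Q0 sol hQ hE.
have dE t (ht : e <= t <= b) := der_add (der_energy a_gt0 e0 bpi sol ht) (der_cst C0 t).
apply: (gronwall_le eb dE) => t ht; rewrite addr0.
have := hQ t ht; rewrite ler_norml => /andP[h1 _].
have w2 := sqr_ge0 (v t / A t).
have e1 : - (q t * (v t / A t) ^+ 2) <= Q * (v t / A t) ^+ 2.
  by rewrite -mulNr; apply: ler_wpM2r => //; lra.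
have := ler_wpM2l Q0 (hE t); lra.
Qed.

(** Solutions on a compact interval depend on their phase point at any time s in a
   Lipschitz way, and the zero solution is among them. *)
Lemma solutions_dist c b M : 0 < c -> c <= b -> b < pi -> 0 <= M -> exists C, [/\ 0 < C,
  forall u1 v1 u2 v2, ode_sol A g c b u1 v1 -> ode_sol A g c b u2 v2 ->
    (forall t, c <= t <= b -> `|u1 t| <= M) -> (forall t, c <= t <= b -> `|u2 t| <= M) ->
    forall s t, c <= s <= b -> c <= t <= b ->
    (u1 t - u2 t) ^+ 2 + (v1 t - v2 t) ^+ 2 <=
    ((u1 s - u2 s) ^+ 2 + (v1 s - v2 s) ^+ 2) * C &
  forall u v, ode_sol A g c b u v -> (forall t, c <= t <= b -> `|u t| <= M) ->
    forall s t, c <= s <= b -> c <= t <= b ->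
    u t ^+ 2 + v t ^+ 2 <= (u s ^+ 2 + v s ^+ 2) * C].
Proof.
move=> c0 cb bpi M0; have [K K0 hK] := wt_bound m1 m2 c0 cb bpi.
have [L L0 hL] := gnl_lip a_gt0 lam_gt0 M0.
have KL : 0 <= K * (1 + L) by rewrite mulr_ge0 // addr_ge0.
exists (expR (K * (1 + L) * (b - c))).
have dist u1 v1 u2 v2 : ode_sol A g c b u1 v1 -> ode_sol A g c b u2 v2 ->
    (forall t, c <= t <= b -> `|u1 t| <= M) -> (forall t, c <= t <= b -> `|u2 t| <= M) ->
    forall s t, c <= s <= b -> c <= t <= b ->
    (u1 t - u2 t) ^+ 2 + (v1 t - v2 t) ^+ 2 <=
    ((u1 s - u2 s) ^+ 2 + (v1 s - v2 s) ^+ 2) * expR (K * (1 + L) * (b - c)).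
  move=> s1 s2 b1 b2 s t /andP[cs sb] /andP[ct tb].
  have sub x y : c <= x -> y <= b -> forall z, x <= z <= y -> c <= z <= b.
    by move=> cx yb z /andP[/(le_trans cx) -> /le_trans ->].
  have both x y (cx : c <= x) (yb : y <= b) (xy : x <= y) := @ode_sol_dist R A g x y
    u1 v1 u2 v2 K L xy K0 L0 (fun z hz => s1 z (sub x y cx yb z hz))
    (fun z hz => s2 z (sub x y cx yb z hz)) (fun z hz => hK z (sub x y cx yb z hz))
    (fun z hz => hL _ _ (b1 z (sub x y cx yb z hz)) (b2 z (sub x y cx yb z hz))).
  have wide x y : c <= x -> y <= b -> expR (K * (1 + L) * (y - x)) <= expR (K * (1 + L) * (b - c)).
    by move=> cx yb; rewrite ler_expR ler_wpM2l // lerB.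
  have [st|/ltW ts] := leP s t; [have [h _] := both s t cs tb st|have [_ h] := both t s ct sb ts];
    by apply: le_trans h _; rewrite ler_wpM2l ?addr_ge0 ?sqr_ge0 // wide.
split=> [|//|u v sol bu s t hs ht]; first exact: expR_gt0.
have z : ode_sol A g c b (fun=> 0) (fun=> 0) by apply: ode_sol0; rewrite gnl0.
by have := dist u v _ _ sol z bu (fun _ _ => ltac:(by rewrite normr0)) s t hs ht; rewrite !subr0.
Qed.

Section Fixed.
Variable eps : R.
Hypotheses (eps_gt0 : 0 < eps) (eps_small : eps < pi / 2).

Local Notation L := (pi - eps).

Let epsL : eps <= L. Proof. by have := eps_small; lra. Qed.
Let eps_pi : 0 < eps < pi.
Proof. by have := eps_small; have := eps_gt0; have := @pi_gt0 R => *; apply/andP; split; lra. Qed.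
Let L_pi : L < pi. Proof. by rewrite gtrBl. Qed.
Let in_pi t : eps <= t <= L -> 0 < t < pi.
Proof. by have := eps_gt0 => ? /andP[? ?]; apply/andP; split; lra. Qed.

Lemma wt_continuous t : 0 < t < pi -> {for t, continuous A}.
Proof. by move=> ht; exact: der_continuous (der_wt m1 m2 ht). Qed.

(** Existence for the nonlinearity truncated at height M, with the coefficients
   extended as constants outside the compact interval. *)
Lemma truncated_solution M d : 0 <= M -> exists u v, [/\ u eps = d, v eps = 0 &
  ode_sol A (fun x => g (Num.min (Num.max x (- M)) M)) eps L u v].
Proof.
move=> M0; have [Lg Lg0 hLg] := gnl_lip a_gt0 lam_gt0 M0.
have MM : - M <= M by rewrite (le_trans _ M0) // oppr_le0.
pose gM x := g (Num.min (Num.max x (- M)) M).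
have gMlip x y : `|gM x - gM y| <= Lg * `|x - y|.
  apply: le_trans (hLg _ _ (clamp_bounds x M0) (clamp_bounds y M0)) _.
  by apply: ler_wpM2l => //; exact: clamp_lip.
have [K K0 hK] := wt_bound m1 m2 eps_gt0 epsL L_pi.
pose cl t := Num.min (Num.max t eps) L.
have clin t : eps <= cl t <= L.
  by rewrite /cl le_min ge_min lexx orbT le_max lexx orbT epsL.
have K1 : 0 < K + 1 by rewrite ltr_wpDl.
have KK : K <= K + 1 by rewrite lerDl.
have [|||||u [v [u0 v0 huv]]] := @global_solution R (fun t => (A (cl t))^-1)
  (fun t => - A (cl t)) gM (K + 1) Lg eps d 0 K1 Lg0.
- apply: (@continuous_clamp R (fun t => (A t)^-1) eps L epsL) => t ht.
  apply: continuousV; last exact: wt_continuous (in_pi ht).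
  by rewrite gt_eqF // wt_gt0 // in_pi.
- apply: (@continuous_clamp R (fun t => - A t) eps L epsL) => t ht.
  by apply: continuousN; exact: wt_continuous (in_pi ht).
- by move=> t; exact: le_trans (hK _ (clin t)).1 KK.
- by move=> t; rewrite normrN; exact: le_trans (hK _ (clin t)).2 KK.
- exact: gMlip.
exists u, v; split=> // t ht; have /andP[t1 _] := ht; have [du dv] := huv t t1.
rewrite /cl clampE // in du dv; split; first by apply: der_eq du _; rewrite mulrC.
by apply: der_eq dv _; rewrite mulNr.
Qed.

(** The energy grows at most by a fixed factor on the compact interval, which
   bounds the solution below the level of truncation. *)
Lemma energy_bound D : 1 <= D -> exists B, forall t u v,
  eps <= t <= L -> ode_sol A g eps t u v -> `|u eps| <= D -> v eps = 0 -> F (u t) <= B.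
Proof.
move=> D1; have [C0 [C1 [C00 C10 hF hE]]] := sqr_le_energy m1 m2 a_gt0 lam_gt0.
have [Q Q0 hQ] := frc_bound m1 m2 eps_pi.
exists ((lam * (p D * D ^+ 2) + C0) * expR (2 * Q * pi)) => t u v ht sol uD v0.
have /andP[t1 t2] := ht; have /andP[t0 tpi] := in_pi ht.
have hQ' s : eps <= s <= t -> `|q s| <= Q.
  by move=> /andP[s1 s2]; apply: hQ; rewrite s1 (le_trans s2).
have hE2 s := (let: And3 _ h _ := hE u v s in h).
have h1 := energy_growth eps_gt0 tpi t1 Q0 sol hQ' hE2.
have e0 : E u v eps = F (u eps) by rewrite /energy v0 mul0r expr0n /= mul0r add0r.
have F0 : 0 <= F (u eps) + C0 by rewrite -lerBlDr sub0r.
apply: le_trans (_ : E u v t + C0 <= _).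
  by rewrite /energy addrAC lerDr addr_ge0 // divr_ge0 ?sqr_ge0.
apply: le_trans h1 _; rewrite e0; apply: ler_pM => //.
  by rewrite lerD2r; exact: Fnl_le.
rewrite ler_expR; apply: ler_wpM2l; first by rewrite mulr_ge0.
by rewrite (le_trans _ (ltW tpi)) // gerBl ltW.
Qed.

Lemma cauchy_solutions D : 1 <= D -> exists2 M, 0 <= M &
  forall d, 1 <= d <= D -> exists u v, [/\ ode_sol A g eps L u v,
    u eps = d, v eps = 0 & forall t, eps <= t <= L -> `|u t| <= M].
Proof.
move=> D1; have [B hB] := energy_bound D1.
have [M0 M01 hM0] := Fnl_coercive a_gt0 lam_gt0 B.
pose M := Num.max M0 (D + 1).
have DM : D < M by rewrite lt_max ltrDl ltr01 orbT.
have MM0 : M0 <= M by rewrite le_max lexx.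
have M_0 : 0 <= M := le_trans (le_trans ler01 M01) MM0.
exists M => // d /andP[d1 dD].
have d0 : 0 <= d := le_trans ler01 d1.
have [u [v [u0 v0 solM]]] := truncated_solution d M_0.
have toG t : eps <= t <= L -> (forall s, eps <= s <= t -> `|u s| <= M) ->
    ode_sol A g eps t u v.
  move=> /andP[t1 t2] h s /andP[s1 s2].
  have [du dv] := solM s ltac:(by rewrite s1 (le_trans s2)).
  have us : - M <= u s <= M by rewrite -ler_norml h // s1.
  by split => //; rewrite clampE in dv.
have ueps : `|u eps| < M by rewrite u0 ger0_norm // (le_lt_trans dD).
have cu t : eps <= t <= L -> {for t, continuous (fun t => `|u t|)}.
  move=> ht; apply: (@continuous_comp _ _ _ u); last exact: norm_continuous.
  by have [du _] := solM t ht; exact: der_continuous du.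
have bnd : forall t, eps <= t <= L -> `|u t| < M.
  apply: (continuous_induction cu ueps) => t ht h.
  have FB : F (u t) <= B.
    by apply: hB ht (toG t ht h) _ v0; rewrite u0 ger0_norm.
  rewrite ltNge; apply/negP => Mu.
  by have := lt_le_trans (hM0 (u t) (le_trans MM0 Mu)) FB; rewrite ltxx.
exists u, v; split => //; last by move=> t ht; exact/ltW/bnd.
apply: toG; first by rewrite epsL lexx.
by move=> s hs; exact/ltW/bnd.
Qed.

End Fixed.
End Cauchy.

(** * Shooting with a prescribed number of zeros *)

Section Shooting.
Context {R : realType}.
Variables (a lam : R) (m1 m2 : nat).
Hypotheses (a_gt0 : 0 < a) (lam_gt0 : 0 < lam) (m1_gt0 : (0 < m1)%N) (m2_gt0 : (0 < m2)%N)
  (sub1 : a * (m1%:R - 1) < 4) (sub2 : a * (m2%:R - 1) < 4).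
Implicit Types (u v th : R -> R) (r s t b d e x y B l M D eps : R) (k : nat).

Local Notation A := (wt m1 m2).
Local Notation g := (gnl a lam).
Local Notation rad1 := (rad a m1 m2).
Local Notation rad2 := (rad a m2 m1).

Let rad1_gt0 : 0 < rad1. Proof. exact: rad_gt0. Qed.
Let rad2_gt0 : 0 < rad2. Proof. exact: rad_gt0. Qed.

Ltac forget := clear -a_gt0 lam_gt0 m1_gt0 m2_gt0 sub1 sub2 rad1_gt0 rad2_gt0.

(** The segment [rad / 2, rad] contains k + 1 intervals of length l separated by
   gaps of length l; each of them will contain a zero. *)
Lemma zero_interval_in (n m : nat) (i k : nat) : (i <= k)%N -> 0 < rad a n m ->
  let l := rad a n m / (4 * (k%:R + 1)) in
  [/\ 0 < l, rad a n m / 2 <= rad a n m / 2 + 2 * i%:R * l &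
      rad a n m / 2 + 2 * i%:R * l + l <= rad a n m].
Proof.
move=> ik r0 l; have ik' : (i%:R : R) <= k%:R by rewrite ler_nat.
have i0 : (0 : R) <= i%:R by [].
have k0 : 0 < 4 * (k%:R + 1) :> R by lra.
have l0 : 0 < l by rewrite divr_gt0.
have e : rad a n m = 4 * (k%:R + 1) * l by rewrite /l; field; rewrite gt_eqF //; lra.
have e1 : 0 <= i%:R * l by rewrite mulr_ge0 // ltW.
have e2 : i%:R * l <= k%:R * l by rewrite ler_pM2r.
by split => //; rewrite ?e; lra.
Qed.

Lemma left_height_angle k : exists2 D, 1 <= D & forall e b u v th,
  0 < e -> e <= rad1 / 2 -> rad1 <= b -> ode_sol A g e b u v ->
  prufer e b u v th -> - (pi / 2) < th e -> v e = 0 -> D <= `|u e| ->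
  pi / 2 + k%:R * pi <= th b.
Proof.
have [l0 _ _] := zero_interval_in (leqnn k) rad1_gt0.
have [D D1 hD] := many_zeros m2 a_gt0 lam_gt0 m1_gt0 sub1 l0.
exists D => // e b u v th e0 er rb sol P the ve De.
have r0 := rad1_gt0.
apply: (angle_ge_of_zero_intervals P the (c := rad1 / 2) er l0).
  have [_ _] := zero_interval_in (leqnn k) rad1_gt0; lra.
move=> i ik; have [_ h1 h2] := zero_interval_in ik rad1_gt0.
apply: (hD e u v) => //; exact: ode_sol_sub sol.
Qed.

(** Reflection turns a large height at the right end into a large initial height. *)
Lemma right_height_angle k : exists2 D, 1 <= D & forall e b u v th,
  0 < e -> e <= pi - rad2 -> pi - rad2 / 2 <= b -> b < pi -> ode_sol A g e b u v ->
  prufer e b u v th -> - (pi / 2) < th e -> v b = 0 -> D <= `|u b| ->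
  pi / 2 + k%:R * pi <= th b.
Proof.
have [l0 _ _] := zero_interval_in (leqnn k) rad2_gt0.
have [D D1 hD] := many_zeros m1 a_gt0 lam_gt0 m2_gt0 sub2 l0.
set l := (X in 0 < X) in l0.
exists D => // e b u v th e0 er rb bpi sol P the vb De.
have r0 := rad2_gt0.
have el : rad2 = 4 * (k%:R + 1) * l.
  rewrite /l; field; rewrite gt_eqF //; have : (0 : R) <= k%:R by []; lra.
pose c := pi - rad2 / 2 - (2 * k%:R + 1) * l.
have ec : e <= c by rewrite /c; lra.
apply: (angle_ge_of_zero_intervals P the (c := c) ec l0); first by rewrite /c; lra.
move=> i ik; have [_ h1 h2] := zero_interval_in (leq_subr i k) rad2_gt0.
have solr := ode_sol_refl sol.
have [|||||t /andP[t1 t2] ut] := hD (pi - b) (fun t => u (pi - t)) (fun t => - v (pi - t)) _ _ _ _ _ _ h1 h2.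
- lra.
- lra.
- by apply: ode_sol_sub solr => //; lra.
- by rewrite /= subKr vb oppr0.
- by rewrite /= subKr.
exists (pi - t) => //; move: t1 t2; rewrite natrB // -/l => t1 t2.
by rewrite /c; apply/andP; split; lra.
Qed.

Section Fixed.
Variable eps : R.
Hypotheses (eps_gt0 : 0 < eps) (eps_small : eps < pi / 2).

Local Notation L := (pi - eps).

Let epsL : eps <= L.
Proof. by have h := eps_small; lra. Qed.
Let L_pi : L < pi. Proof. by rewrite gtrBl. Qed.
Let in_pi t : eps <= t <= L -> 0 < t < pi.
Proof.
by move=> /andP[t1 t2]; rewrite (lt_le_trans eps_gt0 t1) (le_lt_trans t2) // gtrBl.
Qed.

Ltac forget_eps := clear -a_gt0 lam_gt0 m1_gt0 m2_gt0 sub1 sub2 rad1_gt0 rad2_gt0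
  eps_gt0 eps_small epsL L_pi in_pi.

Definition shot M d (w : (R -> R) * (R -> R) * (R -> R)) :=
  [/\ ode_sol A g eps L w.1.1 w.1.2, w.1.1 eps = d /\ w.1.2 eps = 0,
      forall t, eps <= t <= L -> `|w.1.1 t| <= M,
      prufer eps L w.1.1 w.1.2 w.2 & w.2 eps = 0].

Lemma shot_exists D : 1 <= D -> exists M S, 0 <= M /\
  forall d, 1 <= d <= D -> shot M d (S d).
Proof.
move=> D1.
have [M M0 hM] := cauchy_solutions m1 m2 a_gt0 lam_gt0 eps_gt0 eps_small D1.
have [C [C0 _ normC]] := solutions_dist m1 m2 a_gt0 lam_gt0 eps_gt0 epsL L_pi M0; exists M.
suff /choice[S hS] : forall d, exists w, 1 <= d <= D -> shot M d w by exists S.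
move=> d; have [hd|nd] := pselect (1 <= d <= D); last by exists ((id, id), id).
have /andP[d1 _] := hd; have [u [v [sol ue ve bu]]] := hM d hd.
have hL : eps <= eps <= L by rewrite lexx.
have [||||||th [the P]] := @prufer_exists R A g eps L u v 0 epsL sol.
- by move=> t /in_pi; exact: wt_gt0.
- by move=> t /in_pi; exact: wt_continuous.
- exact: gnl_continuous.
- move=> t ht; rewrite -(pmulr_lgt0 _ C0); apply: lt_le_trans (normC u v sol bu t eps ht hL).
  by rewrite ue ve expr0n addr0 exprn_gt0 // (lt_le_trans ltr01).
- rewrite cos0 mulr1 /amp ue ve expr0n addr0 sqrtr_sqr ger0_norm //.
  exact: le_trans d1.
- by rewrite sin0 mulr0 oppr0.
by exists ((u, v), th).
Qed.

Lemma shot_angle_continuous M eta : 0 <= M -> 0 < eta -> exists2 del, 0 < del &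
  forall x y w1 w2, 1 <= x -> `|x - y| < del -> shot M x w1 -> shot M y w2 ->
  `|w1.2 L - w2.2 L| < eta.
Proof.
move=> M0 eta0.
have [C [C0 distC normC]] := solutions_dist m1 m2 a_gt0 lam_gt0 eps_gt0 epsL L_pi M0.
pose et := Num.min eta (pi / 4).
have p4 : 0 < pi / 4 :> R by rewrite divr_gt0 // pi_gt0.
have et0 : 0 < et by rewrite lt_min eta0.
have et1 : et <= eta by rewrite ge_min lexx.
have et2 : et <= pi / 4 by rewrite ge_min lexx orbT.
have [et3 et4] : et < pi / 2 /\ et <= pi.
  by move: et2 p4; move: (pi : R) (et) => z x; forget_eps => *; split; lra.
have cet : cos et < 1.
  by rewrite -cos0 ltr_cos // in_itv /= ?lexx ?pi_ge0 // (ltW et0).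
pose kap := C^-1 * (1 - cos et) / C.
have kap0 : 0 < kap by rewrite divr_gt0 ?mulr_gt0 ?invr_gt0 // subr_gt0.
exists (Num.sqrt kap); first by rewrite sqrtr_gt0.
move=> x y w1 w2 x1 hxy [s1 [i1 j1] b1 P1 t1] [s2 [i2 j2] b2 P2 t2].
apply: lt_le_trans et1; have hL : eps <= eps <= L by rewrite lexx.
apply: (angle_close epsL P1 P2 (kap := (x - y) ^+ 2 * C) (nu := C^-1)).
- by rewrite t1 t2.
- by rewrite et0.
- move=> t ht; have := distC _ _ _ _ s1 s2 b1 b2 eps t hL ht.
  by rewrite i1 i2 j1 j2 subrr expr0n addr0.
- move=> t ht; have := normC _ _ s1 b1 t eps ht hL.
  rewrite i1 j1 expr0n addr0 -ler_pdivrMr // => /(le_trans _); apply.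
  by rewrite ler_peMl ?invr_ge0 ?(ltW C0) // exprn_ege1.
have : (x - y) ^+ 2 < kap.
  rewrite -(sqr_sqrtr (ltW kap0)) -(real_normK (num_real (x - y))).
  by rewrite ltr_sqr ?nnegrE ?sqrtr_ge0.
by rewrite /kap ltr_pdivlMr.
Qed.

(** The shot of height 1 stays at the constant solution, hence does not turn. *)
Lemma shot_angle_one M w : shot M 1 w -> w.2 L < pi / 2.
Proof.
move=> [s1 [i1 j1] b1 P1 t1].
have hL : eps <= eps <= L by rewrite lexx.
have M1 : 1 <= M by rewrite -normr1 -i1 b1.
have [C [_ distC _]] :=
  solutions_dist m1 m2 a_gt0 lam_gt0 eps_gt0 epsL L_pi (le_trans ler01 M1).
have one : ode_sol A g eps L (fun=> 1) (fun=> 0).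
  move=> t _; rewrite /gnl pw1 mulr1 subrr mulr0 mulr0 oppr0 mul0r.
  by split; exact: der_cst.
rewrite ltNge; apply/negP => hk.
have [t ht et] : exists2 t, eps <= t <= L & w.2 t = pi / 2.
  apply: ivt epsL _ _; first by move=> t ht; exact: prufer_continuous P1 _ ht.
  by rewrite ge_min le_max t1 hk orbT divr_ge0 // pi_ge0.
have := (prufer_zero P1 ht).2; rewrite et cos_pihalf => /(_ erefl) ut.
have := distC _ _ _ _ s1 one b1 (fun s _ => ltac:(by rewrite normr1)) eps t hL ht.
rewrite ut i1 j1 !subrr expr0n addr0 mul0r sub0r sqrrN expr1n.
by apply/negP; rewrite -ltNge ltr_wpDr // sqr_ge0.
Qed.

End Fixed.

Lemma sin_natpi (n : nat) : sin (n%:R * pi) = 0 :> R.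
Proof.
by elim: n => [|n ih]; rewrite ?mul0r ?sin0 // -natr1 mulrDl mul1r sinDpi ih oppr0.
Qed.

(** The end angle depends continuously on the initial height, is small at height
   1 and large at height D; the height at the other end is bounded because a
   larger one would produce too many zeros when read from right to left. *)
Lemma shooting k : (0 < k)%N -> exists D eps0, [/\ 1 <= D, 0 < eps0 &
  forall eps, 0 < eps <= eps0 -> exists u v th,
  [/\ ode_sol A g eps (pi - eps) u v,
      prufer eps (pi - eps) u v th,
      th eps = 0 /\ th (pi - eps) = k%:R * pi,
      v eps = 0 /\ v (pi - eps) = 0 &
      1 <= u eps <= D /\ `|u (pi - eps)| <= D]].
Proof.
move=> k0; have pi0 := @pi_gt0 R; have pi2 := @pi_ge2 R.
have [D1 D11 hD1] := left_height_angle k.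
have [D2 D21 hD2] := right_height_angle k.
pose D := Num.max D1 D2.
have D1D : D1 <= D by rewrite le_max lexx.
have D2D : D2 <= D by rewrite le_max lexx orbT.
have D_1 : 1 <= D := le_trans D11 D1D.
exists D, (Num.min rad1 rad2 / 2); split => // [|eps /andP[eps_gt0]].
  by rewrite divr_gt0 // lt_min rad1_gt0.
rewrite ler_pdivlMr // le_min -!ler_pdivlMr // => /andP[h1 h2].
have r1 : rad1 <= 1 := @rad_le1 R a m1 m2.
have r2 : rad2 <= 1 := @rad_le1 R a m2 m1.
have [eps_small e1 e2 e3] : [/\ eps < pi / 2, rad1 <= pi - eps,
    eps <= pi - rad2 & pi - rad2 / 2 <= pi - eps].
  by move: h1 h2 r1 r2 pi2; forget => *; split; lra.
have epsL : eps <= pi - eps by move: eps_small; forget; lra.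
have LL : eps <= pi - eps <= pi - eps by rewrite epsL lexx.
have Lpi : pi - eps < pi by rewrite gtrBl.
have kpi : k%:R * pi < pi / 2 + k%:R * pi :> R by rewrite ltrDr divr_gt0.
have npi : - (pi / 2) < 0 :> R by rewrite oppr_lt0 divr_gt0.
have [M [S [M0 hS]]] := shot_exists eps_gt0 eps_small D_1.
pose cl d := Num.min (Num.max d 1) D; pose Th d := (S (cl d)).2 (pi - eps).
have clin d : 1 <= cl d <= D.
  by rewrite le_min ge_min lexx orbT le_max lexx orbT D_1.
have cTh : continuous Th.
  move=> x; apply/cvgrPdist_lt => eta eta0.
  have [del del0 h] := shot_angle_continuous eps_gt0 eps_small M0 eta0.
  apply/nbhs_ballP; exists del => // y hy; have /andP[x1 _] := clin x.
  apply: h (hS _ (clin x)) (hS _ (clin y)) => //.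
  by apply: le_lt_trans hy; exact: clamp_lip.
have Th1 : Th 1 <= k%:R * pi.
  have c1 : cl 1 = 1 by apply: clampE; rewrite lexx.
  have s1 : shot eps M 1 (S (cl 1)) by rewrite c1; apply: hS; rewrite lexx.
  apply: le_trans (ltW (shot_angle_one eps_gt0 eps_small s1)) _.
  rewrite (le_trans (_ : _ <= 1 * pi)) ?ler_pM2r ?ler1n //.
  by rewrite mul1r ler_pdivrMr // ler_peMr ?ler1n // ltW.
have ThD : k%:R * pi <= Th D.
  have [s1 [i1 j1] b1 P1 t1] := hS _ (clin D); apply: ltW; apply: lt_le_trans kpi _.
  apply: (hD1 _ _ _ _ _ eps_gt0 h1 e1 s1 P1 _ j1); first by rewrite t1.
  rewrite i1 (_ : cl D = D) ?ger0_norm // ?(le_trans ler01) //.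
  by apply: clampE; rewrite lexx D_1.
have [d hd ed] : exists2 d, 1 <= d <= D & Th d = k%:R * pi.
  apply: ivt D_1 _ _; first by move=> t _; exact: cTh.
  by rewrite ge_min le_max Th1 ThD orbT.
move: ed; rewrite /Th /cl (clampE hd); have [] := hS d hd.
move: (S d) => [[u v] th] /= sol [ue ve] _ P the thL; exists u, v, th.
have vL : v (pi - eps) = 0 by rewrite (prufer_sin P LL) thL sin_natpi mulr0 oppr0.
split=> //; split; first by rewrite ue.
rewrite leNgt; apply/negP => /ltW hL.
have := hD2 eps (pi - eps) u v th eps_gt0 e2 e3 Lpi sol P.
rewrite the thL => /(_ npi vL (le_trans D2D hL)).
by rewrite leNgt kpi.
Qed.

End Shooting.

(** * Limits along an ultrafilter *)

Section UltraLimit.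
Context {R : realType}.
Variable U : set_system nat.
Context {UU : UltraFilter U}.
Implicit Types (x y : nat -> R) (l c e B : R).

(** Along an ultrafilter every bounded sequence converges, so that no subsequences
   have to be extracted, not even for uncountably many points at once. *)
Definition ulim x l := forall e, 0 < e -> U [set j | `|x j - l| < e].

Lemma ulim_exists x B : U [set j | `|x j| <= B] -> exists l, ulim x l.
Proof.
move=> hB; pose S := [set r | U [set j | r <= x j]].
have supS : has_sup S.
  split.
    exists (- B); apply: filterS hB => j /=; by rewrite ler_norml => /andP[].
  exists B => r Sr; have [j [/= h1 h2]] := filter_ex (filterI Sr hB).
  by apply: le_trans h1 _; apply: le_trans h2; exact: ler_norm.
exists (sup S) => e e0.
have [r Sr hr] := sup_adherent e0 supS.
have nS : ~ S (sup S + e / 2).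
  by move=> /(ub_le_sup supS.2); lra.
have [//|h] := in_ultra_setVsetC [set j | sup S + e / 2 <= x j] UU.
apply: filterS (filterI Sr h) => j [/= h1 /negP]; rewrite -ltNge => h2.
by rewrite ltr_norml; apply/andP; split; lra.
Qed.

Lemma ulim_le x l c : ulim x l -> U [set j | x j <= c] -> l <= c.
Proof.
move=> hl hc; rewrite leNgt; apply/negP => cl.
have lc : 0 < l - c by rewrite subr_gt0.
have [j [/= h1 h2]] := filter_ex (filterI (hl _ lc) hc).
by move: h1; rewrite ltr_norml => /andP[]; lra.
Qed.

Lemma ulim_ext x y l : U [set j | x j = y j] -> ulim x l -> ulim y l.
Proof.
by move=> h hx e e0; apply: filterS (filterI h (hx e e0)) => j [/= ->].
Qed.

Lemma ulim_add x y l c : ulim x l -> ulim y c -> ulim (fun j => x j + y j) (l + c).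
Proof.
move=> hx hy e e0; have e2 : 0 < e / 2 by lra.
apply: filterS (filterI (hx _ e2) (hy _ e2)) => j [/= h1 h2].
have -> : x j + y j - (l + c) = (x j - l) + (y j - c) by ring.
by apply: le_lt_trans (ler_normD _ _) _; lra.
Qed.

Lemma ulim_comp (f : R -> R) x l : {for l, continuous f} ->
  ulim x l -> ulim (fun j => f (x j)) (f l).
Proof.
move=> cf hx e e0; have := cf => /cvgr_dist_lt /(_ e e0) /nbhs_ballP[d /= d0 hd].
apply: filterS (hx d d0) => j /= h; rewrite distrC; apply: hd.
by rewrite /ball /= distrC.
Qed.

Lemma ulim_mulr c x l : ulim x l -> ulim (fun j => c * x j) (c * l).
Proof.
apply: (@ulim_comp ( *%R c)); exact: der_continuous (der_lin c l).
Qed.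

Lemma ulim_sub x y l c : ulim x l -> ulim y c -> ulim (fun j => x j - y j) (l - c).
Proof.
move=> hx hy; apply: ulim_add => //.
by apply: (@ulim_comp (fun z => - z)) => //; exact: der_continuous (der_opp (der_id c)).
Qed.

Lemma ulim_norm_le x l c : ulim x l -> U [set j | `|x j| <= c] -> `|l| <= c.
Proof.
move=> hx hc; apply: (@ulim_le (fun j => `|x j|)) => //.
by apply: (@ulim_comp (fun z => `|z|)) => //; exact: norm_continuous.
Qed.

Lemma der_of_quadratic (f : R -> R) (s d C r : R) : 0 < r ->
  (forall t, `|t - s| < r -> `|f t - f s - d * (t - s)| <= C * `|t - s| ^+ 2) ->
  is_derive s 1 f d.
Proof.
move=> r0 h; have C1 : 0 < `|C| + 1 by have := normr_ge0 C; lra.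
have cv : h^-1 *: (f (h *: 1 + s) - f s) @[h --> 0^'] --> d.
  apply/cvgrPdist_lt => e e0; apply/nbhs_ballP.
  exists (Num.min r (e / (`|C| + 1))) => /=; first by rewrite lt_min r0 divr_gt0.
  move=> z /=; rewrite /ball /= sub0r normrN lt_min => /andP[zr ze] z0.
  rewrite /GRing.scale /= mulr1.
  have z0' : 0 < `|z| by rewrite normr_gt0.
  have := h (z + s); rewrite addrK => /(_ zr) hz.
  have -> : d - z^-1 * (f (z + s) - f s) = - (z^-1 * (f (z + s) - f s - d * z)) by field.
  rewrite normrN normrM normfV mulrC ltr_pdivrMr //.
  apply: le_lt_trans hz _.
  have : (`|C| + 1) * `|z| < e by rewrite mulrC -ltr_pdivlMr.
  have := ler_norm C; nra.
by split; [apply/cvg_ex; exists d|exact: cvg_lim cv].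
Qed.

(** With derivatives that are equi-Lipschitz at s, the first order expansions at s
   have a uniform quadratic remainder, which passes to the limit. *)
Lemma ulim_derive (f h : nat -> R -> R) (f' h' : R -> R) (a b C s : R) :
  0 <= C -> a < s < b ->
  U [set j | forall t, a <= t <= b -> is_derive t 1 (f j) (h j t)] ->
  U [set j | forall t, a <= t <= b -> `|h j t - h j s| <= C * `|t - s|] ->
  (forall t, a <= t <= b -> ulim (fun j => f j t) (f' t)) ->
  ulim (fun j => h j s) (h' s) ->
  is_derive s 1 f' (h' s).
Proof.
move=> C0 /andP[as_ sb] hd hl hf hh.
apply: (@der_of_quadratic _ s (h' s) C (Num.min (s - a) (b - s))).
  by rewrite lt_min; apply/andP; split; lra.
move=> t; rewrite lt_min => /andP[]; rewrite !ltr_norml => /andP[t1 t2] /andP[t3 t4].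
have ht : a <= t <= b by apply/andP; split; lra.
have hs : a <= s <= b by apply/andP; split; lra.
apply: (@ulim_norm_le (fun j => f j t - f j s - (t - s) * h j s)).
  apply: ulim_sub; first by apply: ulim_sub; exact: hf.
  by rewrite [h' s * _]mulrC; apply: ulim_mulr.
apply: filterS (filterI hd hl) => j [/= dj lj].
have [c [c1 c2] ec] : exists2 c, `|c - s| <= `|t - s| /\ a <= c <= b &
    f j t - f j s = h j c * (t - s).
  have [st|/ltW ts] := leP s t.
    have d1 z (hx : s <= z <= t) : is_derive z 1 (f j) (h j z).
      by apply: dj; case/andP: hx => ? ?; apply/andP; split; lra.
    have [c /andP[c1 c2] ec] := mean_value st d1.
    exists c => //; split; last by apply/andP; split; lra.
    by rewrite !ger0_norm; lra.
  have d1 z (hx : t <= z <= s) : is_derive z 1 (f j) (h j z).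
    by apply: dj; case/andP: hx => ? ?; apply/andP; split; lra.
  have [c /andP[c1 c2] ec] := mean_value ts d1.
  exists c; last by rewrite -[LHS]opprK opprB ec; ring.
  split; last by apply/andP; split; lra.
  by rewrite !ler0_norm; lra.
rewrite ec [(t - s) * _]mulrC -mulrBl normrM expr2 mulrA.
apply: ler_wpM2r => //; apply: le_trans (lj c c2) _.
exact: ler_wpM2l.
Qed.

End UltraLimit.

(** * Bounds uniform in the regularisation *)

Section UniformBounds.
Context {R : realType}.
Variables (a lam : R).
Hypotheses (a_gt0 : 0 < a) (lam_gt0 : 0 < lam).
Implicit Types (u v th : R -> R) (r s t b d e x y B l M D eps del : R) (k : nat).

Local Notation g := (gnl a lam).
Local Notation F := (Fnl a lam).
Local Notation p := (pw a).

Ltac forget := clear -a_gt0 lam_gt0.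

(** The energy is largest at one of the ends, where it is Fnl of the height. *)
Lemma bounded_of_end_heights m1 m2 D : 1 <= D -> exists M W : R, [/\ 1 <= M, 0 <= W &
  forall eps u v, 0 < eps -> eps < pi / 2 ->
  ode_sol (wt m1 m2) g eps (pi - eps) u v -> v eps = 0 -> v (pi - eps) = 0 ->
  `|u eps| <= D -> `|u (pi - eps)| <= D ->
  forall t, eps <= t <= pi - eps -> `|u t| <= M /\ `|v t / wt m1 m2 t| <= W].
Proof.
move=> D1; have a0 := a_gt0; have la0 := lam_gt0.
have [C0 [C1 [C00 C10 hF hE]]] := sqr_le_energy m1 m2 a_gt0 lam_gt0.
pose B := lam * (p D * D ^+ 2).
have B0 : 0 <= B by rewrite mulr_ge0 ?(ltW la0) // mulr_ge0 ?pw_ge0 ?sqr_ge0.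
have [M M1 hM] := Fnl_coercive a_gt0 lam_gt0 B.
exists M, (Num.sqrt (2 * (B + C0))); split => //.
move=> eps u v e0 epi sol v1 v2 u1 u2 t ht.
have /andP[t1 t2] := ht.
have Fd d : `|d| <= D -> F d <= B by exact: Fnl_le.
have Lpi : pi - eps < pi by rewrite gtrBl.
have EB : energy a lam m1 m2 u v t <= B.
  apply: le_trans (energy_le_max a_gt0 e0 Lpi sol ht) _.
  by rewrite ge_max /energy v1 v2 !mul0r expr0n /= mul0r !add0r !Fd.
have [h1 h2 h3] := hE u v t.
split.
  have FB : F (u t) <= B.
    by apply: le_trans EB; rewrite /energy lerDr divr_ge0 ?sqr_ge0.
  by rewrite leNgt; apply/negP => /ltW /hM; rewrite ltNge FB.
have -> : `|v t / wt m1 m2 t| = Num.sqrt ((v t / wt m1 m2 t) ^+ 2) by rewrite sqrtr_sqr.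
by apply: ler_wsqrtr; apply: le_trans h2 _; rewrite ler_pM2l // lerD2r.
Qed.

Lemma left_end_bounds m1 m2 M eps u v b : 1 <= M -> (0 < m1)%N -> 0 < eps ->
  rad a m1 m2 <= b -> ode_sol (wt m1 m2) g eps b u v -> v eps = 0 ->
  (forall t, eps <= t <= b -> `|u t| <= M) ->
  forall t, eps <= t <= rad a m1 m2 ->
  `|v t / wt m1 m2 t| <= lam * (p M * M) * t /\
  `|u t - u eps| <= lam * (p M * M) * t ^+ 2.
Proof.
move=> M1 mm e0 rb sol ve hM t /andP[t1 t2].
have sol1 : ode_sol (wt m1 m2) g eps (rad a m1 m2) u v by exact: ode_sol_sub sol.
pose G := lam * (p M * M).
have G0 : 0 <= G by rewrite mulr_ge0 ?(ltW lam_gt0) // mulr_ge0 ?pw_ge0 //; lra.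
have sl s : eps <= s <= rad a m1 m2 -> `|v s / wt m1 m2 s| <= G * s.
  move=> /andP[s1 s2].
  have s0 : 0 < s by lra.
  apply: (slope_le e0 (@rad_ltpi R a m1 m2) sol1) => //; first by rewrite s1.
    by apply: (frc_rad_ge0 mm (a := a)); rewrite s0.
  move=> r /andP[r1 r2]; apply: gnl_le => //; apply: hM; apply/andP; split; lra.
split; first by apply: sl; rewrite t1.
have du s (hs : eps <= s <= t) : is_derive s 1 u (v s / wt m1 m2 s).
  by have [] := sol1 s; first (case/andP: hs => ? ?; apply/andP; split; lra).
have dG s (_ : eps <= s <= t) : is_derive s 1 (fun s => s ^+ 2 * (G / 2)) (G * s).
  apply: der_eq (der_mul (der_exp 2 (der_id s)) (der_cst (G / 2) s)) _.
  by rewrite /= expr1; field.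
have h := der_norm_le t1 du dG.
have {}h : `|u t - u eps| <= t ^+ 2 * (G / 2) - eps ^+ 2 * (G / 2).
  apply: h => s /andP[s1 s2]; apply: sl; rewrite s1; lra.
have e2 : 0 <= eps ^+ 2 * (G / 2) by rewrite mulr_ge0 ?sqr_ge0 // divr_ge0.
have e3 : 0 <= t ^+ 2 * (G / 2) by rewrite mulr_ge0 ?sqr_ge0 // divr_ge0.
rewrite -/G; lra.
Qed.

Lemma right_end_bounds m1 m2 M eps u v e : 1 <= M -> (0 < m2)%N -> 0 < eps ->
  e <= pi - rad a m2 m1 -> ode_sol (wt m1 m2) g e (pi - eps) u v -> v (pi - eps) = 0 ->
  (forall t, e <= t <= pi - eps -> `|u t| <= M) ->
  forall t, eps <= t <= rad a m2 m1 ->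
  `|v (pi - t) / wt m1 m2 (pi - t)| <= lam * (p M * M) * t /\
  `|u (pi - t) - u (pi - eps)| <= lam * (p M * M) * t ^+ 2.
Proof.
move=> M1 mm e0 rb sol ve hM t ht.
have := ode_sol_refl sol; rewrite subKr => solr.
have [|||h1 h2] := left_end_bounds (b := pi - e) M1 mm e0 _ solr _ _ ht.
- lra.
- by rewrite ve oppr0.
- by move=> s /andP[s1 s2]; apply: hM; apply/andP; split; lra.
by split => //; move: h1; rewrite wt_refl mulNr normrN.
Qed.

Lemma equi_lipschitz m1 m2 M W del : 0 <= M -> 0 <= W -> 0 < del < pi -> exists2 C, 0 <= C &
  forall u v s t, ode_sol (wt m1 m2) g del (pi - del) u v ->
  (forall t, del <= t <= pi - del -> `|u t| <= M /\ `|v t / wt m1 m2 t| <= W) ->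
  del <= s <= pi - del -> del <= t <= pi - del ->
  `|v t / wt m1 m2 t - v s / wt m1 m2 s| <= C * `|t - s| /\
  `|- (wt m1 m2 t * g (u t)) - - (wt m1 m2 s * g (u s))| <= C * `|t - s|.
Proof.
move=> M0 W0 hdel; have /andP[d0 dpi] := hdel.
have [Q Q0 hQ] := frc_bound m1 m2 hdel.
have [L L0 hL] := gnl_lip a_gt0 lam_gt0 M0.
have gL x : `|x| <= M -> `|g x| <= L * M.
  move=> hx; have := hL x 0 hx; rewrite normr0 => /(_ M0); rewrite gnl0 !subr0 => h.
  by apply: le_trans h _; exact: ler_wpM2l.
have LM0 : 0 <= L * M by rewrite mulr_ge0.
pose C := L * M + Q * W + Q * (L * M) + L * W.
have QW : 0 <= Q * W by rewrite mulr_ge0.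
have QLM : 0 <= Q * (L * M) by rewrite mulr_ge0.
have LW : 0 <= L * W by rewrite mulr_ge0.
exists C; first by rewrite !addr_ge0.
move=> u v s t sol hb.
wlog st : s t / s <= t.
  move=> H hs ht; have [h|/ltW h] := leP s t; first exact: H.
  have [h1 h2] := H t s h ht hs.
  by split; rewrite distrC [`|t - s|]distrC.
move=> /andP[s1 s2] /andP[t1 t2].
have inI z : s <= z <= t -> del <= z <= pi - del.
  by move=> /andP[/(le_trans s1) -> /le_trans ->].
have pil : pi - del < pi by rewrite gtrBl.
have dts : `|t - s| = t - s by rewrite ger0_norm // subr_ge0.
have d1 z (hz : s <= z <= t) := der_slope d0 pil sol (inI z hz).
have dl c z (_ : s <= z <= t) := der_lin c z.
have lip (f : R -> R) (f' : R -> R) c :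
    (forall z, s <= z <= t -> is_derive z 1 f (f' z)) ->
    (forall z, s <= z <= t -> `|f' z| <= c) -> `|f t - f s| <= c * (t - s).
  by move=> df hf; have := der_norm_le st df (dl c) hf; rewrite -mulrBr.
have b1 z : s <= z <= t ->
    `|- g (u z) - frc m1 m2 z * (v z / wt m1 m2 z)| <= L * M + Q * W.
  move=> hz; have [h1 h2] := hb z (inI z hz).
  apply: le_trans (ler_normB _ _) _; rewrite normrN; apply: lerD; first exact: gL h1.
  rewrite normrM.
  by apply: ler_pM => //; exact: hQ (inI z hz).
split; rewrite dts.
  apply: le_trans (lip _ _ _ d1 b1) _.
  by apply: ler_wpM2r; [rewrite subr_ge0|rewrite /C -addrA lerDl addr_ge0].
rewrite opprK addrC distrC.
have zpi z : s <= z <= t -> 0 < z < pi.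
  by move=> /inI /andP[/(lt_le_trans d0) -> /le_lt_trans ->].
have A1 z : s <= z <= t -> 0 < wt m1 m2 z <= 1.
  by move=> /zpi h; rewrite wt_gt0 //= wt_le1.
have dA z (hz : s <= z <= t) := der_wt m1 m2 (zpi z hz).
have bA z : s <= z <= t -> `|wt m1 m2 z * frc m1 m2 z| <= Q.
  move=> hz; have /andP[w0 w1] := A1 z hz.
  rewrite normrM (gtr0_norm w0) -[leRHS]mul1r; apply: ler_pM => //; first exact: ltW.
  exact: hQ (inI z hz).
have h1 := lip _ _ _ dA bA.
have du z (hz : s <= z <= t) := (sol z (inI z hz)).1.
have bu z (hz : s <= z <= t) := (hb z (inI z hz)).2.
have h2 := lip _ _ _ du bu.
have hs : s <= s <= t by rewrite lexx.
have ht : s <= t <= t by rewrite lexx st.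
have us := (hb s (inI s hs)).1; have ut := (hb t (inI t ht)).1.
have h3 := hL _ _ ut us.
have /andP[w0 w1] := A1 t ht.
have -> : wt m1 m2 t * g (u t) - wt m1 m2 s * g (u s) =
  (wt m1 m2 t - wt m1 m2 s) * g (u s) + wt m1 m2 t * (g (u t) - g (u s)) by ring.
apply: le_trans (ler_normD _ _) _.
rewrite [`|(_ - _) * _|]normrM [`|wt m1 m2 t * _|]normrM (gtr0_norm w0).
have e1 : `|wt m1 m2 t - wt m1 m2 s| * `|g (u s)| <= Q * (t - s) * (L * M).
  by apply: ler_pM => //; exact: gL us.
have e2 : wt m1 m2 t * `|g (u t) - g (u s)| <= 1 * (L * (W * (t - s))).
  apply: ler_pM => //; first exact: ltW.
  by apply: le_trans h3 _; exact: ler_wpM2l.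
have ts : 0 <= t - s by rewrite subr_ge0.
have e3 : 0 <= (L * M + Q * W) * (t - s) by rewrite mulr_ge0 // addr_ge0.
by rewrite /C; move: e1 e2 e3; forget; lra.
Qed.

End UniformBounds.

(** * The limit solution *)

Section Limit.
Context {R : realType}.
Variables (a lam : R) (m1 m2 : nat).
Hypotheses (a_gt0 : 0 < a) (lam_gt0 : 0 < lam) (m1_gt0 : (0 < m1)%N) (m2_gt0 : (0 < m2)%N)
  (sub1 : a * (m1%:R - 1) < 4) (sub2 : a * (m2%:R - 1) < 4).
Implicit Types (u v th w z : R -> R) (r s t b d e x y B l M G D eps rho eta del : R) (k : nat).

Local Notation A := (wt m1 m2).
Local Notation g := (gnl a lam).

(** Quantitative convergence to the end values, with the rates that the regularised
   solutions satisfy uniformly. *)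
Definition close_ends G rho u v (u0 upi : R) := forall t, 0 < t <= rho ->
  [/\ `|v t / A t| <= G * t, `|u t - u0| <= G * t ^+ 2,
      `|v (pi - t) / A (pi - t)| <= G * t & `|u (pi - t) - upi| <= G * t ^+ 2].

Ltac forget := clear -a_gt0 lam_gt0 m1_gt0 m2_gt0 sub1 sub2.

(** Locally uniform bounds make the right-hand sides equi-Lipschitz, so the
   pointwise ultralimit of solutions can be differentiated term by term. *)
Lemma ulim_ode_sol (U : set_system nat) (us vs : nat -> R -> R) M W d u v t :
  UltraFilter U -> 0 <= M -> 0 <= W -> 0 < d -> d < t < pi - d ->
  U [set j | ode_sol A g d (pi - d) (us j) (vs j) /\
     forall x, d <= x <= pi - d -> `|us j x| <= M /\ `|vs j x / A x| <= W] ->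
  (forall x, 0 < x < pi -> ulim U (fun j => us j x) (u x)) ->
  (forall x, 0 < x < pi -> ulim U (fun j => vs j x) (v x)) ->
  is_derive t 1 u (v t / A t) /\ is_derive t 1 v (- (A t * g (u t))).
Proof.
move=> UU M0 W0 d0 htd ev hu hv.
have sub x : d <= x <= pi - d -> 0 < x < pi.
  by move=> /andP[/(lt_le_trans d0) -> h]; rewrite (le_lt_trans h) // gtrBl.
have ht' : d <= t <= pi - d by have /andP[/ltW -> /ltW ->] := htd.
have dpi : 0 < d < pi.
  by have /andP[h1 h2] := sub t ht'; have /andP[/lt_trans -> //] := htd; rewrite d0.
have ht : 0 < t < pi := sub t ht'.
have [C C0 hC] := equi_lipschitz a_gt0 lam_gt0 m1 m2 M0 W0 dpi.
have hva : ulim U (fun j => vs j t / A t) (v t / A t).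
  rewrite mulrC; apply: ulim_ext (ulim_mulr (A t)^-1 (hv t ht)).
  by apply: filterE => j /=; rewrite mulrC.
split.
  apply: (@ulim_derive R U UU us (fun j x => vs j x / A x) u (fun x => v x / A x)
     d (pi - d) C t C0 htd).
  - by apply: filterS ev => j /= [sj _] x hx; have [] := sj x hx.
  - by apply: filterS ev => j /= [sj bj] x hx; have [] := hC _ _ t x sj bj ht' hx.
  - by move=> x hx; apply: hu; exact: sub.
  - exact: hva.
apply: (@ulim_derive R U UU vs (fun j x => - (A x * g (us j x))) v (fun x => - (A x * g (u x)))
     d (pi - d) C t C0 htd).
- by apply: filterS ev => j /= [sj _] x hx; have [] := sj x hx.
- by apply: filterS ev => j /= [sj bj] x hx; have [] := hC _ _ t x sj bj ht' hx.
- by move=> x hx; apply: hv; exact: sub.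
- apply: (@ulim_comp R U UU (fun y => - (A t * g y))); last exact: hu.
  exact: der_continuous (der_opp (der_mul (der_cst (A t) _) (der_gnl lam a_gt0 _))).
Qed.

(** The limit itself may a priori have fewer zeros than its approximations. The last
   clause therefore keeps, for each del and eta, an approximating solution whose
   phase point at del is eta-close to that of the limit. *)
Lemma limit_solution k : (0 < k)%N -> exists u v (u0 upi G rho M : R),
  [/\ [/\ 0 < rho, rho <= 1, 0 <= G & 0 <= M],
      forall del, 0 < del -> ode_sol A g del (pi - del) u v,
      (forall t, 0 < t < pi -> `|u t| <= M) /\ close_ends G rho u v u0 upi,
      1 <= u0 &
      forall del eta, 0 < del <= 1 -> 0 < eta -> exists e w z th,
      [/\ 0 < e < del, ode_sol A g e (pi - e) w z /\ prufer e (pi - e) w z th,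
          [/\ th e = 0, th (pi - e) = k%:R * pi & 1 <= w e],
          (forall t, e <= t <= rho -> `|w t - w e| <= G * t ^+ 2 /\
                     `|w (pi - t) - w (pi - e)| <= G * t ^+ 2) /\
          (forall t, e <= t <= pi - e -> `|w t| <= M) &
          [/\ `|w (pi - e) - upi| < eta, `|w del - u del| < eta & `|z del - v del| < eta]]].
Proof.
move=> k0; have [D [eps0 [D1 eps00 hsh]]] := shooting a_gt0 lam_gt0 m1_gt0 m2_gt0 sub1 sub2 k0.
have pi2 := @pi_ge2 R.
pose eps (j : nat) : R := Num.min eps0 2^-1 / (j.+1%:R).
have m0 : 0 < Num.min eps0 2^-1 by rewrite lt_min eps00 invr_gt0 ltr0n.
have m_1 : Num.min eps0 2^-1 <= 2^-1 by rewrite ge_min lexx orbT.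
have me : Num.min eps0 2^-1 <= eps0 by rewrite ge_min lexx.
have eps_gt0 j : 0 < eps j by rewrite divr_gt0.
have eps_le j : eps j <= Num.min eps0 2^-1.
  have h : (1 : R) <= j.+1%:R by rewrite ler1n.
  by rewrite ler_pdivrMr // ler_peMr // ltW.
have eps_e0 j : 0 < eps j <= eps0 by rewrite eps_gt0 (le_trans (eps_le j)).
have /choice[S hS] : forall j, exists w : (R -> R) * (R -> R) * (R -> R),
  [/\ ode_sol A g (eps j) (pi - eps j) w.1.1 w.1.2,
      prufer (eps j) (pi - eps j) w.1.1 w.1.2 w.2,
      w.2 (eps j) = 0 /\ w.2 (pi - eps j) = k%:R * pi,
      w.1.2 (eps j) = 0 /\ w.1.2 (pi - eps j) = 0 &
      1 <= w.1.1 (eps j) <= D /\ `|w.1.1 (pi - eps j)| <= D].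
  by move=> j; have [u [v [th h]]] := hsh (eps j) (eps_e0 j); exists ((u, v), th).
pose us j := (S j).1.1; pose vs j := (S j).1.2; pose ths j := (S j).2.
have eps_half j : eps j <= 2^-1 := le_trans (eps_le j) m_1.
have half1 : 2^-1 < 1 :> R by rewrite invf_lt1 // ltr1n.
have pi1 : 1 <= pi / 2 :> R by rewrite ler_pdivlMr // mul1r.
have eps_lt_half j : eps j < pi / 2.
  exact: le_lt_trans (eps_half j) (lt_le_trans half1 pi1).
have eps_in j : eps j <= pi - eps j.
  by rewrite lerBrDr -mulr2n -mulr_natr -ler_pdivlMr // ltW.
have [M [W [M1 W0 hMW]]] := bounded_of_end_heights a_gt0 lam_gt0 m1 m2 D1.
have bnd j t : eps j <= t <= pi - eps j -> `|us j t| <= M /\ `|vs j t / A t| <= W.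
  have [s1 P1 [t1 t2] [v1 v2] [/andP[d1 d2] d3]] := hS j.
  have d4 : `|us j (eps j)| <= D by rewrite ger0_norm //; apply: le_trans d1.
  by move=> ht; apply: (hMW (eps j) (us j) (vs j) (eps_gt0 j) (eps_lt_half j) s1 v1 v2 d4 d3).
have M0 : 0 <= M := le_trans ler01 M1.
pose G := lam * (pw a M * M).
have G0 : 0 <= G by rewrite mulr_ge0 ?(ltW lam_gt0) // mulr_ge0 ?pw_ge0.
have r10 : 0 < rad a m1 m2 by exact: rad_gt0.
have r20 : 0 < rad a m2 m1 by exact: rad_gt0.
have r11 : rad a m1 m2 <= 1 := @rad_le1 R a m1 m2.
have r21 : rad a m2 m1 <= 1 := @rad_le1 R a m2 m1.
pose rho := Num.min (rad a m1 m2) (rad a m2 m1).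
have rho0 : 0 < rho by rewrite lt_min r10 r20.
have rho1 : rho <= rad a m1 m2 by rewrite ge_min lexx.
have rho2 : rho <= rad a m2 m1 by rewrite ge_min lexx orbT.
have ends j t : eps j <= t <= rho ->
    [/\ `|vs j t / A t| <= G * t, `|us j t - us j (eps j)| <= G * t ^+ 2,
      `|vs j (pi - t) / A (pi - t)| <= G * t &
      `|us j (pi - t) - us j (pi - eps j)| <= G * t ^+ 2].
  move=> /andP[t1 t2].
  have [s1 P1 [th1 th2] [v1 v2] _] := hS j.
  have tt1 : eps j <= t <= rad a m1 m2 by rewrite t1 (le_trans t2).
  have tt2 : eps j <= t <= rad a m2 m1 by rewrite t1 (le_trans t2).
  have bj s (hs : eps j <= s <= pi - eps j) := (bnd j s hs).1.
  have r1e : rad a m1 m2 <= pi - eps j.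
    by move: r11 pi2 (eps_half j); forget; lra.
  have r2e : eps j <= pi - rad a m2 m1.
    by move: r21 pi2 (eps_half j); forget; lra.
  have [h1 h2] := left_end_bounds a_gt0 lam_gt0 M1 m1_gt0 (eps_gt0 j) r1e s1 v1 bj tt1.
  have [h3 h4] := right_end_bounds a_gt0 lam_gt0 M1 m2_gt0 (eps_gt0 j) r2e s1 v2 bj tt2.
  by split.
have [U [UU hU]] := ultraFilterLemma (@eventually_filter).
have ev_eps d : 0 < d -> U [set j | eps j < d].
  move=> d0; apply: hU.
  have [n hn] : exists n : nat, Num.min eps0 2^-1 / d < n%:R.
    by exists (Num.truncn (Num.min eps0 2^-1 / d)).+1; rewrite truncnS_gt.
  exists n => // j /= nj; rewrite /eps ltr_pdivrMr //.
  move: hn; rewrite ltr_pdivrMr // => hn; apply: lt_le_trans hn _.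
  by rewrite mulrC ler_pM2l // ler_nat leqW.
have ev_in t : 0 < t < pi -> U [set j | eps j <= t <= pi - eps j].
  move=> /andP[t1 t2]; have h1 := ev_eps _ t1.
  have h2 : U [set j | eps j < pi - t] by apply: ev_eps; rewrite subr_gt0.
  apply: filterS (filterI h1 h2) => j [/= /ltW -> /=].
  by rewrite ltrBrDr addrC -ltrBrDr => /ltW.
have /choice[u hu] : forall t, exists l, 0 < t < pi -> ulim U (fun j => us j t) l.
  move=> t; have [ht|nt] := pselect (0 < t < pi); last by exists 0.
  have [|l hl] := @ulim_exists R U UU (fun j => us j t) M; last by exists l.
  by apply: filterS (ev_in t ht) => j /= hj; have [] := bnd j t hj.
have Apos t : 0 < t < pi -> 0 < A t <= 1.
  by move=> ht; rewrite wt_gt0 //= wt_le1.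
have /choice[v hv] : forall t, exists l, 0 < t < pi -> ulim U (fun j => vs j t) l.
  move=> t; have [ht|nt] := pselect (0 < t < pi); last by exists 0.
  have [|l hl] := @ulim_exists R U UU (fun j => vs j t) W; last by exists l.
  apply: filterS (ev_in t ht) => j /= hj; have [_ h] := bnd j t hj.
  have /andP[w0 w1] := Apos t ht.
  move: h; rewrite normrM normfV (gtr0_norm w0) ler_pdivrMr // => h.
  by apply: le_trans h _; rewrite ler_piMr.
have [u0 hu0] : exists l, ulim U (fun j => us j (eps j)) l.
  apply: (@ulim_exists R U UU _ M); apply: filterE => j.
  by have [] := bnd j (eps j); rewrite ?lexx ?eps_in.
have [upi hupi] : exists l, ulim U (fun j => us j (pi - eps j)) l.
  apply: (@ulim_exists R U UU _ M); apply: filterE => j.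
  by have [] := bnd j (pi - eps j); rewrite ?lexx ?eps_in.
have hva t : 0 < t < pi -> ulim U (fun j => vs j t / A t) (v t / A t).
  move=> ht; rewrite mulrC; apply: ulim_ext (ulim_mulr (A t)^-1 (hv t ht)).
  by apply: filterE => j /=; rewrite mulrC.
have solu del : 0 < del -> ode_sol A g del (pi - del) u v.
  move=> d0 t /andP[t1 t2]; pose d := del / 2.
  have dd : 0 < d by rewrite divr_gt0.
  have ddel : d < del by rewrite ltr_pdivrMr // ltr_pMr // ltr1n.
  have htd : d < t < pi - d.
    by rewrite (lt_le_trans ddel t1) (le_lt_trans t2) // ltrD2l ltrN2.
  apply: (ulim_ode_sol UU M0 W0 dd htd _ hu hv).
  apply: filterS (ev_eps d dd) => j /= /ltW hj; have [s1 _ _ _ _] := hS j.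
  have sub x : d <= x <= pi - d -> eps j <= x <= pi - eps j.
    by move=> /andP[/(le_trans hj) -> /le_trans -> //]; rewrite lerD2l lerN2.
  by split=> x /sub hx; [exact: s1|exact: bnd].
exists u, v, u0, upi, G, rho, M; split => //.
- by split => //; rewrite (le_trans rho1).
- split.
    move=> t ht; apply: (ulim_norm_le (hu t ht)).
    by apply: filterS (ev_in t ht) => j /= hj; have [] := bnd j t hj.
  move=> t /andP[t1 t2].
  have tpi : t < pi.
    by rewrite (le_lt_trans t2) // (le_lt_trans rho1) // (le_lt_trans r11) // (lt_le_trans _ pi2) // ltr1n.
  have ht : 0 < t < pi by rewrite t1.
  have ht' : 0 < pi - t < pi by rewrite subr_gt0 tpi gtrBl.
  have ev : U [set j | eps j <= t <= rho].
    by apply: filterS (ev_eps t t1) => j /= hj; rewrite t2 ltW.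
  split.
  + apply: (ulim_norm_le (hva t ht)); apply: filterS ev => j /= hj.
    by have [] := ends j t hj.
  + apply: (ulim_norm_le (ulim_sub (hu t ht) hu0)); apply: filterS ev => j /= hj.
    by have [] := ends j t hj.
  + apply: (ulim_norm_le (hva (pi - t) ht')); apply: filterS ev => j /= hj.
    by have [] := ends j t hj.
  + apply: (ulim_norm_le (ulim_sub (hu (pi - t) ht') hupi)); apply: filterS ev => j /= hj.
    by have [] := ends j t hj.
- rewrite -lerN2 -[- u0]mulN1r.
  apply: (@ulim_le R U UU _ _ (-1) (ulim_mulr (-1) hu0)); apply: filterE => j /=.
  by rewrite mulN1r lerN2; have [_ _ _ _ [/andP[]]] := hS j.
move=> del eta /andP[d0 d1] eta0.
have hd : 0 < del < pi by rewrite d0 (le_lt_trans d1) // (lt_le_trans _ pi2) // ltr1n.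
have [j [/= [/= [/= h1 h2] h3] h4]] := filter_ex (filterI (filterI (filterI (ev_eps del d0)
  (hupi eta eta0)) (hu del hd eta eta0)) (hv del hd eta eta0)).
have [s1 P1 [th1 th2] [v1 v2] [/andP[e1 e2] _]] := hS j.
exists (eps j), (us j), (vs j), (ths j); split => //.
- by rewrite eps_gt0.
- split; last by move=> t ht; have [] := bnd j t ht.
  by move=> t ht; have [_ ? _ ?] := ends j t ht.
Qed.

End Limit.

(** * Uniqueness at the singular endpoint *)

Section Nontrivial.
Context {R : realType}.
Variables (a lam : R).
Hypotheses (a_gt0 : 0 < a) (lam_gt0 : 0 < lam).
Implicit Types (u v th w z : R -> R) (r s t b d e x y B l M G C D eps rho eta del : R) (k n : nat).

Local Notation g := (gnl a lam).
Local Notation F := (Fnl a lam).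

Ltac forget := clear -a_gt0 lam_gt0.

Lemma le0_of_linear x C r : 0 < r -> (forall s, 0 < s <= r -> x <= C * s) -> x <= 0.
Proof.
move=> r0 h; rewrite leNgt; apply/negP => x0.
have C1 : 0 < `|C| + 1 by rewrite ltr_wpDl.
pose s := Num.min r (x / (2 * (`|C| + 1))).
have s0 : 0 < s by rewrite lt_min r0 divr_gt0 // mulr_gt0.
have sr : s <= r by rewrite ge_min lexx.
have : s <= x / (2 * (`|C| + 1)) by rewrite ge_min lexx orbT.
rewrite ler_pdivlMr ?mulr_gt0 // => hs.
have xs : x <= C * s by apply: h; rewrite s0.
have Cs : C * s <= `|C| * s by rewrite ler_pM2r // ler_norm.
by move: hs xs Cs s0 x0; forget; lra.
Qed.

Lemma Fnl_small x : `|x| <= 1 -> F x <= lam * x ^+ 2.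
Proof.
move=> hx; rewrite ler_pM2l //.
have p1 : pw a x <= 1 by rewrite -(pw1 a); apply: pw_le; rewrite // normr1.
have x2 := sqr_ge0 x; have a1 : 1 <= a + 2 by move: a_gt0; forget; lra.
rewrite lerBlDr; apply: le_trans (_ : x ^+ 2 <= _); last by rewrite lerDl divr_ge0.
rewrite ler_pdivrMr ?(lt_le_trans ltr01 a1) //.
by rewrite mulrC; apply: ler_pM; rewrite ?pw_ge0 // (le_trans p1).
Qed.

Lemma Fnl_ge x : - (lam * (x ^+ 2 / 2)) <= F x.
Proof.
rewrite -mulrN ler_pM2l // lerDr divr_ge0 // ?addr_ge0 ?(ltW a_gt0) //.
by rewrite mulr_ge0 ?pw_ge0 ?sqr_ge0.
Qed.

Lemma slope_of_energy x y : x ^+ 2 / 2 + F y <= 0 -> x ^+ 2 <= lam * y ^+ 2.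
Proof. by have := Fnl_ge y; forget; lra. Qed.

Lemma mul_le_of_slope x y : x ^+ 2 <= lam * y ^+ 2 -> 2 * (y * x) <= (1 + lam) * y ^+ 2.
Proof. by have := sqr_ge0 (y - x); forget; lra. Qed.

Section ZeroData.
Variables (m1 m2 : nat) (rho G : R) (u v : R -> R).
Hypotheses (m1_gt0 : (0 < m1)%N) (rho01 : 0 < rho <= 1) (G_ge0 : 0 <= G)
  (sol : forall del, 0 < del -> ode_sol (wt m1 m2) g del (pi - del) u v)
  (data : forall t, 0 < t <= rho -> `|v t / wt m1 m2 t| <= G * t /\ `|u t| <= G * t ^+ 2).

Let r0 := Num.min rho (1 / (m1%:R + m2%:R)).
Let r1 := Num.min r0 (G + 1)^-1.

Let r0_rho : r0 <= rho. Proof. by rewrite ge_min lexx. Qed.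
Let r0_1 : r0 <= 1. Proof. by have /andP[_] := rho01; exact: le_trans. Qed.
Let r0_gt0 : 0 < r0.
Proof.
have /andP[rho0 _] := rho01; rewrite lt_min rho0 divr_gt0 // ltr_pwDl // ltr0n //.
Qed.
Let r0_pi : r0 < pi.
Proof. by apply: le_lt_trans r0_1 (lt_le_trans _ (pi_ge2 R)); rewrite ltr1n. Qed.
Let G1 : 0 < G + 1. Proof. by rewrite ltr_wpDl. Qed.
Let r1_gt0 : 0 < r1. Proof. by rewrite lt_min r0_gt0 invr_gt0. Qed.
Let r1_r0 : r1 <= r0. Proof. by rewrite ge_min lexx. Qed.

Let small s : 0 < s <= r1 ->
  [/\ s <= 1, `|u s| <= 1, u s ^+ 2 <= G ^+ 2 * s & (v s / wt m1 m2 s) ^+ 2 <= G ^+ 2 * s].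
Proof.
move=> /andP[s0 sr]; have sr0 := le_trans sr r1_r0.
have [|hv hu] := @data s; first by rewrite s0 (le_trans sr0 r0_rho).
have s1 : s <= 1 := le_trans sr0 r0_1; have s0' := ltW s0.
have Gs : G * s <= 1.
  apply: le_trans (_ : s * (G + 1) <= _); first by rewrite mulrC ler_pM2l // lerDl.
  by rewrite -ler_pdivlMr // mul1r (le_trans sr) // ge_min lexx orbT.
have Gs2 : G * s ^+ 2 <= G * s by rewrite expr2 mulrA ler_piMr // mulr_ge0.
have key x : `|x| <= G * s -> x ^+ 2 <= G ^+ 2 * s.
  move=> hx; rewrite -(real_normK (num_real x)).
  apply: le_trans (_ : (G * s) ^+ 2 <= _); first by rewrite ler_sqr ?nnegrE ?mulr_ge0.
  by rewrite exprMn; apply: ler_wpM2l; rewrite ?sqr_ge0 // expr2 ler_piMr.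
by split=> //; [exact: le_trans (le_trans hu Gs2) Gs|exact: key (le_trans hu Gs2)|exact: key].
Qed.

Let sol_from s : 0 < s -> ode_sol (wt m1 m2) g s r0 u v.
Proof.
move=> s0 x /andP[x1 x2]; apply: (sol (del := Num.min s 1)); first by rewrite lt_min s0 ltr01.
have h2 : Num.min s 1 <= 1 by rewrite ge_min lexx orbT.
rewrite (le_trans _ x1) ?ge_min ?lexx //= (le_trans x2) // lerBrDr.
by apply: le_trans (pi_ge2 R); rewrite -[2]/(1 + 1); apply: lerD.
Qed.

(** The energy tends to 0 at the endpoint and does not increase near it. *)
Let energy_le0 r : 0 < r <= r0 -> energy a lam m1 m2 u v r <= 0.
Proof.
move=> /andP[rr0 rt].
apply: (@le0_of_linear _ (G ^+ 2 / 2 + lam * G ^+ 2) (Num.min r r1)).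
  by rewrite lt_min rr0 r1_gt0.
move=> s; rewrite le_min => /andP[s0 /andP[sr sr1]].
have [|s1 u1 u2 v2] := @small s; first by rewrite s0.
apply: le_trans (_ : energy a lam m1 m2 u v s <= _).
  apply: (energy_nonincreasing a_gt0 s0 r0_pi (sol_from s0)) => //.
  by apply: frc_ge0_near; rewrite // ?rr0 ?(le_trans rt) // ge_min lexx orbT.
rewrite /energy mulrDl; apply: lerD; first by rewrite [leRHS]mulrAC ler_pM2r ?invr_gt0.
by apply: le_trans (Fnl_small u1) _; rewrite -mulrA ler_pM2l.
Qed.

Let slope_bound r : 0 < r <= r0 -> (v r / wt m1 m2 r) ^+ 2 <= lam * u r ^+ 2.
Proof. by move=> hr; apply: slope_of_energy; exact: energy_le0. Qed.

(** Zero data at the singular endpoint force the zero solution: u' is then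
   controlled by u, and Gronwall's inequality applies from every s > 0. *)
Lemma singular_unique : exists2 t, 0 < t <= 1 & u t = 0 /\ v t = 0.
Proof.
exists r0; first by rewrite r0_gt0.
have ut : u r0 ^+ 2 <= 0.
  apply: (@le0_of_linear _ (G ^+ 2 * expR ((1 + lam) * r0)) r1 r1_gt0) => s hs.
  have /andP[s0 sr1] := hs; have [s1 _ u2 _] := small hs.
  have st : s <= r0 := le_trans sr1 r1_r0.
  have du x (hx : s <= x <= r0) := der_exp 2 (sol_from s0 hx).1.
  have h := gronwall_le (c := 1 + lam) st du.
  have {}h : u r0 ^+ 2 <= u s ^+ 2 * expR ((1 + lam) * (r0 - s)).
    apply: h => x /andP[x1 x2]; rewrite /= expr1.
    rewrite -mulrA; apply: mul_le_of_slope; apply: slope_bound.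
    by rewrite (lt_le_trans s0 x1).
  apply: le_trans h _; rewrite [leRHS]mulrAC.
  apply: ler_pM => //; first exact: sqr_ge0.
  by rewrite ler_expR ler_wpM2l ?addr_ge0 ?(ltW lam_gt0) // gerBl ltW.
have ut0 : u r0 = 0 by apply/eqP; rewrite -sqrf_eq0; apply/eqP/le_anti; rewrite ut sqr_ge0.
split => //; have := @slope_bound r0; rewrite r0_gt0 lexx => /(_ isT).
rewrite ut0 expr0n mulr0 => h.
have w0 : 0 < wt m1 m2 r0 by rewrite wt_gt0 // r0_gt0.
have : v r0 / wt m1 m2 r0 = 0.
  by apply/eqP; rewrite -sqrf_eq0; apply/eqP/le_anti; rewrite h sqr_ge0.
by move/eqP; rewrite mulf_eq0 invr_eq0 (gt_eqF w0) orbF => /eqP.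
Qed.

End ZeroData.

(** As long as u has no zero, the angle cannot leave an interval of length pi around
   a multiple of pi. *)
Lemma angle_trapped c b u v th s t n : prufer c b u v th -> c <= s -> s <= t -> t <= b ->
  (forall x, s <= x <= t -> u x <> 0) ->
  `|th s - n%:R * pi| < pi / 2 <-> `|th t - n%:R * pi| < pi / 2.
Proof.
move=> P cs st tb nz.
have key x y : Num.min (`|th s - n%:R * pi|) (`|th t - n%:R * pi|) = x ->
   Num.max (`|th s - n%:R * pi|) (`|th t - n%:R * pi|) = y -> x < pi / 2 -> y < pi / 2.
  move=> ex ey xp; rewrite ltNge; apply/negP => yp.
  have [r /andP[r1 r2] er] : exists2 r, s <= r <= t & `|th r - n%:R * pi| = pi / 2.
    apply: (@ivt _ (fun r => `|th r - n%:R * pi|)) => //.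
      move=> r /andP[r1 r2].
      apply: (@continuous_comp _ _ _ (fun r => th r - n%:R * pi)); last exact: norm_continuous.
      apply: continuousB; last exact: cst_continuous.
      by apply: (prufer_continuous P); apply/andP; split; lra.
    by rewrite ex ey (ltW xp) yp.
  apply: (nz r); first by rewrite r1.
  apply/(prufer_zero P); first by apply/andP; split; lra.
  by rewrite -[th r](subrK (n%:R * pi)) cosDnatpi -cos_norm er cos_pihalf mulr0.
have [h1|h1] := leP (`|th s - n%:R * pi|) (`|th t - n%:R * pi|).
  by split=> [|h]; [apply: key; [exact/min_idPl|exact/max_idPr]|lra].
split=> [h|]; first lra.
by apply: key; [exact/min_idPr/ltW|exact/max_idPl/ltW].
Qed.

End Nontrivial.

(** * The limit has exactly k zeros *)

Section Nodal.
Context {R : realType}.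
Variables (a lam : R) (m1 m2 : nat).
Hypotheses (a_gt0 : 0 < a) (lam_gt0 : 0 < lam) (m1_gt0 : (0 < m1)%N) (m2_gt0 : (0 < m2)%N)
  (sub1 : a * (m1%:R - 1) < 4) (sub2 : a * (m2%:R - 1) < 4).
Implicit Types (u v th w z : R -> R) (r s t b d e x y B l M G D eps rho eta del : R) (k : nat).

Local Notation A := (wt m1 m2).
Local Notation g := (gnl a lam).

Ltac forget := clear -a_gt0 lam_gt0 m1_gt0 m2_gt0 sub1 sub2.

Lemma prufer_sub c b c' b' u v th : c <= c' -> b' <= b ->
  prufer c b u v th -> prufer c' b' u v th.
Proof.
move=> h1 h2 [p1 p2 p3 p4]; split => t /andP[t1 t2];
  [apply: p1|apply: p2|apply: p3|apply: p4]; apply/andP; split; lra.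
Qed.

(** Uniqueness in the regular interior, by Gronwall's inequality against the zero
   solution. *)
Lemma zero_data_zero M u v s t : (forall del, 0 < del -> ode_sol A g del (pi - del) u v) ->
  (forall t, 0 < t < pi -> `|u t| <= M) -> 0 < s < pi -> 0 < t < pi ->
  u t ^+ 2 + v t ^+ 2 = 0 -> u s = 0.
Proof.
move=> sol hM /andP[s0 spi] /andP[t0 tpi] Nt.
have M0 : 0 <= M by apply: le_trans (hM t _) => //; rewrite t0.
pose c := Num.min s t; pose b := Num.max s t.
have [cs ct] : c <= s /\ c <= t by rewrite !ge_min !lexx orbT.
have [sb tb] : s <= b /\ t <= b by rewrite !le_max !lexx orbT.
have c0 : 0 < c by rewrite lt_min s0.
have bpi : b < pi by rewrite gt_max spi.
pose del := Num.min c (pi - b).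
have d0 : 0 < del by rewrite lt_min c0 subr_gt0.
have solcb : ode_sol A g c b u v.
  apply: ode_sol_sub (sol del d0); first by rewrite ge_min lexx.
  by rewrite lerBrDl -lerBrDr ge_min lexx orbT.
have hMcb x : c <= x <= b -> `|u x| <= M.
  by move=> /andP[cx xb]; apply: hM; rewrite (lt_le_trans c0 cx) (le_lt_trans xb).
have [C [_ _ normC]] := solutions_dist m1 m2 a_gt0 lam_gt0 c0 (le_trans cs sb) bpi M0.
have := normC u v solcb hMcb t s; rewrite ct tb cs sb Nt mul0r => /(_ isT isT) Ns.
apply/eqP; rewrite -sqrf_eq0; apply/eqP/le_anti; rewrite sqr_ge0 andbT.
by apply: le_trans Ns; rewrite lerDl sqr_ge0.
Qed.

Lemma close_ends_refl G rho u v (u0 upi : R) :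
  close_ends m1 m2 G rho u v u0 upi ->
  close_ends m2 m1 G rho (fun t => u (pi - t)) (fun t => - v (pi - t)) upi u0.
Proof.
move=> h t ht; have [h1 h2 h3 h4] := h t ht.
have e : wt m2 m1 (pi - t) = A t by rewrite -wt_refl subKr.
by split; rewrite ?subKr ?mulNr ?normrN ?e // -wt_refl.
Qed.

(** If the value at pi vanished, the solution would vanish identically, also
   near 0, where it is at least 1. *)
Lemma right_end_nonzero M G rho u v (u0 upi : R) : 0 < rho <= 1 -> 0 <= G ->
  (forall del, 0 < del -> ode_sol A g del (pi - del) u v) ->
  (forall t, 0 < t < pi -> `|u t| <= M) ->
  close_ends m1 m2 G rho u v u0 upi -> 1 <= u0 -> upi <> 0.
Proof.
move=> hr G0 sol hM ends u01 upi0; have /andP[rho0 rho1] := hr.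
have pi2 := @pi_ge2 R.
have er := close_ends_refl ends; rewrite upi0 in er.
have [||t /andP[t0 t1] [ut vt]] := @singular_unique R a lam a_gt0 lam_gt0 m2 m1 rho G
   (fun t => u (pi - t)) (fun t => - v (pi - t)) m2_gt0 hr G0.
- by move=> del d0; have := ode_sol_refl (sol del d0); rewrite subKr.
- by move=> t ht; have [h1 h2 _ _] := er t ht; rewrite -[u _]subr0.
have ht : 0 < pi - t < pi by apply/andP; split; lra.
have N0 : u (pi - t) ^+ 2 + v (pi - t) ^+ 2 = 0.
  by move/eqP: vt; rewrite oppr_eq0 => /eqP ->; rewrite ut !expr0n addr0.
have zero s : 0 < s < pi -> u s = 0.
  by move=> hs; exact: zero_data_zero sol hM hs ht N0.
suff : u0 <= 0 by lra.
apply: (@le0_of_linear _ _ G rho rho0) => s /andP[s0 sr].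
have [_ h _ _] := ends s ltac:(by rewrite s0).
rewrite zero in h; last by apply/andP; split; lra.
rewrite sub0r normrN in h; have := ler_norm u0 => h2.
apply: le_trans h2 (le_trans h _); apply: ler_wpM2l => //.
by have s1 : s <= 1; [lra|nra].
Qed.

Section Comparison.
Variables (c b : R).
Hypothesis (cb : c <= b).

(** The angle passes k odd multiples of pi / 2 on its way from near 0 to near k pi;
   where it lies in ]pi / 2, pi] the solution is negative. *)
Lemma nodal_of_angle u v psi k : (0 < k)%N -> prufer c b u v psi ->
  `|psi c| < pi / 2 -> `|psi b - k%:R * pi| < pi / 2 ->
  exists z : nat -> R,
    [/\ forall i, (i < k)%N -> c <= z i <= b /\ u (z i) = 0,
        forall i j, (i < k)%N -> (j < k)%N -> z i = z j -> i = j,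
        forall t, c <= t <= b -> u t = 0 -> exists2 i, (i < k)%N & t = z i &
        exists2 t, c <= t <= b & u t < 0].
Proof.
move=> k0 Q; rewrite !ltr_norml => psil /andP[psir1 psir2].
have pi0 := @pi_gt0 R.
have psir' : k%:R * pi - pi / 2 < psi b < k%:R * pi + pi / 2.
  by apply/andP; split; lra.
have [z [hz1 hz2]] := prufer_exact_zeros Q cb psil psir'.
exists z; split => //.
- move=> i ik; have [hi ti] := hz1 i ik; split => //.
  by apply/(prufer_zero Q hi); rewrite ti cos_half_pi_nat.
- move=> i j ik jk zij; have [_ ti] := hz1 i ik; have [_ tj] := hz1 j jk.
  apply/eqP; rewrite -(eqr_nat R); apply/eqP.
  have := ti; rewrite zij tj => /addrI /eqP; rewrite -subr_eq0 -mulrBl mulf_eq0.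
  by rewrite (gt_eqF pi0) orbF subr_eq0 => /eqP.
pose al := Num.min pi (psi b).
have k1 : (1 : R) <= k%:R by rewrite ler1n.
have kpi : pi <= k%:R * pi :> R by nra.
have al1 : pi / 2 < al by rewrite lt_min; apply/andP; split; lra.
have al2 : al <= pi by rewrite ge_min lexx.
have [t ht et] : exists2 t, c <= t <= b & psi t = al.
  apply: ivt => //; first by move=> t ht; exact: (prufer_continuous Q).
  rewrite ge_min le_max; apply/andP; split; apply/orP; [left|right].
    by move/andP: psil => [? ?]; lra.
  by rewrite ge_min lexx orbT.
exists t => //; rewrite (prufer_cos Q ht) et pmulr_rlt0 ?(prufer_amp_gt0 Q) //.
have : 0 < cos (pi - al) by apply: cos_gt0_pihalf; apply/andP; split; lra.
by rewrite cosB cospi sinpi mul0r addr0 mulN1r oppr_gt0.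
Qed.

Lemma cos_gt0_small x : `|x| < pi -> 0 < cos x -> `|x| < pi / 2.
Proof.
move=> xpi; rewrite -cos_norm => h; rewrite ltNge; apply/negP => h2.
have : 0 <= cos (pi - `|x|) by apply: cos_ge0_pihalf; apply/andP; split; lra.
by rewrite cosB cospi sinpi mul0r addr0 mulN1r; lra.
Qed.

Lemma polar_start u v t : 0 < u t -> exists phi, [/\ - (pi / 2) < phi < pi / 2,
  u t = amp u v t * cos phi & v t = - (amp u v t * sin phi)].
Proof.
move=> u0; exists (atan (- v t / u t)).
have ampE : amp u v t = u t * Num.sqrt (1 + (- v t / u t) ^+ 2).
  rewrite /amp; have -> : u t ^+ 2 + v t ^+ 2 = u t ^+ 2 * (1 + (- v t / u t) ^+ 2).
    by field; rewrite gt_eqF.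
  by rewrite sqrtrM ?sqr_ge0 // sqrtr_sqr gtr0_norm.
have sq0 : 0 < Num.sqrt (1 + (- v t / u t) ^+ 2).
  by rewrite sqrtr_gt0; have := sqr_ge0 (- v t / u t); lra.
have c0 : cos (atan (- v t / u t)) != 0 by rewrite cos_atan invr_eq0 gt_eqF.
have uE : u t = amp u v t * cos (atan (- v t / u t)).
  by rewrite ampE cos_atan mulfK ?gt_eqF.
split => //; first by rewrite atan_gtNpi2 atan_ltpi2.
have -> : sin (atan (- v t / u t)) = - v t / u t * cos (atan (- v t / u t)).
  by rewrite -[X in X * cos _]atanK /tan divfK.
by rewrite mulrCA -uE divfK ?gt_eqF // opprK.
Qed.

(** While the scalar product of the phase points is positive, the two angles differ
   by less than pi / 2. At b both angles are close to the same multiple of pi,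
   because the two values have the same sign there. *)
Lemma prufer_transfer u v w z th k : 0 < c -> b < pi ->
  ode_sol A g c b u v -> prufer c b w z th ->
  (forall t, c <= t <= b -> 0 < u t ^+ 2 + v t ^+ 2) ->
  (forall t, c <= t <= b -> 0 < u t * w t + v t * z t) ->
  0 < u c -> `|th c| < pi / 2 -> `|th b - k%:R * pi| < pi / 2 -> 0 < u b * w b ->
  exists psi, [/\ prufer c b u v psi, `|psi c| < pi / 2 & `|psi b - k%:R * pi| < pi / 2].
Proof.
move=> c0 bpi sol P Npos dot uc thc thb uw.
have inpi t : c <= t <= b -> 0 < t < pi by move=> /andP[? ?]; apply/andP; split; lra.
have [phi [phi1 cphi sphi]] := polar_start v uc.
have cA t : c <= t <= b -> {for t, continuous A}.
  by move=> /inpi ht; exact: wt_continuous.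
have pA t : c <= t <= b -> 0 < A t by move=> /inpi; exact: wt_gt0.
have [psi [psi0 Q]] := prufer_exists cb sol pA cA (@gnl_continuous R a lam a_gt0) Npos cphi sphi.
have hc : c <= c <= b by rewrite lexx.
have hb : c <= b <= b by rewrite lexx cb.
exists psi; split => //; first by rewrite psi0 ltr_norml.
have close0 : `|psi c - th c| < pi / 2.
  apply: cos_gt0_small.
    move: thc; rewrite psi0 !ltr_norml => /andP[? ?]; move/andP: phi1 => [? ?].
    by apply/andP; split; lra.
  have := dot c hc; rewrite (cos_angle_diff hc Q P) pmulr_rgt0 //.
  by rewrite mulr_gt0 // (prufer_amp_gt0 Q, prufer_amp_gt0 P).
have close1 : `|psi b - th b| < pi / 2.
  by apply: (angle_stay_close hb Q P) => // s hs; exact: dot.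
have cb0 : 0 < cos (th b - k%:R * pi).
  by apply: cos_gt0_pihalf; move: thb; rewrite ltr_norml.
apply: cos_gt0_small.
  have -> : psi b - k%:R * pi = (psi b - th b) + (th b - k%:R * pi) by ring.
  by apply: le_lt_trans (ler_normD _ _) _; lra.
have uE : u b = amp u v b * ((-1) ^+ k * cos (psi b - k%:R * pi)).
  by rewrite (prufer_cos Q hb) -cosDnatpi subrK.
have wE : w b = amp w z b * ((-1) ^+ k * cos (th b - k%:R * pi)).
  by rewrite (prufer_cos P hb) -cosDnatpi subrK.
move: uw; rewrite uE wE.
move: (cos (psi b - _)) (cos (th b - _)) cb0 => x y y0.
have -> : amp u v b * ((-1) ^+ k * x) * (amp w z b * ((-1) ^+ k * y))
  = (amp u v b * amp w z b * y) * x * ((-1) ^+ k * (-1) ^+ k) by ring.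
rewrite -exprD addnn -signr_odd odd_double expr0 mulr1 pmulr_rgt0 //.
by rewrite !mulr_gt0 // (prufer_amp_gt0 Q, prufer_amp_gt0 P).
Qed.

(** The phase point of u stays at a positive distance from the origin, and by
   continuous dependence nearby solutions stay within that distance. *)
Lemma stay_close M u v : 0 < c -> b < pi -> 0 <= M -> ode_sol A g c b u v ->
  (forall t, c <= t <= b -> `|u t| <= M) -> 0 < u c ->
  (forall t, c <= t <= b -> 0 < u t ^+ 2 + v t ^+ 2) /\
  exists2 eta, 0 < eta & forall w z, ode_sol A g c b w z ->
    (forall t, c <= t <= b -> `|w t| <= M) ->
    `|w c - u c| < eta -> `|z c - v c| < eta ->
    forall t, c <= t <= b -> 0 < u t * w t + v t * z t.
Proof.
move=> c0 bpi M0 sol hu uc; pose N0 := u c ^+ 2 + v c ^+ 2.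
have N00 : 0 < N0 by rewrite ltr_pwDl ?sqr_ge0 // exprn_gt0.
have hc : c <= c <= b by rewrite lexx.
have [C [C0 distC normC]] := solutions_dist m1 m2 a_gt0 lam_gt0 c0 cb bpi M0.
have lowN t : c <= t <= b -> N0 <= (u t ^+ 2 + v t ^+ 2) * C.
  by move=> ht; exact: normC sol hu t c ht hc.
split.
  by move=> t ht; have := lt_le_trans N00 (lowN t ht); rewrite pmulr_lgt0.
pose e2 := N0 / (2 * C ^+ 2 + 1).
have CC : 0 < 2 * C ^+ 2 + 1 by rewrite ltr_wpDl // mulr_ge0 ?sqr_ge0.
have e20 : 0 < e2 by rewrite divr_gt0.
exists (Num.sqrt e2); first by rewrite sqrtr_gt0.
move=> w z solw hw h1 h2 t ht; apply: dot_pos_of_close.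
have sq x : `|x| < Num.sqrt e2 -> x ^+ 2 <= e2.
  move=> hx; rewrite -[leRHS](sqr_sqrtr (ltW e20)) -(real_normK (num_real x)).
  by rewrite ler_sqr ?nnegrE ?normr_ge0 ?sqrtr_ge0 // ltW.
have q1 : (u c - w c) ^+ 2 <= e2 by apply: sq; rewrite distrC.
have q2 : (v c - z c) ^+ 2 <= e2 by apply: sq; rewrite distrC.
have h3 := distC u v w z sol solw hu hw c t hc ht.
have h4 : (u t - w t) ^+ 2 + (v t - z t) ^+ 2 <= 2 * e2 * C.
  by apply: le_trans h3 _; apply: ler_wpM2r; [exact: ltW|lra].
apply: le_lt_trans h4 _; rewrite -(ltr_pM2r C0); apply: lt_le_trans (lowN t ht).
have -> : 2 * e2 * C * C = N0 * (2 * C ^+ 2 / (2 * C ^+ 2 + 1)).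
  by rewrite /e2; field; rewrite gt_eqF.
by rewrite -[ltRHS]mulr1 ltr_pM2l // ltr_pdivrMr // mul1r ltrDl.
Qed.

End Comparison.

Lemma near_nonzero x y : `|x - y| < `|y| / 2 -> x <> 0.
Proof. by move=> h x0; move: h; rewrite x0 sub0r normrN; have := normr_ge0 y; lra. Qed.

Lemma near_nonzero_mul x1 x2 y : `|x1 - y| < `|y| / 2 -> `|x2 - y| < `|y| / 2 -> 0 < x1 * x2.
Proof.
have [y0|y0] := leP 0 y.
  rewrite (ger0_norm y0) !ltr_norml => /andP[? ?] /andP[? ?]; apply: mulr_gt0; lra.
by rewrite (ltr0_norm y0) !ltr_norml => /andP[? ?] /andP[? ?]; rewrite nmulr_rgt0; lra.
Qed.

(** Near the ends the limit and its approximation have no zeros, because they stay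
   close to nonzero end values; in between their angles make the same number of
   half turns. *)
Lemma nodal_limit k : (0 < k)%N -> exists u v (u0 upi G rho : R),
  [/\ [/\ 0 < rho, rho <= 1 & 0 <= G],
      forall del, 0 < del -> ode_sol A g del (pi - del) u v,
      close_ends m1 m2 G rho u v u0 upi,
      u0 <> 0 /\ upi <> 0 &
      exists z : nat -> R,
      [/\ forall i, (i < k)%N -> 0 < z i < pi /\ u (z i) = 0,
          forall i j, (i < k)%N -> (j < k)%N -> z i = z j -> i = j,
          forall t, 0 < t < pi -> u t = 0 -> exists2 i, (i < k)%N & t = z i,
          exists2 t, 0 < t < pi & u t < 0 &
          exists2 t, 0 < t < pi & 0 < u t]].
Proof.
move=> k0.
have [u [v [u0 [upi [G [rho [M [[rho0 rho1 G0 M0] sol [hM ends] u01 appr]]]]]]]] :=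
  limit_solution a_gt0 lam_gt0 m1_gt0 m2_gt0 sub1 sub2 k0.
have hr : 0 < rho <= 1 by rewrite rho0.
have upi0 := right_end_nonzero hr G0 sol hM ends u01.
have nupi : 0 < `|upi| by rewrite normr_gt0; apply/eqP.
exists u, v, u0, upi, G, rho; split => //.
  by split => // e; rewrite e in u01; lra.
(* up to distance del the solutions keep the signs of their endpoint values *)
have [del [d0 drho small]] : exists del, [/\ 0 < del, del <= rho &
    forall t, 0 < t <= del -> G * t ^+ 2 <= 4^-1 /\ G * t ^+ 2 <= `|upi| / 4].
  pose c := Num.min 1 `|upi|.
  have c0 : 0 < c by rewrite lt_min ltr01.
  have c1 : c <= 1 by rewrite ge_min lexx.
  have cpi : c <= `|upi| by rewrite ge_min lexx orbT.
  have G1 : 0 < 4 * (G + 1) by lra.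
  exists (Num.min rho (c / (4 * (G + 1)))); split.
  - by rewrite lt_min rho0 divr_gt0.
  - by rewrite ge_min lexx.
  move=> t; rewrite le_min ler_pdivlMr // => /and3P[t0 t1 t2].
  have tt : G * t ^+ 2 <= G * t by apply: ler_wpM2l => //; have : t <= 1; [lra|nra].
  lra.
move: sol ends appr small; clear hr => sol ends appr small.
have pi2 := @pi_ge2 R.
have d1 : 0 < del <= 1 by rewrite d0 (le_trans drho).
have dpi : del <= 1 by case/andP: d1.
have dd : del <= pi - del by move: pi2 dpi; forget; lra.
have Lpi : pi - del < pi by rewrite gtrBl.
have inner t : del <= t <= pi - del -> 0 < t < pi.
  by move=> /andP[t1 t2]; rewrite (lt_le_trans d0 t1) (le_lt_trans t2 Lpi).
have ul t : 0 < t <= del -> 0 < u t.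
  move=> ht; have /andP[t0 td] := ht; have [h2 _] := small t ht.
  have htr : 0 < t <= rho by rewrite t0 (le_trans td).
  have [_ h _ _] := ends t htr.
  move: h h2 u01; rewrite ler_norml => /andP[]; forget; lra.
have ur t : 0 < t <= del -> `|u (pi - t) - upi| < `|upi| / 2.
  move=> ht; have /andP[t0 td] := ht; have [_ h2] := small t ht.
  have htr : 0 < t <= rho by rewrite t0 (le_trans td).
  have [_ _ _ h] := ends t htr.
  move: h h2 nupi; forget; lra.
have udel : 0 < u del by apply: ul; rewrite d0 lexx.
have hMd t : del <= t <= pi - del -> `|u t| <= M by move=> /inner; exact: hM.
have [Npos [eta0 eta00 hclose]] := stay_close dd d0 Lpi M0 (sol del d0) hMd udel.
pose eta := Num.min (`|upi| / 4) eta0.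
have eta_gt0 : 0 < eta by rewrite lt_min divr_gt0.
have eta1 : eta <= `|upi| / 4 by rewrite ge_min lexx.
have eta2 : eta <= eta0 by rewrite ge_min lexx orbT.
have [e [w [z [th [/andP[e0 edel] [solw P] [th0 thL w1] [endw Mw] [n1 n2 n3]]]]]] :=
  appr del eta d1 eta_gt0.
have ee : e <= del by exact: ltW.
have ee' : pi - del <= pi - e by rewrite lerD2l lerN2.
have ede : e <= pi - del by exact: le_trans dd.
have PD : prufer del (pi - del) w z th by exact: prufer_sub P.
have wl t : e <= t <= del -> 0 < w t.
  move=> /andP[t1 t2].
  have [h2 _] := small t ltac:(by rewrite (lt_le_trans e0 t1)).
  have [h _] := endw t ltac:(by rewrite t1 (le_trans t2)).
  move: h h2 w1; rewrite ler_norml => /andP[]; forget; lra.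
have wr t : e <= t <= del -> `|w (pi - t) - upi| < `|upi| / 2.
  move=> /andP[t1 t2].
  have [_ h2] := small t ltac:(by rewrite (lt_le_trans e0 t1)).
  have [_ h] := endw t ltac:(by rewrite t1 (le_trans t2)).
  have -> : w (pi - t) - upi = (w (pi - t) - w (pi - e)) + (w (pi - e) - upi) by ring.
  apply: le_lt_trans (ler_normD _ _) _.
  move: h h2 n1 eta1; forget; lra.
have pih : 0 < pi / 2 :> R by rewrite divr_gt0 // pi_gt0.
have thdel : `|th del| < pi / 2.
  have nz x : e <= x <= del -> w x <> 0 by move=> /wl h wx; rewrite wx ltxx in h.
  have := (angle_trapped 0 P (lexx e) ee (le_trans dd ee') nz).1.
  by rewrite !mul0r !subr0 th0 normr0; apply.
have thr : `|th (pi - del) - k%:R * pi| < pi / 2.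
  have nz x : pi - del <= x <= pi - e -> w x <> 0.
    move=> /andP[x1 x2]; apply: (@near_nonzero _ upi); rewrite -[x](subKr pi); apply: wr.
    by apply/andP; split; [rewrite lerBrDl -lerBrDr|rewrite lerBlDl -lerBlDr].
  by apply: (angle_trapped k P ede ee' (lexx _) nz).2; rewrite thL subrr normr0.
have hdd : 0 < del <= del by rewrite d0 lexx.
have hed : e <= del <= del by rewrite ee lexx.
have uw := near_nonzero_mul (ur del hdd) (wr del hed).
have dot : forall t, del <= t <= pi - del -> 0 < u t * w t + v t * z t.
  apply: hclose; [exact: ode_sol_sub solw| |exact: lt_le_trans eta2|exact: lt_le_trans eta2].
  by move=> t /andP[t1 t2]; apply: Mw; rewrite (le_trans ee) ?(le_trans t2).
have [psi [Q psil psir]] := prufer_transfer dd d0 Lpi (sol del d0) PD Npos dot udel thdel thr uw.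
have [zs [hz1 hz2 hz3 [tn htn un]]] := nodal_of_angle dd k0 Q psil psir.
exists zs; split => //.
- by move=> i ik; have [hi ui] := hz1 i ik; split => //; exact: inner.
- move=> t /andP[t1 t2] ut; have [td|td] := leP t del.
    by have := ul t; rewrite t1 td ut ltxx => /(_ isT).
  have [td'|td'] := leP t (pi - del); first by apply: hz3 => //; rewrite (ltW td).
  have hpt : 0 < pi - t <= del by rewrite subr_gt0 t2 lerBlDl -lerBlDr ltW.
  by have := ur (pi - t) hpt; rewrite subKr ut => /near_nonzero.
- by exists tn => //; exact: inner.
- by exists del => //; apply: inner; rewrite lexx.
Qed.

End Nodal.

(** * Regularity at the endpoints *)

Section Regularity.
Context {R : realType}.
Variables (a lam : R).
Hypotheses (a_gt0 : 0 < a) (lam_gt0 : 0 < lam).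
Implicit Types (f u v w : R -> R) (r s t b d e x y B l M G D C eps rho eta del : R) (k : nat).

Local Notation g := (gnl a lam).

Lemma within_dnbhs_cvg (S : set R) f x l :
  (forall e, 0 < e -> exists2 r, 0 < r &
     forall y, S y -> 0 < `|y - x| < r -> `|f y - l| < e) ->
  f y @[y --> within S (dnbhs x)] --> l.
Proof.
move=> h; apply/cvgrPdist_lt => e e0; have [r r0 hr] := h e e0.
apply/nbhs_ballP; exists r => // y /=; rewrite /ball /= distrC => yr yx Sy.
by rewrite distrC; apply: hr => //; rewrite normr_gt0 subr_eq0 yx.
Qed.

Lemma within_nbhs_cvg (S : set R) f x :
  (forall e, 0 < e -> exists2 r, 0 < r &
     forall y, S y -> `|y - x| < r -> `|f y - f x| < e) ->
  f y @[y --> within S (nbhs x)] --> f x.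
Proof.
move=> h; apply/cvgrPdist_lt => e e0; have [r r0 hr] := h e e0.
apply/nbhs_ballP; exists r => // y /=; rewrite /ball /= distrC => yr Sy.
by rewrite distrC; apply: hr.
Qed.

(** Comparison of v + c0 t A with C t ^ 3 A, both of which vanish at the endpoint. *)
Lemma slope_expansion m1 m2 r G C c0 u v : r <= 1 -> 0 <= C ->
  (forall del, 0 < del -> ode_sol (wt m1 m2) g del (pi - del) u v) ->
  (forall t, 0 < t <= r -> `|v t / wt m1 m2 t| <= G * t) ->
  (forall t, 0 < t <= r -> 0 <= frc m1 m2 t) ->
  (forall t, 0 < t <= r -> `|c0 * (1 + t * frc m1 m2 t) - g (u t)| <= C * t ^+ 2) ->
  forall t, 0 < t <= r -> `|v t / wt m1 m2 t + c0 * t| <= C * t ^+ 3.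
Proof.
move=> r1 C0 sol hv hq hc t ht; have /andP[t0 tr] := ht.
have inpi x : 0 < x <= r -> 0 < x < pi.
  by move=> /andP[? ?]; have := @pi_ge2 R => ?; apply/andP; split; lra.
have w0 := wt_gt0 m1 m2 (inpi t ht).
have -> : v t / wt m1 m2 t + c0 * t = (v t + c0 * (t * wt m1 m2 t)) / wt m1 m2 t.
  by field; rewrite gt_eqF.
rewrite normrM normfV (gtr0_norm w0) ler_pdivrMr // -mulrA.
rewrite -subr_le0; apply: (@le0_of_linear _ _ (G + `|c0|) t t0) => s /andP[s0 st].
have srng x : s <= x <= t -> 0 < x <= r.
  by move=> /andP[x1 x2]; rewrite (lt_le_trans s0 x1) (le_trans x2).
have spi : t <= pi - s by have := @pi_ge2 R; lra.
have dH x (hx : s <= x <= t) : is_derive x 1 (fun x => v x + c0 * (x * wt m1 m2 x))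
   (wt m1 m2 x * (c0 * (1 + x * frc m1 m2 x) - g (u x))).
  have xpi := inpi x (srng x hx); have /andP[x1 x2] := hx.
  have hx2 : s <= x <= pi - s by rewrite x1 (le_trans x2).
  have [_ dv] := sol s s0 x hx2.
  apply: der_eq (der_add dv (der_mul (der_cst c0 x) (der_mul (der_id x) (der_wt m1 m2 xpi)))) _.
  by ring.
have dK x (hx : s <= x <= t) : is_derive x 1 (fun x => C * (x ^+ 3 * wt m1 m2 x))
   (C * (3 * x ^+ 2 * wt m1 m2 x + x ^+ 3 * (wt m1 m2 x * frc m1 m2 x))).
  have xpi := inpi x (srng x hx).
  apply: der_eq (der_mul (der_cst C x) (der_mul (der_exp 3 (der_id x)) (der_wt m1 m2 xpi))) _.
  by rewrite /=; ring.
have h : `|v t + c0 * (t * wt m1 m2 t) - (v s + c0 * (s * wt m1 m2 s))| <=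
    C * (t ^+ 3 * wt m1 m2 t) - C * (s ^+ 3 * wt m1 m2 s).
  apply: (der_norm_le st dH dK) => x hx; have hx' := srng x hx; have /andP[x0 xr] := hx'.
  have wx := wt_gt0 m1 m2 (inpi x hx').
  rewrite normrM (gtr0_norm wx).
  apply: le_trans (ler_wpM2l (ltW wx) (hc x hx')) _.
  rewrite mulrCA; apply: ler_wpM2l => //.
  have e2 : 0 <= x ^+ 2 * wt m1 m2 x by rewrite mulr_ge0 ?sqr_ge0 // ltW.
  have e3 : 0 <= x ^+ 3 * (wt m1 m2 x * frc m1 m2 x).
    by apply: mulr_ge0; [rewrite exprn_ge0 // ltW|apply: mulr_ge0; [exact: ltW|exact: hq]].
  by move: e2 e3; move: (wt m1 m2 x) (frc m1 m2 x) => A q; clear; lra.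
have hs : 0 < s <= r by apply: srng; rewrite lexx.
have ws := wt_gt0 m1 m2 (inpi s hs); have ws1 := wt_le1 m1 m2 (inpi s hs).
have Hs : `|v s + c0 * (s * wt m1 m2 s)| <= (G + `|c0|) * s.
  have -> : v s + c0 * (s * wt m1 m2 s) = wt m1 m2 s * (v s / wt m1 m2 s + c0 * s).
    by field; rewrite gt_eqF.
  rewrite normrM (gtr0_norm ws) -[leRHS]mul1r; apply: ler_pM => //; first exact: ltW.
  apply: le_trans (ler_normD _ _) _; rewrite mulrDl [`|c0 * s|]normrM (gtr0_norm s0).
  by apply: lerD => //; exact: hv.
have Ks : 0 <= C * (s ^+ 3 * wt m1 m2 s).
  by apply: mulr_ge0 => //; apply: mulr_ge0; [rewrite exprn_ge0 // ltW|exact: ltW].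
have := ler_normD (v t + c0 * (t * wt m1 m2 t) - (v s + c0 * (s * wt m1 m2 s))) (v s + c0 * (s * wt m1 m2 s)).
rewrite subrK; lra.
Qed.

(** With c0 = g u0 / (1 + m1), the slope is - c0 t up to third order, and the equation
   then shows that u'' tends to - c0 at the endpoint. *)
Lemma end_regularity m1 m2 G rho u v (u0 : R) : (0 < m1)%N -> 0 < rho <= 1 -> 0 <= G ->
  (forall del, 0 < del -> ode_sol (wt m1 m2) g del (pi - del) u v) ->
  (forall t, 0 < t <= rho -> `|v t / wt m1 m2 t| <= G * t /\ `|u t - u0| <= G * t ^+ 2) ->
  exists C r, [/\ 0 <= C, 0 < r <= 1 & forall t, 0 < t <= r ->
    `|v t / wt m1 m2 t + g u0 / (1 + m1%:R) * t| <= C * t ^+ 2 /\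
    `|- g (u t) - frc m1 m2 t * (v t / wt m1 m2 t) + g u0 / (1 + m1%:R)| <= C * t].
Proof.
move=> mm /andP[rho0 rho1] G0 sol hb.
have m1p : 1 <= m1%:R :> R by rewrite ler1n.
pose m := m1%:R + m2%:R : R.
have mp : 1 <= m by have : 0 <= m2%:R :> R; [by []|rewrite /m; lra].
pose r := Num.min rho (1 / m).
have r0 : 0 < r by rewrite lt_min rho0 divr_gt0 //; lra.
have rrho : r <= rho by rewrite ge_min lexx.
have r1 : r <= 1 by exact: le_trans rho1.
have fr t : 0 < t <= r -> `|t * frc m1 m2 t - m1%:R| <= m * t ^+ 2 /\ 0 <= frc m1 m2 t.
  move=> /andP[t0 tr]; have t1 : 0 < t <= 1 by rewrite t0 (le_trans tr).
  split; first exact: frc_near0.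
  by apply: frc_ge0_near t1 _ => //; rewrite (le_trans tr) // ge_min lexx orbT.
pose M := `|u0| + G; have M0 : 0 <= M by rewrite addr_ge0.
have [L L0 hL] := gnl_lip a_gt0 lam_gt0 M0.
set c0 := g u0 / (1 + m1%:R).
have gc0 : g u0 = c0 * (1 + m1%:R) by rewrite /c0; field; rewrite gt_eqF //; lra.
have gd t : 0 < t <= r -> `|g (u t) - g u0| <= L * G * t ^+ 2.
  move=> /andP[t0 tr]; have [_ h] := hb t ltac:(by rewrite t0 (le_trans tr)).
  rewrite -mulrA; apply: le_trans (hL _ _ _ _) _.
  - have -> : u t = u0 + (u t - u0) by ring.
    apply: le_trans (ler_normD _ _) _; rewrite /M lerD2l; apply: le_trans h _.
    have t1 : t <= 1 by exact: le_trans r1.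
    by rewrite -[leRHS]mulr1; apply: ler_wpM2l => //; nra.
  - by rewrite /M lerDl.
  - exact: ler_wpM2l.
clearbody c0 M.
pose C1 := L * G + `|c0| * m.
have C10 : 0 <= C1 by rewrite addr_ge0 ?mulr_ge0 //; lra.
have Sbound : forall t, 0 < t <= r -> `|v t / wt m1 m2 t + c0 * t| <= C1 * t ^+ 3.
  apply: (slope_expansion (G := G) r1 C10 sol).
  - by move=> t /andP[t0 tr]; have [] := hb t ltac:(by rewrite t0 (le_trans tr)).
  - by move=> t /fr[].
  move=> t ht; have [q1 _] := fr t ht; have gx := gd t ht.
  have -> : c0 * (1 + t * frc m1 m2 t) - g (u t) =
     - (g (u t) - g u0) + c0 * (t * frc m1 m2 t - m1%:R) by rewrite gc0; ring.
  apply: le_trans (ler_normD _ _) _; rewrite normrN [`|c0 * _|]normrM /C1 mulrDl.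
  by apply: lerD => //; rewrite -mulrA; exact: ler_wpM2l.
have LG : 0 <= L * G by exact: mulr_ge0.
have cm : 0 <= `|c0| * m by apply: mulr_ge0 => //; lra.
have C1m : 0 <= C1 * (m1%:R + m) by apply: mulr_ge0 => //; lra.
pose C := C1 * (1 + m1%:R + m) + L * G + `|c0| * m.
have CC1 : C1 <= C by rewrite /C; lra.
exists C, r; split => //; [exact: le_trans CC1|by rewrite r0|].
move=> t ht; have /andP[t0 tr] := ht; have t1 : t <= 1 by exact: le_trans r1.
have t2 : 0 <= t ^+ 2 by exact: sqr_ge0.
have t3 : t ^+ 3 <= t ^+ 2 by rewrite exprS; nra.
have hS := Sbound t ht; have [q1 q2] := fr t ht; have gx := gd t ht.
clear gd hL hb sol fr.
split.
  by apply: le_trans hS _; apply: ler_pM => //; exact: exprn_ge0 (ltW t0).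
have -> : - g (u t) - frc m1 m2 t * (v t / wt m1 m2 t) + c0 =
   - (g (u t) - g u0) - frc m1 m2 t * (v t / wt m1 m2 t + c0 * t) + c0 * (t * frc m1 m2 t - m1%:R).
  by rewrite gc0; ring.
have tq : t * frc m1 m2 t <= m1%:R + m.
  move: q1; rewrite ler_norml => /andP[_ h]; have : m * t ^+ 2 <= m by have : t ^+ 2 <= 1; nra.
  lra.
have tt : t ^+ 2 <= t by nra.
have e1 : `|frc m1 m2 t * (v t / wt m1 m2 t + c0 * t)| <= C1 * (m1%:R + m) * t.
  rewrite normrM (ger0_norm q2).
  apply: le_trans (_ : frc m1 m2 t * (C1 * t ^+ 3) <= _); first exact: ler_wpM2l.
  have -> : frc m1 m2 t * (C1 * t ^+ 3) = C1 * ((t * frc m1 m2 t) * t ^+ 2) by ring.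
  rewrite -[leRHS]mulrA; apply: ler_wpM2l => //; apply: ler_pM => //.
  by apply: mulr_ge0 => //; exact: ltW.
have e2 : `|c0 * (t * frc m1 m2 t - m1%:R)| <= `|c0| * m * t.
  rewrite normrM -mulrA; apply: ler_wpM2l => //; apply: le_trans q1 _.
  by apply: ler_wpM2l => //; lra.
have e3 : `|g (u t) - g u0| <= L * G * t.
  by apply: le_trans gx _; apply: ler_wpM2l => //; exact: mulr_ge0.
apply: le_trans (ler_normD _ _) _; apply: le_trans (lerD (ler_normB _ _) (lexx _)) _.
have e4 : 0 <= C1 * t by apply: mulr_ge0 => //; exact: ltW.
move: e1 e2 e3 e4; rewrite normrN /C.
by move: `|frc m1 m2 t * _| `|c0 * _| `|g (u t) - g u0| => x y z; lra.
Qed.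

End Regularity.

(** * Solutions of the boundary value problem *)

Section Assembly.
Context {R : realType}.
Implicit Types (f u v w : R -> R) (r s t b d e x y B l M G D C eps rho eta del : R) (k : nat).

(** The hypothesis m < n - 1 says that the exponent is subcritical in dimension
   m + 1. *)
Lemma subcritical_exponent (n m : nat) : (3 <= n)%N -> (m < n - 1)%N ->
  0 < crit_exp n - 1 :> R /\ (crit_exp n - 1) * (m%:R - 1) < 4 :> R.
Proof.
move=> hn hm; have n3 : 3 <= n%:R :> R by rewrite (ler_nat _ 3).
have mn : m%:R + 1 <= n%:R - 1 :> R.
  by rewrite natr1 -(natrB _ (ltac:(exact: leq_trans hn) : (1 <= n)%N)) ler_nat.
have n2 : 0 < n%:R - 2 :> R by lra.
have -> : crit_exp n - 1 = 4 / (n%:R - 2) :> R.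
  by rewrite /crit_exp; field; rewrite gt_eqF.
split; first by rewrite divr_gt0.
by rewrite mulrAC ltr_pdivrMr //; lra.
Qed.

Section Glue.
Variables (f0 f1 : R) (f : R -> R).

(** The limit solution is meaningful inside (0, pi) only, so its end values, and those
   of its derivatives, are put in by hand. *)
Definition glue t := if t <= 0 then f0 else if pi <= t then f1 else f t.

Lemma glue0 : glue 0 = f0.
Proof. by rewrite /glue lexx. Qed.

Lemma gluepi : glue pi = f1.
Proof. by rewrite /glue leNgt pi_gt0 /= lexx. Qed.

Lemma glue_in t : 0 < t < pi -> glue t = f t.
Proof. by move=> /andP[t0 tpi]; rewrite /glue leNgt t0 /= leNgt tpi. Qed.

Lemma in_segment_cases t : `[0, pi]%classic t -> [\/ t = 0, 0 < t < pi | t = pi].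
Proof.
rewrite /= in_itv /= => /andP[]; rewrite le_eqVlt => /orP[/eqP <-|t0]; first by constructor 1.
by rewrite le_eqVlt => /orP[/eqP ->|tpi]; [constructor 3|constructor 2; rewrite t0].
Qed.

(** Both the continuity of a glued function and the existence of its derivative are
   limits of some phi x y as y tends to x in [0, pi], with a rate at the ends. *)
Lemma segment_limit (phi : R -> R -> R) (l : R -> R) C r x e : 0 < r <= 1 -> 0 <= C -> 0 < e ->
  (forall t, 0 < t < pi -> exists2 d, 0 < d &
     forall y, 0 < y < pi -> 0 < `|y - t| < d -> `|phi t y - l t| < e) ->
  (forall t, 0 < t <= r -> `|phi 0 t - l 0| <= C * t /\ `|phi pi (pi - t) - l pi| <= C * t) ->
  `[0, pi]%classic x ->
  exists2 d, 0 < d & forall y, `[0, pi]%classic y -> 0 < `|y - x| < d -> `|phi x y - l x| < e.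
Proof.
move=> /andP[r0 r1] C0 e0 inner ends /in_segment_cases hx; have pi2 := @pi_ge2 R.
have C1 : 0 < C + 1 by rewrite ltr_pwDr.
pose d := Num.min r (e / (C + 1)).
have d0 : 0 < d by rewrite lt_min r0 divr_gt0.
have dr : d <= r by rewrite ge_min lexx.
have dpi : d < pi by move: dr r1 pi2; clear; lra.
have small t : 0 < t < d -> C * t < e.
  rewrite lt_min => /and3P[t0 _]; rewrite ltr_pdivlMr // => h.
  by apply: le_lt_trans h; rewrite mulrC; apply: ler_wpM2l; [exact: ltW|rewrite lerDl].
have [->|hx0|->] := hx.
- exists d => // y /in_segment_cases hy; rewrite subr0 => /andP[yn yd].
  have [y0|/andP[y0 _]|ypi] := hy; first by rewrite y0 normr0 ltxx in yn.
    rewrite gtr0_norm // in yd.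
    have [h _] := ends y ltac:(by rewrite y0 (le_trans (ltW yd))).
    by apply: le_lt_trans h (small y _); rewrite y0.
  by move: yd; rewrite ypi gtr0_norm ?pi_gt0 // ltNge ltW.
- have [s s0 hs] := inner x hx0; have /andP[x0 xp] := hx0.
  exists (Num.min s (Num.min x (pi - x))); first by rewrite !lt_min s0 x0 subr_gt0.
  move=> y _; rewrite !lt_min => /andP[h0 /and3P[h1 h2 h3]].
  by apply: hs; rewrite ?h0 //; move: h2 h3; rewrite !ltr_norml; clear; lra.
- exists d => // y /in_segment_cases hy /andP[yn yd].
  have [y0|/andP[_ y0]|ypi] := hy; last by rewrite ypi subrr normr0 ltxx in yn.
    by move: yd; rewrite y0 sub0r normrN gtr0_norm ?pi_gt0 // ltNge ltW.
  rewrite distrC gtr0_norm ?subr_gt0 // in yd.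
  have py : 0 < pi - y < d by rewrite subr_gt0 y0.
  have [_] := ends (pi - y) ltac:(by rewrite subr_gt0 y0 (le_trans (ltW yd))).
  by rewrite subKr => h; exact: le_lt_trans h (small _ py).
Qed.

Lemma glue_continuous C r : 0 < r <= 1 -> 0 <= C ->
  (forall t, 0 < t < pi -> {for t, continuous f}) ->
  (forall t, 0 < t <= r -> `|f t - f0| <= C * t /\ `|f (pi - t) - f1| <= C * t) ->
  {within `[0, pi], continuous glue}.
Proof.
move=> hr C0 cf hends; apply/subspace_continuousP => x hx.
apply: (@within_nbhs_cvg R _ glue) => e e0.
have [| |d d0 hd] := @segment_limit (fun _ => glue) glue C r x e hr C0 e0 _ _ hx.
- move=> t ht; have /cvgr_dist_lt /(_ e e0) /nbhs_ballP[s /= s0 hs] := cf t ht.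
  exists s => // y hy /andP[_ yt]; rewrite !glue_in // distrC; apply: hs.
  by rewrite /ball /= distrC.
- move=> t ht; have /andP[t0 tr] := ht; have /andP[r0 r1] := hr.
  have tpi : t < pi by apply: le_lt_trans tr (le_lt_trans r1 (lt_le_trans _ (pi_ge2 R))); rewrite ltr1n.
  have pt : 0 < pi - t < pi by rewrite subr_gt0 tpi gtrBl.
  by rewrite glue0 gluepi (glue_in pt) glue_in ?t0 //; exact: hends.
exists d => // y hy yd; have [->|yx] := eqVneq y x; first by rewrite subrr normr0.
by apply: hd; rewrite // normr_gt0 subr_eq0 yx.
Qed.

End Glue.

Lemma glue_derivative_on (f0 f1 d0 d1 : R) f f' C r : 0 < r <= 1 -> 0 <= C ->
  (forall t, 0 < t < pi -> is_derive t 1 f (f' t)) ->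
  (forall t, 0 < t <= r -> `|f t - f0 - d0 * t| <= C * t ^+ 2 /\
                           `|f (pi - t) - f1 + d1 * t| <= C * t ^+ 2) ->
  derivative_on `[0, pi] (glue f0 f1 f) (glue d0 d1 f').
Proof.
move=> hr C0 df hends x hx; apply: within_dnbhs_cvg => e e0.
apply: (@segment_limit (fun x y => (glue f0 f1 f y - glue f0 f1 f x) / (y - x))
  (glue d0 d1 f') C r x e hr C0 e0) => // t ht.
  have [s s0 hs] := difference_quotient (df t ht) e0.
  by exists s => // y hy yt; rewrite !glue_in //; exact: hs.
have /andP[t0 tr] := ht; have /andP[r0 r1] := hr; have [h1 h2] := hends t ht.
have tpi : t < pi by apply: le_lt_trans tr (le_lt_trans r1 (lt_le_trans _ (pi_ge2 R))); rewrite ltr1n.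
have quot (z : R) : `|z| <= C * t ^+ 2 -> `|z / t| <= C * t.
  by rewrite normrM normfV (gtr0_norm t0) ler_pdivrMr // -mulrA -expr2.
have pt : 0 < pi - t < pi by rewrite subr_gt0 tpi gtrBl.
have tt : 0 < t < pi by rewrite t0.
rewrite !glue0 !gluepi (glue_in _ _ _ pt) (glue_in _ _ _ tt) subr0 [pi - t - pi]addrAC subrr add0r.
split; [have := quot _ h1|have := quot _ h2; rewrite -normrN];
  by congr (`|_| <= _); field; rewrite gt_eqF.
Qed.

(** By the gradient equation 0 is a regular value, and the multiplicity of a principal
   curvature at a point of that level is positive. *)
Lemma isoparametric_mult_gt0 (n l m1 m2 : nat) (f : 'rV[R]_n.+1 -> R) :
  isoparametric_data l m1 m2 f -> [/\ (0 < l)%N, (0 < m1)%N & (0 < m2)%N].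
Proof.
case=> _ _ im ll _ curv _ _ grad _.
have l0 : (0 < l)%N by move: ll; rewrite !inE => /or4P[| | |/orP[]] /eqP ->.
have [x xS fx] : exists2 x, sphere x & f x = 0.
  have : (f @` sphere) 0 by rewrite im /= in_itv /= lerN10 ler01.
  by case=> x xS fx; exists x.
have reg : regular_level f 0.
  split; first by exists x.
  move=> y [yS fy]; apply/eqP => gy; have := grad y yS.
  rewrite gy fy expr0n subr0 mulr1 /sqnorm big1; last by move=> i _; rewrite mxE expr0n.
  by move=> /esym/eqP; rewrite expf_eq0 /= pnatr_eq0 gtn_eqF.
have [lam [mu [_ h1 h2 h3]]] := curv 0 reg.
have lev : level f 0 x by split.
have pos i : (0 < mu i)%N.
  rewrite -(h2 x i lev).
  have : principal_curvature f x (lam i) by rewrite (h1 x lev); exists i.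
  by [].
split => //.
  by have [i _ <-] : range mu m1 by rewrite h3; left.
by have [i _ <-] : range mu m2 by rewrite h3; right.
Qed.

Lemma nodal_solution (n l m1 m2 k : nat) : (3 <= n)%N -> (0 < l)%N -> (0 < m1)%N -> (0 < m2)%N ->
  (m1 < n - 1)%N -> (m2 < n - 1)%N -> (0 < k)%N ->
  exists w : R -> R, [/\ bvp_solution n l m1 m2 w, sign_changing w & zeros w #= `I_k].
Proof.
move=> hn l0 m10 m20 hm1 hm2 k0.
have [a0 s1] := subcritical_exponent hn hm1; have [_ s2] := subcritical_exponent hn hm2.
pose a : R := crit_exp n - 1.
pose lam : R := n%:R * (n%:R - 2) / (4 * l%:R ^+ 2).
have lam0 : 0 < lam.
  have n3 : 3 <= n%:R :> R by rewrite (ler_nat _ 3).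
  have l2 : 0 < 4 * l%:R ^+ 2 :> R by rewrite mulr_gt0 // exprn_gt0 // ltr0n.
  by rewrite divr_gt0 // mulr_gt0 //; move: n3; clear; lra.
have [u [v [u0 [upi [G [rho [[rho0 rho1 G0] sol ends [u00 upi0]]]]]]]] :=
  nodal_limit a0 lam0 m10 m20 s1 s2 k0.
case=> z [hz1 hz2 hz3 [tn htn un] [tp htp up]].
have hr : 0 < rho <= 1 by rewrite rho0.
have [C1 [r1 [C10 /andP[r10 r11] reg1]]] := end_regularity a0 lam0 m10 hr G0 sol
  (fun t ht => let: And4 h1 h2 _ _ := ends t ht in conj h1 h2).
have solr del (d0 : 0 < del) :
    ode_sol (wt m2 m1) (gnl a lam) del (pi - del) (fun t => u (pi - t)) (fun t => - v (pi - t)).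
  by have := ode_sol_refl (sol del d0); rewrite subKr.
have endsr := close_ends_refl ends.
have [C2 [r2 [C20 /andP[r20 r21] reg2]]] := end_regularity a0 lam0 m20 hr G0 solr
  (fun t ht => let: And4 h1 h2 _ _ := endsr t ht in conj h1 h2).
pose c1 := gnl a lam u0 / (1 + m1%:R); pose c2 := gnl a lam upi / (1 + m2%:R).
pose C := C1 + C2; pose r := Num.min r1 r2.
have C_0 : 0 <= C by rewrite addr_ge0.
have CC1 : C1 <= C by rewrite lerDl.
have CC2 : C2 <= C by rewrite lerDr.
have hr' : 0 < r <= 1 by rewrite lt_min r10 r20 ge_min r11.
have rr1 : r <= r1 by rewrite ge_min lexx.
have rr2 : r <= r2 by rewrite ge_min lexx orbT.
pose slope t := v t / wt m1 m2 t.
pose accel t := - gnl a lam (u t) - frc m1 m2 t * slope t.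
have dsol t : 0 < t < pi -> is_derive t 1 u (slope t) /\ is_derive t 1 slope (accel t).
  move=> /andP[t0 tpi]; pose d := Num.min t (pi - t).
  have d0 : 0 < d by rewrite lt_min t0 subr_gt0.
  have dt : d <= t <= pi - d by rewrite ge_min lexx lerBrDl -lerBrDr ge_min lexx orbT.
  have dpi : pi - d < pi by rewrite gtrBl.
  split; first by have [] := sol d d0 t dt.
  exact: (der_slope d0 dpi (sol d d0) dt).
have caccel t : 0 < t < pi -> {for t, continuous accel}.
  move=> ht; have [du ds] := dsol t ht; have [sn cs] := half_trig_gt0 ht.
  have dg := @der_comp R u (gnl a lam) _ _ _ (der_gnl lam a0 (u t)) du.
  have dsn := @der_comp R (fun x => x / 2) sin _ _ _ (is_derive_sin _) (der_half t).
  have dcs := @der_comp R (fun x => x / 2) cos _ _ _ (is_derive_cos _) (der_half t).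
  have dq := der_sub (der_mul (der_cst (m1%:R / 2) t) (der_mul dcs (der_inv (lt0r_neq0 sn) dsn)))
                     (der_mul (der_cst (m2%:R / 2) t) (der_mul dsn (der_inv (lt0r_neq0 cs) dcs))).
  exact: der_continuous (der_sub (der_opp dg) (der_mul dq ds)).
pose w := glue u0 upi u; pose w' := glue 0 0 slope; pose w'' := glue (- c1) (- c2) accel.
have slope_refl t : - v (pi - t) / wt m2 m1 t = - slope (pi - t).
  by rewrite /slope wt_refl mulNr.
have Ct t : 0 < t -> C1 * t <= C * t /\ C2 * t <= C * t.
  by move=> t0; rewrite !ler_pM2r.
have Ct2 t : 0 < t -> C1 * t ^+ 2 <= C * t ^+ 2 /\ C2 * t ^+ 2 <= C * t ^+ 2.
  by move=> t0; rewrite !ler_pM2r // exprn_gt0.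
have Dw : derivative_on `[0, pi] w w'.
  apply: (glue_derivative_on hr G0) => [t ht|t ht]; first by have [] := dsol t ht.
  by have [_ h1 _ h2] := ends t ht; rewrite mul0r subr0 addr0.
have Dw' : derivative_on `[0, pi] w' w''.
  apply: (glue_derivative_on hr' C_0) => [t ht|t /andP[t0 tr]].
    by have [] := dsol t ht.
  have [h1 _] := reg1 t ltac:(by rewrite t0 (le_trans tr)).
  have [h2 _] := reg2 t ltac:(by rewrite t0 (le_trans tr)).
  have [k1 k2] := Ct2 t t0.
  split; first by rewrite subr0 mulNr opprK; exact: le_trans k1.
  rewrite slope_refl in h2; rewrite subr0 -normrN opprD mulNr opprK.
  exact: le_trans k2.
have Cw'' : {within `[0, pi], continuous w''}.
  apply: (glue_continuous hr' C_0 caccel) => t /andP[t0 tr].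
  have [_ h1] := reg1 t ltac:(by rewrite t0 (le_trans tr)).
  have [_ h2] := reg2 t ltac:(by rewrite t0 (le_trans tr)).
  have [k1 k2] := Ct t t0; rewrite !opprK.
  split; first exact: le_trans k1.
  apply: le_trans k2; move: h2; rewrite slope_refl -(opprK (frc m2 m1 t)) -frc_refl.
  by rewrite mulrNN.
have wpos t : 0 < t < pi -> 0 <= t <= pi by move=> /andP[? ?]; rewrite !ltW.
exists w; split.
- exists w', w''; split => //; last by rewrite /w' glue0 gluepi.
  move=> t ht; rewrite /w /w' /w'' !glue_in // frcE // /accel /gnl /pw.
  by rewrite -/a -/lam; ring.
- exists tn, tp; rewrite /w !glue_in //; split => //; exact: wpos.
have -> : zeros w = z @` `I_k.
  apply/seteqP; split => t /=.
    case=> /in_segment_cases[->|ht|->]; rewrite /w ?glue0 ?gluepi ?glue_in // => ut.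
    by have [i ik ->] := hz3 t ht ut; exists i.
  by case=> i ik <-; have [hi ui] := hz1 i ik; split; [exact: wpos|rewrite /w glue_in].
apply: inj_card_eq => i j; rewrite !inE /= => ik jk; exact: hz2.
Qed.

End Assembly.

Theorem theorem1p2 (R : realType) (n l m1 m2 : nat)
    (f : 'rV[R]_n.+1 -> R)
    (hn : (3 <= n)%N)
    (hf : isoparametric_data l m1 m2 f)
    (hm1 : (m1 < n - 1)%N) (hm2 : (m2 < n - 1)%N) :
  exists w : nat -> R -> R,
    forall k : nat, (0 < k)%N ->
      [/\ bvp_solution n l m1 m2 (w k),
          sign_changing (w k) &
          zeros (w k) #= `I_k].
Proof.
have [l0 m10 m20] := isoparametric_mult_gt0 hf.
have /choice[w hw] : forall k, exists w : R -> R, (0 < k)%N ->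
    [/\ bvp_solution n l m1 m2 w, sign_changing w & zeros w #= `I_k].
  move=> k; have [->|k0] := posnP k; first by exists (fun=> 0).
  by have [w hw] := nodal_solution (R := R) hn l0 m10 m20 hm1 hm2 k0; exists w.
by exists w.
Qed.
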